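(* Let $m\geq 1$ be finite and let $\mathcal{A}_{m+1}=[m+1:\omega]$. \begin{enumerate} \item For every $Z\subseteq\omega$ there are $Z$-computable copies $\mathcal{T}_Z,\mathcal{S}_Z$ of $\mathcal{A}_{m+1}$ such that every isomorphism $f\colon \mathcal{T}_Z\to\mathcal{S}_Z$ computes $Z^{(2m)}$. \item $\operatorname{SR}(\mathcal{A}_{m+1}) = 2m+1$. In particular some automorphism orbit of $\mathcal{A}_{m+1}$ is not $\Sigma^{\mathrm{in}}_{2m}$-definable, while every orbit is $\Sigma^{\mathrm{in}}_{2m+1}$-definable. \item $\operatorname{SSC}(\mathcal{A}_{m+1}) \in \{\Sigma^{\mathrm{in}}_{2m+1},\ \mathrm{d}\text{-}\Sigma^{\mathrm{in}}_{2m+1},\ \Pi^{\mathrm{in}}_{2m+2}\}$. \end{enumerate}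
   Context: Trees. A tree is a structure $(T,\prec)$ in the language $\{\prec\}$ where $\prec$ is a strict partial order, the predecessors of each element form a finite linearly ordered set, and there is a $\prec$-least element, the root; trees are countable and have no infinite paths. The level of $x$ is its number of predecessors. Rank: terminal nodes have rank $0$, $\mathrm{rk}(x)=\sup\{\mathrm{rk}(y)+1: y$ an immediate successor of $x\}$, and the rank of $T$ is that of its root. For finite $n\geq1$ and $N\in\omega\cup\{\omega\}$ the tree type $[n:N]$ is defined inductively: $[1:N]$ is the tree of rank $\leq1$ whose root has exactly $N$ children; $[n:N]$ ($n\geq 2$) is the tree of rank $n$ in which exactly $N$ level-one nodes are roots of subtrees of type $[n-1:\omega]$, for every $k\in\omega$ (including $k=0$) infinitely many level-one nodes are roots of subtrees of type $[n-1:k]$, and there are no other level-one nodes. (''$\omega$ many'' and ''infinitely many'' mean countably infinitely many.) $Z^{(k)}$ is the $k$-th Turing jump of $Z$; a $Z$-computable copy is an isomorphic copy with $Z$-computable universe (a subset of $\omega$) and order. Infinitary formulas: $\Sigma^{\mathrm{in}}_0=\Pi^{\mathrm{in}}_0$ are the finitary quantifier-free formulas; for $\alpha\geq1$, a $\Sigma^{\mathrm{in}}_\alpha$ formula is a countable disjunction of formulas $\exists\bar y\,\psi$ with $\psi\in\Pi^{\mathrm{in}}_\beta$, $\beta<\alpha$, and dually $\Pi^{\mathrm{in}}_\alpha$ (countable conjunctions of $\forall\bar y\,\psi$, $\psi\in\Sigma^{\mathrm{in}}_\beta$, $\beta<\alpha$). A $\mathrm{d}\text{-}\Sigma^{\mathrm{in}}_\alpha$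 formula is a conjunction of a $\Sigma^{\mathrm{in}}_\alpha$ and a $\Pi^{\mathrm{in}}_\alpha$ formula. A Scott sentence of a countable structure is an $L_{\omega_1\omega}$ sentence whose countable models are exactly its isomorphic copies. $\operatorname{SSC}(\mathcal{A})$ (Scott sentence complexity) is the least complexity among $\Sigma^{\mathrm{in}}_\alpha,\Pi^{\mathrm{in}}_\alpha,\mathrm{d}\text{-}\Sigma^{\mathrm{in}}_\alpha$ of a Scott sentence of $\mathcal{A}$, in the ordering $\Sigma^{\mathrm{in}}_\alpha,\Pi^{\mathrm{in}}_\alpha<\mathrm{d}\text{-}\Sigma^{\mathrm{in}}_\alpha<\Sigma^{\mathrm{in}}_{\alpha+1},\Pi^{\mathrm{in}}_{\alpha+1}$ (a least one is known to exist). $\operatorname{SR}(\mathcal{A})$ is the least $\alpha$ such that every automorphism orbit of every finite tuple of $\mathcal{A}$ is definable by a parameter-free $\Sigma^{\mathrm{in}}_\alpha$ formula. ''Orbit'' means automorphism orbit of a finite tuple, and definability is without parameters. *)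

(* Defs.v *)
From HB Require Import structures.
From mathcomp Require Import all_boot.
From mathcomp Require Import boolp classical_sets functions cardinality.
From Stdlib Require Cantor.

Set Implicit Arguments.
Unset Strict Implicit.
Unset Printing Implicit Defensive.

Local Open Scope classical_set_scope.
Local Open Scope card_scope.

(** * Countable ordinals *)

(* Brouwer notations. [OSup f] denotes the supremum of the [f i]; the sequence
   need not be increasing.  Every countable ordinal has a notation, and an
   ordinal is a class of notations modulo [oeq]. *)
Inductive ord : Set :=
| OZero : ord
| OSucc : ord -> ord
| OSup : (nat -> ord) -> ord.

Inductive ole : ord -> ord -> Prop :=
| ole_zero a : ole OZero a
| ole_succ a b : ole a b -> ole (OSucc a) (OSucc b)
| ole_sup_r a f i : ole a (f i) -> ole a (OSup f)
| ole_sup_l f b : (forall i, ole (f i) b) -> ole (OSup f) b.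

Definition olt (a b : ord) : Prop := ole (OSucc a) b.
Definition oeq (a b : ord) : Prop := ole a b /\ ole b a.

Fixpoint ord_of_nat (n : nat) : ord :=
  if n is n'.+1 then OSucc (ord_of_nat n') else OZero.

(** * Structures in the language with one binary relation symbol *)

Record structure : Type := Structure {
  dom :> Type;
  prec : dom -> dom -> Prop }.

Definition isomorphism (A B : structure) (f : A -> B) : Prop :=
  bijective f /\ forall x y : A, prec x y <-> prec (f x) (f y).

Definition isomorphic (A B : structure) : Prop :=
  exists f : A -> B, isomorphism f.

Definition substructure (A : structure) (D : set A) : structure :=
  @Structure {x : A | D x} (fun x y => prec (sval x) (sval y)).

(** * Trees *)

Definition is_root (T : structure) (r : T) : Prop :=
  forall x : T, x = r \/ prec r x.

Definition imm_succ (T : structure) (x y : T) : Prop :=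
  prec x y /\ ~ exists z : T, prec x z /\ prec z y.

Definition is_tree (T : structure) : Prop :=
  (forall x : T, ~ prec x x) /\
  (forall x y z : T, prec x y -> prec y z -> prec x z) /\
  (forall x : T, finite_set [set y | prec y x]) /\
  (forall x y z : T, prec y x -> prec z x -> prec y z \/ y = z \/ prec z y) /\
  (exists r : T, is_root r) /\
  countable [set: T] /\
  (~ exists p : nat -> T, forall i, prec (p i) (p i.+1)).

Definition has_level (T : structure) (x : T) (l : nat) : Prop :=
  [set y : T | prec y x] #= `I_l.

Definition subtree (T : structure) (x : T) : structure :=
  substructure [set y | y = x \/ prec x y].

(* [rk x] is the supremum of the [rk y + 1], [y] an immediate successor of
   [x]. On a tree such a function exists and is unique up to [oeq]. *)
Definition rank_function (T : structure) (rk : T -> ord) : Prop :=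
  forall x : T,
    (forall y, imm_succ x y -> ole (OSucc (rk y)) (rk x)) /\
    (forall a, (forall y, imm_succ x y -> ole (OSucc (rk y)) a) ->
               ole (rk x) a).

Definition has_rank (T : structure) (a : ord) : Prop :=
  exists (rk : T -> ord) (r : T),
    [/\ rank_function rk, is_root r & oeq (rk r) a].

(* Elements of omega + 1. *)
Inductive natomega : Set := Fin of nat | Omega.

Definition has_card (T : Type) (D : set T) (N : natomega) : Prop :=
  match N with
  | Fin k => D #= `I_k
  | Omega => D #= [set: nat]
  end.

(* [tree_type n N T]: the structure [T] is (a copy of) the tree [n : N]. The
   tree type is only defined for positive [n]. *)
Fixpoint tree_type (n : nat) (N : natomega) (T : structure) : Prop :=
  match n with
  | 0 => False
  | n'.+1 =>
    if n' is 0 then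
      [/\ is_tree T,
          exists a, has_rank T a /\ ole a (ord_of_nat 1)
        & exists r : T, is_root r /\ has_card [set x | imm_succ r x] N]
    else
      [/\ is_tree T,
          has_rank T (ord_of_nat n),
          has_card
            [set x : T | has_level x 1 /\ tree_type n' Omega (subtree x)] N,
          forall k : nat, has_card
            [set x : T | has_level x 1 /\ tree_type n' (Fin k) (subtree x)]
            Omega
        & forall x : T, has_level x 1 ->
            tree_type n' Omega (subtree x) \/
            exists k : nat, tree_type n' (Fin k) (subtree x)]
  end.

(** * Infinitary formulas *)

(* [form n] is the type of L_{omega_1 omega} formulas with free variables among
   x_0, ..., x_(n-1). [FEx k] and [FAll k] bind the block of the last [k]
   variables. Countable families are indexed by [nat]: a finite nonempty family
   is listed with repetitions, an empty one is listed as a constant family of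
   [FFalse] or [FTrue]. *)
Inductive form (n : nat) : Type :=
| FTrue
| FFalse
| FEq (i j : 'I_n)
| FPrec (i j : 'I_n)
| FNot (phi : form n)
| FAnd (phi psi : form n)
| FOr (phi psi : form n)
| FBigAnd (phi : nat -> form n)
| FBigOr (phi : nat -> form n)
| FEx (k : nat) (phi : form (n + k))
| FAll (k : nat) (phi : form (n + k)).

Arguments FTrue {n}.
Arguments FFalse {n}.

Definition app_valuation (T : Type) (n k : nat) (v : 'I_n -> T) (w : 'I_k -> T)
    (i : 'I_(n + k)) : T :=
  match fintype.split i with inl j => v j | inr j => w j end.

Fixpoint sat (A : structure) (n : nat) (phi : form n) : ('I_n -> A) -> Prop :=
  match phi in form _ return ('I_n -> A) -> Prop with
  | FTrue => fun v => True
  | FFalse => fun v => False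
  | FEq i j => fun v => v i = v j
  | FPrec i j => fun v => prec (v i) (v j)
  | FNot phi => fun v => ~ sat phi v
  | FAnd phi psi => fun v => sat phi v /\ sat psi v
  | FOr phi psi => fun v => sat phi v \/ sat psi v
  | FBigAnd phi => fun v => forall i, sat (phi i) v
  | FBigOr phi => fun v => exists i, sat (phi i) v
  | FEx k phi => fun v => exists w : 'I_k -> A, sat phi (app_valuation v w)
  | FAll k phi => fun v => forall w : 'I_k -> A, sat phi (app_valuation v w)
  end.

Fixpoint finitary_qf (n : nat) (phi : form n) : Prop :=
  match phi with
  | FTrue | FFalse | FEq _ _ | FPrec _ _ => True
  | FNot phi => finitary_qf phi
  | FAnd phi psi | FOr phi psi => finitary_qf phi /\ finitary_qf psi
  | FBigAnd _ | FBigOr _ | FEx _ _ | FAll _ _ => False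
  end.

Inductive Sigma_in (n : nat) (a : ord) : form n -> Prop :=
| Sigma_in_zero phi : oeq a OZero -> finitary_qf phi -> Sigma_in a phi
| Sigma_in_pos (k : nat -> nat) (psi : forall i, form (n + k i))
    (b : nat -> ord) :
    (forall i, olt (b i) a) -> (forall i, Pi_in (b i) (psi i)) ->
    Sigma_in a (FBigOr (fun i => FEx (psi i)))
with Pi_in (n : nat) (a : ord) : form n -> Prop :=
| Pi_in_zero phi : oeq a OZero -> finitary_qf phi -> Pi_in a phi
| Pi_in_pos (k : nat -> nat) (psi : forall i, form (n + k i))
    (b : nat -> ord) :
    (forall i, olt (b i) a) -> (forall i, Sigma_in (b i) (psi i)) ->
    Pi_in a (FBigAnd (fun i => FAll (psi i))).

Definition dSigma_in (n : nat) (a : ord) (phi : form n) : Prop :=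
  exists psi chi : form n,
    [/\ phi = FAnd psi chi, Sigma_in a psi & Pi_in a chi].

(** * Scott analysis *)

(* The automorphism orbit of the tuple [v]. *)
Definition tuple_orbit (A : structure) (n : nat) (v : 'I_n -> A) :
    set ('I_n -> A) :=
  [set w | exists g : A -> A, isomorphism g /\ w = g \o v].

Definition Sigma_definable (A : structure) (a : ord) (n : nat)
    (X : set ('I_n -> A)) : Prop :=
  exists phi : form n,
    Sigma_in a phi /\ forall w : 'I_n -> A, sat phi w <-> X w.

Definition all_orbits_Sigma (A : structure) (a : ord) : Prop :=
  forall (n : nat) (v : 'I_n -> A), Sigma_definable a (tuple_orbit v).

Definition SR (A : structure) (a : ord) : Prop :=
  all_orbits_Sigma A a /\ forall b, all_orbits_Sigma A b -> ole a b.

Definition sentence_sat (B : structure) (phi : form 0) : Prop :=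
  forall v : 'I_0 -> B, sat phi v.

(* Countable models are nonempty and may be finite. *)
Definition Scott_sentence (A : structure) (phi : form 0) : Prop :=
  forall B : structure, inhabited B -> countable [set: B] ->
    (sentence_sat B phi <-> isomorphic A B).

Inductive complexity : Set :=
| CSigma of ord
| CPi of ord
| CdSigma of ord.

Definition has_complexity (phi : form 0) (c : complexity) : Prop :=
  match c with
  | CSigma a => Sigma_in a phi
  | CPi a => Pi_in a phi
  | CdSigma a => dSigma_in a phi
  end.

Definition complexity_ord (c : complexity) : ord :=
  match c with CSigma a | CPi a | CdSigma a => a end.

(* Sigma_a and Pi_a are incomparable and lie strictly below d-Sigma_a, which
   lies strictly below Sigma_b and Pi_b for all b > a. *)
Definition complexity_le (c d : complexity) : Prop :=
  olt (complexity_ord c) (complexity_ord d) \/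
  (oeq (complexity_ord c) (complexity_ord d) /\
   match c, d with
   | CSigma _, CSigma _ | CPi _, CPi _ | _, CdSigma _ => True
   | _, _ => False
   end).

Definition has_Scott_sentence (A : structure) (c : complexity) : Prop :=
  exists phi : form 0, has_complexity phi c /\ Scott_sentence A phi.

Definition SSC (A : structure) (c : complexity) : Prop :=
  has_Scott_sentence A c /\
  forall d, has_Scott_sentence A d -> complexity_le c d.

(** * Relative computability *)

Notation pair_code x y := (Cantor.to_nat (x, y)).

(* Programs for the unary partial functions that are partial recursive in an
   oracle; several arguments are passed through the Cantor pairing. *)
Inductive code : Set :=
| CodeZero
| CodeSucc
| CodeFst
| CodeSnd
| CodeOracle
| CodePair of code & code
| CodeComp of code & code
| CodeRec of code & code
| CodeMin of code.

(* [eval Z c x y]: program [c] with oracle [Z] halts on [x] with output [y]. *)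
Inductive eval (Z : set nat) : code -> nat -> nat -> Prop :=
| eval_zero x : eval Z CodeZero x 0
| eval_succ x : eval Z CodeSucc x x.+1
| eval_fst x y : eval Z CodeFst (pair_code x y) x
| eval_snd x y : eval Z CodeSnd (pair_code x y) y
| eval_oracle_in x : Z x -> eval Z CodeOracle x 1
| eval_oracle_out x : ~ Z x -> eval Z CodeOracle x 0
| eval_pair c d x y z :
    eval Z c x y -> eval Z d x z -> eval Z (CodePair c d) x (pair_code y z)
| eval_comp c d x y z :
    eval Z d x y -> eval Z c y z -> eval Z (CodeComp c d) x z
| eval_rec0 c d x y :
    eval Z c x y -> eval Z (CodeRec c d) (pair_code x 0) y
| eval_recS c d x n y z :
    eval Z (CodeRec c d) (pair_code x n) y ->
    eval Z d (pair_code x (pair_code n y)) z ->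
    eval Z (CodeRec c d) (pair_code x n.+1) z
| eval_min c x n (v : nat -> nat) :
    (forall i, i < n -> eval Z c (pair_code x i) (v i).+1) ->
    eval Z c (pair_code x n) 0 ->
    eval Z (CodeMin c) x n.

(* A bijective Goedel numbering of programs. *)
Fixpoint code_index (c : code) : nat :=
  match c with
  | CodeZero => 0
  | CodeSucc => 1
  | CodeFst => 2
  | CodeSnd => 3
  | CodeOracle => 4
  | CodePair c d => 4 * pair_code (code_index c) (code_index d) + 5
  | CodeComp c d => 4 * pair_code (code_index c) (code_index d) + 6
  | CodeRec c d => 4 * pair_code (code_index c) (code_index d) + 7
  | CodeMin c => 4 * code_index c + 8
  end.

Definition Turing_le (X Z : set nat) : Prop :=
  exists c : code, forall x : nat,
    (X x -> eval Z c x 1) /\ (~ X x -> eval Z c x 0).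

Definition jump (Z : set nat) : set nat :=
  [set e | exists c : code, code_index c = e /\ exists y, eval Z c e y].

Definition iter_jump (k : nat) (Z : set nat) : set nat := iter k jump Z.

(** * Computable copies *)

(* Only the restriction of [nat_prec] to [universe] is relevant. *)
Record nat_structure : Type := NatStructure {
  universe : set nat;
  nat_prec : nat -> nat -> Prop }.

Definition structure_of_nat (T : nat_structure) : structure :=
  @Structure {x : nat | universe T x}
    (fun x y => nat_prec T (sval x) (sval y)).

Coercion structure_of_nat : nat_structure >-> structure.

Definition computable_structure (Z : set nat) (T : nat_structure) : Prop :=
  Turing_le (universe T) Z /\
  Turing_le [set p | exists x y : nat, p = pair_code x y /\
               [/\ universe T x, universe T y & nat_prec T x y]] Z.

Definition computable_copy (Z : set nat) (A : structure) (T : nat_structure) :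
    Prop :=
  computable_structure Z T /\ isomorphic A T.

Definition graph (T S : nat_structure) (f : T -> S) : set nat :=
  [set p | exists x : T, p = pair_code (sval x) (sval (f x))].

(* A function between subsets of omega is used as an oracle via its graph. *)
Definition map_computes (T S : nat_structure) (f : T -> S) (X : set nat) :
    Prop :=
  Turing_le X (graph f).

(* Main.v *)
Require Import Defs.
From mathcomp Require Import all_boot.
From mathcomp Require Import boolp classical_sets functions cardinality.
From mathcomp Require Import zify.
From Stdlib Require Cantor.

(** The tree [h : Omega] is handled through levels and types. A node [x] of
    level [l] has height [n = h - l] and a type N with subtree [n : N]; N
    counts the children of type Omega, while every finite type is shared by
    infinitely many children as soon as n > 1 ([labelled]). All parts of the
    theorem rest on how much of N is visible to formulas of a given level.

    Visibility. Finite partial isomorphisms that are closed under predecessors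
    are kept as lists of pairs ([matching]). At level [s] they are required to
    preserve types of height [n] if [2n <= s], to compare them if [2n = s + 1],
    and not to restrict them otherwise. The extension step
    [matching_child] is a count: a child of type Omega can be answered as long
    as fewer such children have been used on the right than exist there. It
    yields that matchings of level [s] transport Pi_s formulas
    ([matching_transfer]), and that matchings preserving all types extend to
    isomorphisms ([scott_iso]).

    Upper bounds. By induction on [n], having type N at height [n] is
    Pi_2n-definable: it says how many children satisfy a Pi_(2n-2) formula
    ([Pdef_typed]). At the root of [h : Omega] this gives a Scott sentence that
    is Pi_2h. Non-root nodes have height at most [h - 1], and the types in a
    tuple closed under predecessors determine its orbit, so orbits are
    Sigma_(2h-1) ([ltree_orbits]).

    Lower bounds. If finitely many parameters witness a Sigma formula of level
    [2n] about a node of type [n : Omega], they can be found as well over a node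
    of type [n : p] for large finite [p]. For [n = h - 1] this shows that the
    orbit of a level-one node of type Omega is not Sigma_(2h-2), and for [n = h]
    that no Sigma_2h sentence is a Scott sentence. So the Scott sentence
    complexity is Pi_2h.

    Copies. The [2m]-th jump of Z is Sigma_2m relative to Z, because halting is
    witnessed by a finite derivation ([arith_jump]). A Pi_(n+2) predicate says
    that infinitely many numbers satisfy a Pi_n predicate ([arith_infinite]),
    and iterating this down to a decidable predicate is exactly the recipe for a
    computable tree whose type at height [m] is Omega when the given Pi_2m
    predicate holds ([coded_tree]). Comparing a copy whose level-one types encode
    the complement of the jump with one whose level-one types are decidable, an
    isomorphism computes the jump. *)

Set Implicit Arguments.
Unset Strict Implicit.
Unset Printing Implicit Defensive.

Arguments Cantor.to_nat : simpl never.

Lemma sval_inj (T : Type) (P : T -> Prop) : injective (@proj1_sig T P).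
Proof. by move=> [x Px] [y Py] /= xy; subst y; rewrite (Prop_irrelevance Px Py). Qed.

(** * Counting *)

Definition at_least (T : Type) (D : T -> Prop) (a : nat) : Prop :=
  exists f : 'I_a -> T, injective f /\ forall i, D (f i).

(** The order of omega + 1, with finite first argument. *)
Definition fits (a : nat) (N : natomega) : bool :=
  if N is Fin k then a <= k else true.

Definition counted (T : Type) (D : T -> Prop) (N : natomega) : Prop :=
  forall a, at_least D a <-> fits a N.

Lemma at_least_inj (S T : Type) (f : S -> T) (D : S -> Prop) (E : T -> Prop)
    (a : nat) :
  (forall x, D x -> E (f x)) ->
  (forall x y, D x -> D y -> f x = f y -> x = y) ->
  at_least D a -> at_least E a.
Proof.
move=> DE fI [g [gI gD]]; exists (f \o g); split=> [i j /= e|i]; last exact: DE.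
by apply: gI; apply: fI.
Qed.

Lemma at_least_sub (T : Type) (D E : T -> Prop) (a : nat) :
  (forall x, D x -> E x) -> at_least D a -> at_least E a.
Proof. by move=> DE; apply: (at_least_inj (f := id)). Qed.

Lemma at_least_leq (T : Type) (D : T -> Prop) (a b : nat) :
  b <= a -> at_least D a -> at_least D b.
Proof.
move=> ba [f [fI fD]]; exists (fun i => f (widen_ord ba i)); split=> // i j /fI.
by move/(congr1 val) => /= e; apply: val_inj.
Qed.

Lemma at_least0 (T : Type) (D : T -> Prop) : at_least D 0.
Proof. by exists (fun i : 'I_0 => False_rect T (notF (ltn_ord i))); split; case. Qed.

Lemma at_least_uniq (T : Type) (D : T -> Prop) (s : seq {classic T}) :
  uniq s -> (forall x, x \in s -> D x) -> at_least D (size s).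
Proof.
move=> us sD; exists (fun i => tnth (in_tuple s) i); split=> [i j|i].
  by move=> e; apply: (tuple_uniqP (in_tuple s) us).
by apply: sD; apply: mem_tnth.
Qed.

(** With [s] empty this also extracts an element from a count. *)
Lemma pigeonhole (T : Type) (D : T -> Prop) (s : seq {classic T}) (a : nat) :
  at_least D a -> size s < a -> exists2 x : {classic T}, D x & x \notin s.
Proof.
move=> [f [fI fD]] sa; apply: contrapT => no.
suff: a <= size s by rewrite leqNgt sa.
rewrite -[X in X <= _](size_enum_ord a).
rewrite -(size_map (f : 'I_a -> {classic T})).
apply: uniq_leq_size; first by rewrite map_inj_uniq ?enum_uniq.
move=> x /mapP[i _ ->]; apply: contrapT => /negP fi; apply: no.
by exists (f i).
Qed.

Lemma at_least_add (T : Type) (D E : T -> Prop) (x : T) (a : nat) :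
  (forall y, D y -> E y) -> E x -> ~ D x -> at_least D a -> at_least E a.+1.
Proof.
move=> DE Ex Dx [f [fI fD]].
exists (fun i => if unlift ord0 i is Some j then f j else x); split=> [i j|i].
  case: unliftP => [i'|] ->; case: unliftP => [j'|] -> //.
  - by move/fI => ->.
  - by move=> e; case: Dx; rewrite -e; apply: fD.
  - by move=> e; case: Dx; rewrite e; apply: fD.
by case: unliftP => [i'|] _ //; apply: DE.
Qed.

Lemma at_least_rem (T : Type) (D E : T -> Prop) (x : T) (a : nat) :
  (forall y, E y -> y <> x -> D y) -> at_least E a.+1 -> at_least D a.
Proof.
move=> ED [f [fI fE]].
have lift_ne (i0 : 'I_a.+1) : (forall i : 'I_a, f (lift i0 i) <> x) ->
    at_least D a.
  move=> ne; exists (fun i => f (lift i0 i)); split=> [i j /fI /lift_inj //|i].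
  exact: ED.
have [[i0 fi0]|no] := pselect (exists i, f i = x).
  apply: (lift_ne i0) => i; rewrite -fi0 => /fI /eqP.
  by rewrite eq_sym (negPf (neq_lift i0 i)).
by apply: (lift_ne ord0) => i e; apply: no; exists (lift ord0 i).
Qed.

Lemma at_least_ord (k a : nat) : at_least (fun i => i < k) a <-> a <= k.
Proof.
split=> [[f [fI fk]]|ak].
  have := @leq_card _ _ (fun i => Ordinal (fk i)).
  rewrite !card_ord; apply=> i j /(congr1 val) /=; exact: fI.
exists (fun i : 'I_a => val i); split; first exact: val_inj.
by move=> i; apply: leq_trans (ltn_ord i) ak.
Qed.

Lemma at_least_nat (a : nat) : at_least (fun _ : nat => True) a.
Proof. by exists val; split=> //; apply: val_inj. Qed.

Lemma counted_bij (S T : Type) (f : S -> T) (g : T -> S) (D : S -> Prop)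
    (E : T -> Prop) (N : natomega) :
  (forall x, D x -> E (f x)) -> (forall y, E y -> D (g y)) ->
  (forall x, D x -> g (f x) = x) -> (forall y, E y -> f (g y) = y) ->
  counted D N -> counted E N.
Proof.
move=> DE ED gf fg cD a; rewrite -cD; split.
  by apply: (at_least_inj ED) => x y Ex Ey e; rewrite -(fg _ Ex) e fg.
by apply: (at_least_inj DE) => x y Ex Ey e; rewrite -(gf _ Ex) e gf.
Qed.

Lemma counted_ext (T : Type) (D E : T -> Prop) (N : natomega) :
  (forall x, D x <-> E x) -> counted D N -> counted E N.
Proof. by move=> DE; apply: (counted_bij (f := id) (g := id)) => // x /DE. Qed.

Lemma counted_uniq (T : Type) (D : T -> Prop) (N M : natomega) :
  counted D N -> counted D M -> N = M.
Proof.
move=> cN cM; have NM a : fits a N = fits a M.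
  by apply/idP/idP => [/cN/cM|/cM/cN].
case: N M NM {cN cM} => [k|] [l|] //= NM.
- by congr Fin; apply/eqP; rewrite eqn_leq -NM leqnn NM leqnn.
- by have := NM k.+1; rewrite ltnn.
- by have := NM l.+1; rewrite ltnn.
Qed.

Lemma counted_exists (T : Type) (D : T -> Prop) : exists N, counted D N.
Proof.
have [all|] := pselect (forall a, at_least D a).
  by exists Omega => a; split.
move=> /existsNP[b nb].
have exP : exists m, `[< at_least D m >].
  by exists 0; apply/asboolP; apply: at_least0.
have ubP m : `[< at_least D m >] -> m <= b.
  move=> /asboolP Dm; rewrite leqNgt; apply/negP => /ltnW bm.
  by apply: nb; apply: at_least_leq Dm.
case: (ex_maxnP exP ubP) => k kD kmax.
exists (Fin k) => a; split=> [Da|ak]; first by apply: kmax; apply/asboolP.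
by apply: at_least_leq ak _; apply/asboolP.
Qed.

Lemma counted_omega (T : Type) (D : T -> Prop) :
  counted D Omega <-> forall a, at_least D a.
Proof. by split=> [c a|c a]; [apply/c|split]. Qed.

Lemma has_card_counted (T : Type) (D : set T) (N : natomega) :
  has_card D N -> counted D N.
Proof.
have aux (B : set nat) : (D #= B)%card -> forall a, at_least D a <-> at_least B a.
  move=> /card_set_bijP[f [fB fI fS]] a; split.
    apply: (at_least_inj (f := f)); first by move=> x /fB.
    by move=> x y Dx Dy; apply: fI; rewrite inE.
  case: a => [|a] Ba; first exact: at_least0.
  have [y0 /fS[x0 Dx0 _] _] := pigeonhole (s := [::]) Ba isT.
  have /choice[g gP] : forall y, exists x, B y -> D x /\ f x = y.
    move=> y; have [/fS[x Dx <-]|nB] := pselect (B y); last by exists x0.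
    by exists x.
  apply: (at_least_inj (f := g)) Ba; first by move=> y /gP[].
  by move=> x y /gP[_ ex] /gP[_ ey] e; rewrite -ex e ey.
case: N => [k|] /aux cD a; rewrite cD.
  by apply: iff_trans (at_least_ord k a); split; apply: at_least_sub.
by split=> // _; apply: at_least_sub (at_least_nat a).
Qed.

(** * Ordinal notations *)

Lemma ole_sup_inv (f : nat -> ord) (c : ord) :
  ole (OSup f) c -> forall i, ole (f i) c.
Proof.
move=> fc i; move e : (OSup f) fc => s fc.
elim: fc f i e => // [a g j _ IH f i e|g b gb _ f i [->]]; last exact: gb.
by apply: ole_sup_r; apply: IH e.
Qed.

Lemma ole_trans (b a c : ord) : ole a b -> ole b c -> ole a c.
Proof.
move=> ab; elim: ab c => {a b} [a c _|a b ab IH c bc|a f i _ IH c|f b _ IH c bc].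
- exact: ole_zero.
- move e : (OSucc b) bc => s bc; elim: bc e => // [s' c' sc _ [e]|s' f i _ IHc e].
    by apply: ole_succ; apply: IH; rewrite e.
  by apply: ole_sup_r; apply: IHc.
- by move/ole_sup_inv => fc; apply: IH.
- by apply: ole_sup_l => i; apply: IH.
Qed.

Lemma ole_succ_inv (a b : ord) : ole (OSucc a) (OSucc b) -> ole a b.
Proof.
move=> ab; move e : (OSucc a) ab => s ab; move e' : (OSucc b) ab => s' ab.
by case: ab e e' => // a' b' ab [->] [->].
Qed.

Lemma ole_succ_zero (a : ord) : ~ ole (OSucc a) OZero.
Proof.
move=> a0; move e : (OSucc a) a0 => s a0; move e' : OZero a0 => s' a0.
by case: a0 e e'.
Qed.

Lemma ole_nat (m n : nat) : ole (ord_of_nat m) (ord_of_nat n) <-> m <= n.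
Proof.
elim: m n => [|m IH] [|n] /=; split=> //.
- by move=> _; apply: ole_zero.
- by move=> _; apply: ole_zero.
- by move/ole_succ_zero.
- by move/ole_succ_inv/IH.
- by move/IH; apply: ole_succ.
Qed.

(** Comparison with a finite ordinal is decided classically, also for notations
    that are not normalised in any way. *)
Lemma ole_nat_total (n : nat) (b : ord) :
  ole (ord_of_nat n.+1) b \/ ole b (ord_of_nat n).
Proof.
elim: b n => [|b IH|f IH] n.
- by right; apply: ole_zero.
- case: n => [|n] /=; first by left; apply/ole_succ/ole_zero.
  by case: (IH n) => H; [left|right]; apply: ole_succ.
- have [[i fi]|no] := pselect (exists i, ole (ord_of_nat n.+1) (f i)).
    by left; apply: ole_sup_r fi.
  by right; apply: ole_sup_l => i; case: (IH i n) => // fi; case: no; exists i.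
Qed.

Lemma olt_nat_succ (b : ord) (n : nat) :
  olt b (ord_of_nat n.+1) -> ole b (ord_of_nat n).
Proof. exact: ole_succ_inv. Qed.

(** * Levels of trees *)

Record skeleton (T : structure) : Prop := Skeleton {
  sk_irr : forall x : T, ~ prec x x;
  sk_trans : forall x y z : T, prec x y -> prec y z -> prec x z;
  sk_lin : forall x y z : T,
    prec y x -> prec z x -> prec y z \/ y = z \/ prec z y;
  sk_fin : forall x : T, exists k, counted (fun y => prec y x) (Fin k);
  sk_root : exists r : T, is_root r }.

Definition graded (T : structure) (lev : T -> nat) : Prop :=
  (forall x y : T, prec x y -> lev x < lev y) /\
  (forall (y : T) l, lev y = l.+1 -> exists2 x, prec x y & lev x = l).

Lemma is_tree_skeleton (T : structure) : is_tree T -> skeleton T.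
Proof.
move=> [irr [trans [fin [lin [root _]]]]]; split=> // x.
by have [k xk] := fin x; exists k; apply: (@has_card_counted _ _ (Fin k)).
Qed.

Lemma graded_uniq (T : structure) (lev lev' : T -> nat) :
  graded lev -> graded lev' -> forall x, lev x = lev' x.
Proof.
move=> gl gl'; have le (f g : T -> nat) : graded f -> graded g -> forall x, f x <= g x.
  move=> [_ fp] [gp _] x; move e : (f x) => l.
  elim: l x e => // l IH x /fp[y yx /IH yl]; exact: leq_ltn_trans yl (gp _ _ yx).
by move=> x; apply/eqP; rewrite eqn_leq !le.
Qed.

(** The level of [x] is its number of predecessors; by linearity a predecessor
    of [x] with the most predecessors misses only itself and so lies exactly one
    level below. *)
Lemma skeleton_graded (T : structure) : skeleton T ->
  exists2 lev : T -> nat, graded lev &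
    forall x, counted (fun y => prec y x) (Fin (lev x)).
Proof.
move=> sk; have [lev levP] := choice (sk_fin sk); exists lev => //.
have levlt x y : prec x y -> lev x < lev y.
  move=> xy; apply/(levP y); apply: (at_least_add (D := fun z => prec z x) (x := x)) =>
    //.
  - by move=> z zx; apply: (sk_trans sk) zx xy.
  - exact: (sk_irr sk).
  - exact/(levP x)/leqnn.
split=> // y l yl.
have exP : exists m, `[< exists2 x, prec x y & lev x = m >].
  have y1 : at_least (fun x => prec x y) 1 by apply/(levP y); rewrite yl.
  have [x xy _] := pigeonhole (s := [::]) y1 isT.
  by exists (lev x); apply/asboolP; exists x.
have ubP m : `[< exists2 x, prec x y & lev x = m >] -> m <= l.
  by move=> /asboolP[x /levlt]; rewrite yl ltnS => xl <-.
case: (ex_maxnP exP ubP) => m /asboolP[x xy xm] mmax; exists x => //.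
apply/eqP; rewrite eqn_leq ubP /=; last by apply/asboolP; exists x.
apply/(levP x); apply: (at_least_rem (E := fun z => prec z y) (x := x)).
  move=> z zy zx; case: (sk_lin sk zy xy) => [//|[//|xz]].
  have : lev z <= m by apply: mmax; apply/asboolP; exists z.
  by rewrite leqNgt -xm levlt.
by apply/(levP y); rewrite yl /=.
Qed.

Lemma graded_anc (T : structure) (lev : T -> nat) : skeleton T -> graded lev ->
  forall (y : T) l, l < lev y -> exists2 x, prec x y & lev x = l.
Proof.
move=> sk [_ lp] y l; move e : (lev y) => n; elim: n y e => // n IH y.
move=> /lp[x xy xn]; rewrite ltnS leq_eqVlt => /orP[/eqP ->|ln]; first by exists x.
have [z zx zl] := IH x xn ln; exists z => //; exact: (sk_trans sk) zx xy.
Qed.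

Lemma graded_root (T : structure) (lev : T -> nat) (r : T) : graded lev ->
  is_root r -> forall x, lev x = 0 <-> x = r.
Proof.
move=> [lp lq] rr x; split=> [x0|->].
  by case: (rr x) => // /lp; rewrite x0.
case e : (lev r) => [//|l]; have [y yr yl] := lq _ _ e.
case: (rr y) => [yr'|/lp]; last by rewrite e yl; lia.
by move: (lp _ _ yr); rewrite yr' ltnn.
Qed.

Lemma graded_imm_succ (T : structure) (lev : T -> nat) : skeleton T ->
  graded lev -> forall x y : T, imm_succ x y <-> prec x y /\ lev y = (lev x).+1.
Proof.
move=> sk gl x y; have [lp _] := gl; split=> [[xy no]|[xy yx]].
  split=> //; have := lp _ _ xy; rewrite leq_eqVlt => /orP[/eqP -> //|lt].
  have [z zy zl] := graded_anc sk gl lt.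
  case: (sk_lin sk xy zy) => [xz|[xz|/lp]].
  - by case: no; exists z.
  - by move: zl; rewrite xz; lia.
  - by rewrite zl; lia.
split=> // -[z [/lp xz /lp zy]]; move: zy; rewrite yx; lia.
Qed.

(** * Node types *)

(** For [n > 0] this is the immediate successor relation. *)
Definition below (T : structure) (n : nat) (x y : T) : Prop :=
  prec x y /\ (n <> 0 -> ~ exists z, prec x z /\ prec z y).

(** In a tree whose depth above [x] is at most [n], the subtree of [x] is of
    type [n : N]. A leaf at the bottom gets the type Omega by convention, so
    that at every height N counts the children of type Omega. *)
Fixpoint typed (T : structure) (n : nat) (N : natomega) (x : T) : Prop :=
  if n is n'.+1 then
    [/\ counted (fun y => below n' x y /\ typed n' Omega y) N,
        n' <> 0 -> forall k,
          counted (fun y => below n' x y /\ typed n' (Fin k) y) Omega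
      & forall y, below n' x y -> exists M, typed n' M y]
  else N = Omega.

Lemma typed_uniq (T : structure) (n : nat) (N M : natomega) (x : T) :
  typed n N x -> typed n M x -> N = M.
Proof. by case: n => [-> ->|n [cN _ _] [cM _ _]] //; apply: counted_uniq cN cM. Qed.

Definition cone_map (S T : structure) (g : S -> T) (x : T) : Prop :=
  [/\ injective g, forall u v, prec u v <-> prec (g u) (g v)
    & forall y, (y = x \/ prec x y) <-> exists z, g z = y].

Lemma cone_map_id (T : structure) (r : T) : is_root r -> cone_map (@id T) r.
Proof. by move=> rr; split=> // y; split=> _; [exists y|exact: rr]. Qed.

Lemma cone_map_subtree (S T : structure) (g : S -> T) (x : T) (z : S) :
  skeleton T -> cone_map g x ->
  cone_map (fun u : subtree z => g (sval u)) (g z).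
Proof.
move=> sk [gI gp gim]; split=> [u v /gI|u v|y]; first exact: sval_inj.
  by rewrite -gp.
split=> [yz|[[u uz] /= <-]].
  have [u uy] : exists u, g u = y.
    apply/gim; case: yz => [->|zy]; first by apply/gim; exists z.
    have /gim[e|xz] : exists u, g u = g z by exists z.
      by right; rewrite -e.
    by right; apply: (sk_trans sk) xz zy.
  have uz : u = z \/ prec z u.
    by case: yz => [yz|zy]; [left; apply: gI; rewrite uy|right; apply/gp; rewrite uy].
  by exists (exist _ u uz).
by case: uz => [->|/gp]; [left|right].
Qed.

Lemma has_level_graded (S : structure) (lev : S -> nat) (x : S) (l : nat) :
  is_tree S -> graded lev -> has_level x l <-> lev x = l.
Proof.
move=> tS gl; have [lev' gl' cl] := skeleton_graded (is_tree_skeleton tS).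
rewrite (graded_uniq gl gl'); split.
  move=> /(@has_card_counted _ _ (Fin l)) c.
  by have [] := counted_uniq (cl x) c.
move=> <-; have [_ [_ [fin _]]] := tS; have [k xk] := fin x.
have [->] // := counted_uniq (cl x) (@has_card_counted _ _ (Fin k) xk).
Qed.

Lemma tree_type_is_tree (n : nat) (N : natomega) (S : structure) :
  tree_type n N S -> is_tree S.
Proof. by case: n => [//|[|n]] []. Qed.

(** This is where the rank enters: at height one, a node on level two would
    force the rank of the root to be at least two. *)
Lemma tree_type_depth (n : nat) (N : natomega) (S : structure)
    (lev : S -> nat) :
  tree_type n N S -> graded lev -> forall y, lev y <= n.
Proof.
elim: n N S lev => [//|n IH] N S lev tS gl y.
have sk := is_tree_skeleton (tree_type_is_tree tS).
have [r rr] := sk_root sk.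
case: n IH tS => [|n] IH tS.
  have [_ [a [[rk [r' [rkP rr' [ra _]]]] a1]] _] := tS.
  rewrite leqNgt; apply/negP => y2.
  have [v vl] : exists v, lev v = 2.
    move: y2; rewrite leq_eqVlt => /orP[/eqP e|y2]; first by exists y.
    by have [v _ vl] := graded_anc sk gl y2; exists v.
  have [u uv ul] := gl.2 _ _ vl; have [w wu wl] := gl.2 _ _ ul.
  have wr : w = r' by apply/(graded_root gl rr').
  have uvi : imm_succ u v by apply/(graded_imm_succ sk gl); rewrite vl ul.
  have wui : imm_succ w u by apply/(graded_imm_succ sk gl); rewrite wl ul.
  have h1 := (rkP u).1 _ uvi; have h2 := (rkP w).1 _ wui; rewrite wr in h2.
  have h3 := ole_trans (ole_succ h1) h2.
  have /ole_succ_inv/ole_succ_zero := ole_trans h3 (ole_trans ra a1).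
  by [].
have [_ _ _ _ all] := tS.
case e : (lev y) => [|l] //; rewrite ltnS.
have [z zy zl] : exists2 z, z = y \/ prec z y & lev z = 1.
  case: l e => [|l] e; first by exists y; [left|].
  have [|z zy zl] := graded_anc sk gl (y := y) (l := 1); first by rewrite e.
  by exists z; [right|].
have [M tM] : exists M, tree_type n.+1 M (subtree z).
  have z1 : has_level z 1 by apply/(has_level_graded z 1 (tree_type_is_tree tS) gl).
  by case: (all z z1) => [tz|[k tz]]; [exists Omega|exists (Fin k)].
have yz : y = z \/ prec z y by case: zy; [left|right].
have gz : @graded (subtree z) (fun u => (lev (sval u)).-1).
  split=> [[u uz] [v vz] /=|[u uz] l' /= ul].
    move=> /gl.1; suff: 0 < lev u by lia.
    by case: uz => [->|/gl.1]; lia.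
  have zu : prec z u by case: uz => // uz; move: ul; rewrite uz zl.
  have [v vu vl] := gl.2 u l'.+1 ltac:(lia).
  have vz : v = z \/ prec z v.
    case: (sk_lin sk zu vu) => [|[|/gl.1]]; [by right|by left|].
    by rewrite zl vl; lia.
  by exists (exist _ v vz) => //=; rewrite vl.
by have := IH _ _ _ tM gz (exist _ y yz); rewrite /= e.
Qed.

(** Types are read off along the cones of an ambient tree, so that the nested
    subtrees of the definition of a tree type need not be identified. *)
Lemma tree_type_typed (n : nat) (N : natomega) (S T : structure) (g : S -> T)
    (x : T) :
  tree_type n N S -> skeleton T -> cone_map g x -> typed n N x.
Proof.
elim: n N S g x => [//|n IH] N S g x tS sk cg.
have tr := tree_type_is_tree tS; have skS := is_tree_skeleton tr.
have [lev gl cl] := skeleton_graded skS.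
have [levT glT _] := skeleton_graded sk.
have [gI gp gim] := cg; have [r rr] := sk_root skS.
have gr : g r = x.
  have [z zx] : exists z, g z = x by apply/gim; left.
  case: (rr z) => [<- //|/gp]; rewrite zx.
  have /gim[//|xr rx] : exists z, g z = g r by exists r.
  by case: (sk_irr sk (sk_trans sk xr rx)).
have /choice[f fP] : forall y, exists z, (y = x \/ prec x y) -> g z = y.
  move=> y; have [/gim[z zy]|no] := pselect (y = x \/ prec x y); first by exists z.
  by exists r.
have bel z : below n x (g z) <-> imm_succ r z.
  rewrite /below -{1}gr -gp.
  split=> [[rz no]|[rz no]]; split=> //; last first.
    move=> n0 [w [xw wz]]; have [u uw] : exists u, g u = w by apply/gim; right.
    by apply: no; exists u; rewrite !gp uw gr.
  case: n IH tS no => [|n] IH tS no [w [rw wz]].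
    have := tree_type_depth tS gl z.
    by have := gl.1 _ _ rw; have := gl.1 _ _ wz; lia.
  by apply: no => //; exists (g w); rewrite -gr -!gp.
have lev1 z : imm_succ r z <-> has_level z 1.
  rewrite (has_level_graded z 1 tr gl) (graded_imm_succ skS gl).
  have r0 : lev r = 0 by apply/(graded_root gl rr).
  rewrite r0; split=> [[] //|z1]; split=> //.
  by case: (rr z) => // zr; move: z1; rewrite zr r0.
have belf y : below n x y -> imm_succ r (f y) /\ g (f y) = y.
  by move=> xy; have e := fP y (or_intror xy.1); split=> //; apply/bel; rewrite e.
have fg z : imm_succ r z -> f (g z) = z.
  by move=> /bel zr; apply: gI; apply: fP; right; case: zr.
case: n IH tS bel belf => [|n] IH tS bel belf.
  have [_ _ [r' [rr' cr]]] := tS.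
  have e : r' = r.
    by apply/(graded_root gl rr); apply/(graded_root gl rr').
  rewrite e in cr; split=> //= [|y _]; last by exists Omega.
  apply: (counted_bij (f := g) (g := f)) (has_card_counted cr) =>
    [z /bel //|y [/belf[] //]|z|y [/belf[]] //].
  exact: fg.
have [_ _ cN cK all] := tS.
have sub z M : tree_type n.+1 M (subtree z) -> typed n.+1 M (g z).
  by move=> tz; apply: (IH M (subtree z) (fun u => g (sval u))) => //;
    exact: cone_map_subtree cg.
have some z : imm_succ r z -> exists M, tree_type n.+1 M (subtree z).
  by move=> /lev1/all[|[k]]; [exists Omega|exists (Fin k)].
have sub' z M : imm_succ r z -> typed n.+1 M (g z) -> tree_type n.+1 M (subtree z).
  by move=> /some[M' tM'] /(typed_uniq (sub _ _ tM')) <-.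
have cnt M K : has_card [set z : S | has_level z 1 /\ tree_type n.+1 M (subtree z)] K ->
    counted (fun y => below n.+1 x y /\ typed n.+1 M y) K.
  move=> /has_card_counted; apply: (counted_bij (f := g) (g := f)) =>
    [z [/lev1 rz tz]|y [xy ty]|z|y].
  - by split; [apply/bel|apply: sub].
  - have [rf gf] := belf _ xy; split; first exact/lev1.
    by apply: sub' => //; rewrite gf.
  - by move=> [/lev1 + _]; apply: fg.
  - by move=> [/belf[]].
split; [exact: cnt|by move=> _ k; apply: cnt (cK k)|].
by move=> y /belf[/some[M tM] <-]; exists M; apply: sub.
Qed.

(** * Labelled trees *)

Record labelled (h : nat) (T : structure) (lev : T -> nat)
    (lab : T -> natomega) : Prop := Labelled {
  lb_skeleton : skeleton T;
  lb_graded : graded lev;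
  lb_le : forall x, lev x <= h;
  lb_leaf : forall x, lev x = h -> lab x = Omega;
  lb_omega : forall x, lev x < h ->
    counted (fun y => [/\ prec x y, lev y = (lev x).+1 & lab y = Omega]) (lab x);
  lb_fin : forall x k, (lev x).+1 < h ->
    counted (fun y => [/\ prec x y, lev y = (lev x).+1 & lab y = Fin k]) Omega }.

Lemma graded_skeleton (T : structure) (lev : T -> nat) :
  (forall x y z : T, prec x y -> prec y z -> prec x z) ->
  (forall x y z : T, prec y x -> prec z x -> prec y z \/ y = z \/ prec z y) ->
  (exists r : T, is_root r) -> graded lev -> skeleton T.
Proof.
move=> trans lin root [gl _]; split=> // [x /gl|x]; first by rewrite ltnn.
have [[k|] c] := counted_exists (fun y => prec y x); first by exists k.
have : at_least (fun l => l < lev x) (lev x).+1.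
  apply: (at_least_inj (f := lev) (D := fun y => prec y x)); last exact/c.
    by move=> y /gl.
  move=> y z yx zx e.
  by case: (lin _ _ _ yx zx) => [/gl|[//|/gl]]; rewrite e ltnn.
by move/at_least_ord; rewrite ltnn.
Qed.

Lemma below_level (h : nat) (T : structure) (lev : T -> nat) :
  skeleton T -> graded lev -> (forall x, lev x <= h) ->
  forall n x y, h - lev x = n.+1 ->
  below n x y <-> prec x y /\ lev y = (lev x).+1.
Proof.
move=> sk gl le n x y e; rewrite -(graded_imm_succ sk gl); split=> [[xy no]|[xy no]].
  split=> // -[z [xz zy]]; case: n e no => [|n] e no; last by apply: no => //; exists z.
  by have := gl.1 _ _ xz; have := gl.1 _ _ zy; have := le y; lia.
by split.
Qed.

(** Types propagate from the root upwards, because a typed node has only typed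
    children. *)
Lemma typed_labelled (h : nat) (T : structure) (lev : T -> nat) (r : T)
    (N : natomega) :
  skeleton T -> graded lev -> (forall x, lev x <= h) -> is_root r ->
  typed h N r -> exists2 lab, labelled h lev lab & lab r = N.
Proof.
move=> sk gl le rr rN.
have lr : lev r = 0 by apply/(graded_root gl rr).
have typ x : exists M, typed (h - lev x) M x.
  move e : (lev x) => l; elim: l x e => [|l IH] x e.
    by exists N; have -> : x = r by [apply/(graded_root gl rr)]; rewrite subn0.
  have [y yx yl] := gl.2 _ _ e; have [M] := IH y yl.
  have := le x; rewrite e => lh.
  have eq : h - l = (h - l.+1).+1 by lia.
  rewrite eq => -[_ _]; apply.
  by apply/(below_level sk gl le); rewrite ?yl ?e.
have [lab labP] := choice typ.
have labE n x M : h - lev x = n -> typed n M x <-> lab x = M.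
  move=> e; have := labP x; rewrite e => lx; split=> [/(typed_uniq lx)|<-] //.
exists lab; last by apply/(labE h) => //; rewrite lr subn0.
split=> // [x xh|x xh|x k xh].
- have e : h - lev x = 0 by rewrite xh subnn.
  exact/(labE 0 x Omega e).
- have e : h - lev x = (h - (lev x).+1).+1 by lia.
  have := labP x; rewrite e => -[c _ _]; apply: counted_ext c => y.
  split=> [[/(below_level sk gl le y e)[xy yl]]|[xy yl yO]].
    by move=> /(labE _ y _ (congr1 _ yl)).
  by split; [apply/(below_level sk gl le y e)|apply/(labE _ y _ (congr1 _ yl))].
- have e : h - lev x = (h - (lev x).+1).+1 by lia.
  have := labP x; rewrite e => -[_ c _]; apply: counted_ext (c _ k); last by lia.
  move=> y; split=> [[/(below_level sk gl le y e)[xy yl]]|[xy yl yO]].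
    by move=> /(labE _ y _ (congr1 _ yl)).
  by split; [apply/(below_level sk gl le y e)|apply/(labE _ y _ (congr1 _ yl))].
Qed.

Lemma labelled_typed (h : nat) (T : structure) (lev : T -> nat)
    (lab : T -> natomega) : labelled h lev lab ->
  forall n x N, h - lev x = n -> typed n N x <-> lab x = N.
Proof.
move=> lT; have [sk gl le leaf omega fin] := lT.
suff typ n x : h - lev x = n -> typed n (lab x) x.
  by move=> n x N /typ xt; split=> [/(typed_uniq xt)|<-].
elim: n x => [|n IH] x e; first by apply: leaf; have := le x; lia.
have belE y := below_level sk gl le y e.
have subE y M : below n x y -> typed n M y <-> lab y = M.
  move=> /belE[_ yl]; have yt : typed n (lab y) y by apply: IH; lia.
  by split=> [/(typed_uniq yt)|<-].
split=> [|n0 k|y xy]; last by exists (lab y); apply/subE.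
- apply: (counted_ext (D := fun y => [/\ prec x y, lev y = (lev x).+1 & lab y = Omega])).
    move=> y; split=> [[xy yl yO]|[xy]]; last by move/(subE _ _ xy); case/belE: xy.
    have xy' : below n x y by apply/belE.
    by split=> //; apply/subE.
  by apply: omega; lia.
- apply: (counted_ext (D := fun y => [/\ prec x y, lev y = (lev x).+1 & lab y = Fin k])).
    move=> y; split=> [[xy yl yO]|[xy]]; last by move/(subE _ _ xy); case/belE: xy.
    have xy' : below n x y by apply/belE.
    by split=> //; apply/subE.
  by apply: fin; lia.
Qed.

(** The order alone determines levels and types, so that isomorphisms preserve
    them. *)
Lemma labelled_iso (h : nat) (T S : structure) (f : T -> S) levT labT levS labS :
  isomorphism f -> @labelled h T levT labT -> @labelled h S levS labS ->
  forall x, levS (f x) = levT x /\ labS (f x) = labT x.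
Proof.
move=> [[g fg gf] fp] lT lS.
have gp x y : prec x y <-> prec (g x) (g y) by rewrite fp !gf.
have gr : graded (levS \o f).
  split=> [x y /fp /(lb_graded lS).1 //|y l /(lb_graded lS).2[x xy xl]].
  by exists (g x); rewrite /= ?gf //; apply/fp; rewrite gf.
have levE x : levS (f x) = levT x by apply: graded_uniq gr (lb_graded lT) x.
have lT' : labelled h levT (labS \o f).
  have cnt x M N :
      counted (fun y => [/\ prec (f x) y, levS y = (levS (f x)).+1 & labS y = M]) N ->
      counted (fun y => [/\ prec x y, levT y = (levT x).+1 & (labS \o f) y = M]) N.
    apply: (counted_bij (f := g) (g := f)) => [y|y|y _|y _] //.
      move=> [xy yl yM]; split; first by apply/fp; rewrite gf.
        by rewrite -!levE gf.
      by rewrite /= gf.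
    by move=> [/fp xy yl yM]; split=> //; rewrite !levE.
  split=> [||x|x xh|x xh|x k xh]; rewrite /=.
  - exact: lb_skeleton lT.
  - exact: lb_graded lT.
  - exact: lb_le lT x.
  - by apply: (lb_leaf lS); rewrite levE.
  - by apply: cnt; apply: (lb_omega lS); rewrite levE.
  - by apply: cnt; apply: (lb_fin lS); rewrite levE.
move=> x; split=> //.
have xt : typed (h - levT x) (labS (f x)) x.
  exact: (labelled_typed lT' (n := h - levT x) (x := x) _ erefl).2 erefl.
exact: esym ((labelled_typed lT (n := h - levT x) (x := x) _ erefl).1 xt).
Qed.

Record ltree (h : nat) : Type := LTree {
  lt_str :> structure;
  lv : lt_str -> nat;
  lb : lt_str -> natomega;
  ltP : labelled h lv lb }.
Arguments lv {h l}.
Arguments lb {h l}.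

Lemma lv_le (h : nat) (T : ltree h) (x : T) : lv x <= h.
Proof. exact: lb_le (ltP T) x. Qed.

Lemma lv_root (h : nat) (T : ltree h) (r : T) :
  is_root r -> forall x, lv x = 0 <-> x = r.
Proof. exact: graded_root (lb_graded (ltP T)). Qed.

Lemma lv_prec (h : nat) (T : ltree h) (x y : T) : prec x y -> lv x < lv y.
Proof. exact: (lb_graded (ltP T)).1. Qed.

Lemma lv_parent (h : nat) (T : ltree h) (y : T) (l : nat) :
  lv y = l.+1 -> exists2 x, prec x y & lv x = l.
Proof. exact: (lb_graded (ltP T)).2. Qed.

(** * Finite matchings of labelled trees *)

(** At height [n], agreement of N on the left with M on the right is what makes
    Pi_s formulas pass from left to right: up to level [2n - 2] types are
    invisible, at level [2n - 1] the left one must be at least as large, and from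
    level [2n] on they must be equal. *)
Definition agree (s n : nat) (N M : natomega) : Prop :=
  (2 * n <= s -> N = M) /\ (2 * n <= s.+1 -> forall a, fits a M -> fits a N).

(** The right node has enough children of type Omega to answer those that are
    chosen under the left one, as long as at most [p] nodes are ever chosen.
    Below level [2n - 2] such children can be answered by children of finite
    type. *)
Definition host (s p n : nat) (N M : natomega) : Prop :=
  2 * n <= s.+2 -> forall a, a <= p -> fits a N -> fits a M.

Definition hosting (h : nat) (T S : ltree h) (s p : nat)
    (R : seq ({classic T} * {classic S})) : Prop :=
  forall q, q \in R -> host s p (h - lv (q.1 : T)) (lb (q.1 : T)) (lb (q.2 : S)).

(** Preservation of the order is a consequence, since parents are matched with
    parents. *)
Record matching (h : nat) (T S : ltree h) (s : nat)
    (R : seq ({classic T} * {classic S})) : Prop := Matching {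
  mt_root : exists q, [/\ q \in R, is_root (q.1 : T) & is_root (q.2 : S)];
  mt_lv : forall q, q \in R -> lv (q.1 : T) = lv (q.2 : S);
  mt_agree : forall q, q \in R ->
    agree s (h - lv (q.1 : T)) (lb (q.1 : T)) (lb (q.2 : S));
  mt_parent : forall q l, q \in R -> lv (q.1 : T) = l.+1 ->
    exists q', [/\ q' \in R, prec (q'.1 : T) q.1, prec (q'.2 : S) q.2
                 & lv (q'.1 : T) = l];
  mt_inj : forall q q', q \in R -> q' \in R -> q.1 = q'.1 <-> q.2 = q'.2 }.

Definition swap (T S : Type) (R : seq ({classic T} * {classic S})) :
    seq ({classic S} * {classic T}) := [seq (q.2, q.1) | q <- R].

Lemma mem_swap (T S : Type) (R : seq ({classic T} * {classic S})) q :
  (q \in swap R) = ((q.2, q.1) \in R).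
Proof.
apply/mapP/idP => [[q' q'R ->]|qR]; first by case: q' q'R.
by exists (q.2, q.1) => //; case: q qR.
Qed.

Lemma matching_swap (h : nat) (T S : ltree h) (s s' : nat)
    (R : seq ({classic T} * {classic S})) :
  matching s R ->
  (forall q, q \in R ->
    agree s' (h - lv (q.1 : T)) (lb (q.2 : S)) (lb (q.1 : T))) ->
  matching (T := S) (S := T) s' (swap R).
Proof.
case=> -[r [rR r1 r2]] lvE _ par inj ag; split.
- by exists (r.2, r.1); rewrite mem_swap /= -surjective_pairing.
- by move=> q; rewrite mem_swap => /lvE.
- by move=> q; rewrite mem_swap => qR; have := ag _ qR; rewrite (lvE _ qR).
- move=> q l; rewrite mem_swap => qR; rewrite -(lvE _ qR) =>
    /(par _ _ qR)[q' [q'R p1 p2 pl]].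
  exists (q'.2, q'.1); rewrite mem_swap /= -surjective_pairing; split=> //.
  by rewrite -(lvE _ q'R).
- move=> q q'; rewrite !mem_swap => qR q'R.
  by have [ab ba] := inj _ _ qR q'R; split.
Qed.

Lemma matching_prec_imp (h : nat) (T S : ltree h) (s : nat)
    (R : seq ({classic T} * {classic S})) : matching s R ->
  forall q q', q \in R -> q' \in R -> prec (q.1 : T) q'.1 -> prec (q.2 : S) q'.2.
Proof.
move=> mR q q' qR; move e : (lv (q'.1 : T)) => l; elim: l q' e => [|l IH] q' e q'R qq'.
  by have := lv_prec qq'; rewrite e.
have [u [uR u1 u2 ul]] := mt_parent mR q'R e.
case: (sk_lin (lb_skeleton (ltP T)) qq' u1) => [qu|[qu|/lv_prec]].
- exact: (sk_trans (lb_skeleton (ltP S))) (IH u ul uR qu) u2.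
- by rewrite ((mt_inj mR qR uR).1 qu).
- by have := lv_prec qq'; rewrite e ul; lia.
Qed.

Lemma agree_refl (s n : nat) (N : natomega) : agree s n N N.
Proof. by split. Qed.

Lemma matching_prec (h : nat) (T S : ltree h) (s : nat)
    (R : seq ({classic T} * {classic S})) : matching s R ->
  forall q q', q \in R -> q' \in R ->
  prec (q.1 : T) q'.1 <-> prec (q.2 : S) q'.2.
Proof.
move=> mR q q' qR q'R; split; first exact: (matching_prec_imp mR).
(* At level 0 only leaves are constrained, so the swapped list is a matching. *)
have mR' : matching (T := S) (S := T) 0 (swap R).
  apply: matching_swap (mR) _ => u uR; split.
    case e : (h - lv (u.1 : T)) => [|n] // _.
    have e1 : lv (u.1 : T) = h by have := lv_le (u.1 : T); lia.
    have e2 : lv (u.2 : S) = h by rewrite -(mt_lv mR uR).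
    by rewrite (lb_leaf (ltP T) e1) (lb_leaf (ltP S) e2).
  case e : (h - lv (u.1 : T)) => [|n]; last by lia.
  have e1 : lv (u.1 : T) = h by have := lv_le (u.1 : T); lia.
  have e2 : lv (u.2 : S) = h by rewrite -(mt_lv mR uR).
  by rewrite (lb_leaf (ltP T) e1) (lb_leaf (ltP S) e2).
by apply: (matching_prec_imp mR' (q := (q.2, q.1)) (q' := (q'.2, q'.1)));
  rewrite mem_swap /= -surjective_pairing.
Qed.

(** Let [n] be the height of [d].  Children of every finite type are available
    in infinite supply. If [d] has type Omega and [s < 2n], a finite but large
    type is as good as Omega. If [d] has type Omega and [2n <= s], the answer
    needs type Omega; the children of type Omega used so far correspond to each
    other, so [d] itself witnesses that one is left over on the right. *)
Lemma matching_child (h : nat) (T S : ltree h) (s p : nat)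
    (R : seq ({classic T} * {classic S})) (q : {classic T} * {classic S}) (d : T) :
  matching s R -> hosting s p R -> size R < p ->
  q \in R -> prec (q.1 : T) d -> lv d = (lv (q.1 : T)).+1 ->
  (forall q', q' \in R -> q'.1 <> d) ->
  exists c : S, [/\ prec (q.2 : S) c, lv c = lv d,
    forall q', q' \in R -> q'.2 <> c,
    agree s (h - lv d) (lb d) (lb c) & host s p (h - lv d) (lb d) (lb c)].
Proof.
case: q => x y mR hR sR qR /= xd dl dR.
have lE : lv (x : T) = lv (y : S) := mt_lv mR qR.
have dh := lv_le d.
have yh : lv (y : S) < h by rewrite -lE -dl.
have fresh (D : S -> Prop) : (forall a, a <= (size R).+1 -> at_least D a) ->
    exists2 c : S, D c & forall q', q' \in R -> q'.2 <> c.
  move=> /(_ _ (leqnn _)) DR.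
  have [|c Dc cR] := pigeonhole (s := map snd R) DR; first by rewrite size_map.
  exists c => // q' q'R e; move/negP: cR; apply.
  by apply/mapP; exists q'.
have small k : (lv (y : S)).+1 < h -> exists c : S,
    [/\ prec (y : S) c, lv c = lv d, lb c = Fin k & forall q', q' \in R -> q'.2 <> c].
  move=> yh'; have [|c [yc cl ck] cR] := fresh (fun c =>
    [/\ prec (y : S) c, lv c = (lv (y : S)).+1 & lb c = Fin k]).
    by move=> a _; apply/(lb_fin (ltP S) k yh').
  by exists c; split=> //; rewrite cl dl lE.
have [sd|sd] := leqP (2 * (h - lv d)) s; last first.
  have yh' : (lv (y : S)).+1 < h by rewrite -lE -dl; lia.
  case e : (lb d) => [k|].
    by have [c [yc cl ck cR]] := small k yh'; exists c; rewrite ck; split.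
  have [c [yc cl ck cR]] := small p yh'; exists c; rewrite ck; split=> //.
  by split=> //; lia.
case e : (lb d) => [k|].
  have yh' : (lv (y : S)).+1 < h.
    rewrite ltn_neqAle yh andbT; apply/eqP => yh'.
    have dh' : lv d = h by rewrite dl lE.
    by rewrite (lb_leaf (ltP T) dh') in e.
  by have [c [yc cl ck cR]] := small k yh'; exists c; rewrite ck; split.
pose used (u : {classic T} * {classic S}) := `[< [/\ prec (x : T) u.1,
  lv (u.1 : T) = (lv (x : T)).+1 & lb (u.1 : T) = Omega] >].
pose U := undup [seq u <- R | used u].
have UR u : u \in U -> [/\ u \in R, prec (x : T) u.1,
    lv (u.1 : T) = (lv (x : T)).+1 & lb (u.1 : T) = Omega].
  by rewrite mem_undup mem_filter => /andP[/asboolP[]].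
have sU : size U <= size R.
  by apply: leq_trans (size_undup _) _; rewrite size_filter count_size.
have dU : uniq ((d : {classic T}) :: map fst U).
  rewrite /= map_inj_in_uniq ?undup_uniq ?andbT.
    by apply/mapP => -[u /UR[/dR uR _ _ _] /esym].
  move=> u v /UR[uR _ _ _] /UR[vR _ _ _] uv; have := (mt_inj mR uR vR).1 uv.
  by case: u v uv {uR vR} => [u1 u2] [v1 v2] /= -> ->.
have xh : lv (x : T) < h by rewrite lE.
have Ux : fits (size U).+1 (lb (x : T)).
  apply/(lb_omega (ltP T) xh).
  have -> : (size U).+1 = size ((d : {classic T}) :: map fst U) by rewrite /= size_map.
  apply: at_least_uniq => // u; rewrite inE => /orP[/eqP ->
    //|/mapP[v /UR[_ xv vl vO] ->]].
  by split.
have Uy : fits (size U).+1 (lb (y : S)).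
  apply: (hR _ qR) Ux => /=; last exact: leq_ltn_trans sR.
  by rewrite dl in sd; lia.
have /(lb_omega (ltP S) yh) yU := Uy.
have [|c [yc cl cO] cU] := pigeonhole (s := map snd U) yU; first by rewrite size_map.
exists c; rewrite cO; split=> //; first by rewrite cl dl lE.
move=> u uR uc; move/negP: cU; apply; apply/mapP; exists u => //.
have ul : lv (u.1 : T) = (lv (x : T)).+1 by rewrite (mt_lv mR uR) uc cl lE.
rewrite mem_undup mem_filter uR andbT; apply/asboolP; split=> //.
  by apply/(matching_prec mR qR uR); rewrite uc.
have [+ _] := mt_agree mR uR; rewrite ul -dl uc cO; exact.
Qed.

Lemma matching_add (h : nat) (T S : ltree h) (s : nat)
    (R : seq ({classic T} * {classic S})) (q : {classic T} * {classic S})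
    (d : T) (c : S) :
  matching s R -> q \in R ->
  prec (q.1 : T) d -> lv d = (lv (q.1 : T)).+1 ->
  prec (q.2 : S) c -> lv c = lv d ->
  (forall q', q' \in R -> q'.1 <> d) -> (forall q', q' \in R -> q'.2 <> c) ->
  agree s (h - lv d) (lb d) (lb c) ->
  matching s (((d : {classic T}), (c : {classic S})) :: R).
Proof.
move=> mR qR xd dl yc cl dR cR ca.
have inR q' : q' \in ((d : {classic T}), (c : {classic S})) :: R ->
    q' = ((d : {classic T}), (c : {classic S})) \/ q' \in R.
  by rewrite inE => /orP[/eqP|]; [left|right].
split.
- by have [r [rR r1 r2]] := mt_root mR; exists r; rewrite inE rR orbT.
- by move=> q' /inR[->//|/(mt_lv mR)].
- by move=> q' /inR[-> //|/(mt_agree mR)].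
- move=> q' l' /inR[->/=|q'R ql].
    by rewrite dl => -[<-]; exists q; rewrite inE qR orbT.
  have [u [uR u1 u2 ul]] := mt_parent mR q'R ql.
  by exists u; rewrite inE uR orbT.
- move=> q1 q2 /inR[->|q1R] /inR[->|q2R] //=.
  * by split=> [/esym/(dR _ q2R)|/esym/(cR _ q2R)].
  * by split=> [/(dR _ q1R)|/(cR _ q1R)].
  * by have := mt_inj mR q1R q2R.
Qed.

Lemma matching_root (h : nat) (T S : ltree h) (s : nat) (r : T) (r' : S) :
  is_root r -> is_root r' -> agree s h (lb r) (lb r') ->
  matching s [:: (r : {classic T}, r' : {classic S})].
Proof.
move=> rr rr' ag; have r0 : lv r = 0 by apply/(lv_root rr).
have r'0 : lv r' = 0 by apply/(lv_root rr').
split.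
- by exists (r : {classic T}, r' : {classic S}); rewrite inE eqxx.
- by move=> q /[!inE]/eqP-> /=; rewrite r0 r'0.
- by move=> q /[!inE]/eqP-> /=; rewrite r0 subn0.
- by move=> q l /[!inE]/eqP-> /=; rewrite r0.
- by move=> q q' /[!inE]/eqP-> /eqP->.
Qed.

(** The ancestors of [d] are matched first, which costs at most one pair for each
    level. *)
Lemma matching_extend (h : nat) (T S : ltree h) (s p : nat) (d : T)
    (R : seq ({classic T} * {classic S})) :
  matching s R -> hosting s p R -> size R + (lv d).+1 <= p ->
  exists R', [/\ matching s R', hosting s p R', {subset R <= R'},
    size R' <= size R + (lv d).+1 & exists2 q, q \in R' & q.1 = d].
Proof.
move=> mR hR; move e : (lv d) => l; elim: l d e => [|l IH] d e sR.
  exists R; split=> //; first by rewrite leq_addr.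
  have [r [rR r1 _]] := mt_root mR; exists r => //.
  by apply/esym/(lv_root r1).
have [[q qR qd]|no] := pselect (exists2 q, q \in R & q.1 = d).
  by exists R; split=> //; [rewrite leq_addr|exists q].
have [x xd xl] := lv_parent e.
have [|R' [mR' hR' RR' sR' [q qR' qx]]] := IH x xl; first by lia.
have [[q' q'R qd]|no'] := pselect (exists2 q, q \in R' & q.1 = d).
  by exists R'; split=> //; [lia|exists q'].
subst x; have sR'' : size R' < p by lia.
have dl : lv d = (lv (q.1 : T)).+1 by rewrite e xl.
have dR q' : q' \in R' -> q'.1 <> d by move=> q'R qd; apply: no'; exists q'.
have [c [yc cl cR ca ch]] := matching_child mR' hR' sR'' qR' xd dl dR.
exists (((d : {classic T}), (c : {classic S})) :: R'); split.
- exact: matching_add mR' qR' xd dl yc cl dR cR ca.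
- by move=> q' /[!inE]/orP[/eqP-> //|/hR'].
- by move=> q' /RR' q'R; rewrite inE q'R orbT.
- by rewrite /=; lia.
- by exists ((d : {classic T}), (c : {classic S})); rewrite // inE eqxx.
Qed.

Lemma matching_extend_seq (h : nat) (T S : ltree h) (s p : nat)
    (w : seq T) (R : seq ({classic T} * {classic S})) :
  matching s R -> hosting s p R -> size R + size w * h.+1 <= p ->
  exists R', [/\ matching s R', hosting s p R', {subset R <= R'} &
    forall i, i < size w -> forall t0 : T, exists2 q, q \in R' & q.1 = nth t0 w i].
Proof.
elim: w R => [|d w IH] R mR hR sR; first by exists R; split.
have dh := lv_le d; move: sR; rewrite /= mulSn => sR.
have [|R1 [mR1 hR1 RR1 sR1 [q qR1 qd]]] := matching_extend (d := d) mR hR; first by lia.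
have [|R2 [mR2 hR2 RR2 wR2]] := IH R1 mR1 hR1; first by lia.
exists R2; split=> // [q' /RR1/RR2 //|[_|i /wR2 //] t0 /=].
by exists q => //; apply: RR2.
Qed.

Lemma matching_extend_fun (h : nat) (T S : ltree h) (s p k : nat)
    (w : 'I_k -> T) (R : seq ({classic T} * {classic S})) :
  matching s R -> hosting s p R -> size R + k * h.+1 <= p ->
  exists R' (w' : 'I_k -> S), [/\ matching s R', hosting s p R', {subset R <= R'} &
    forall i, (w i : {classic T}, w' i : {classic S}) \in R'].
Proof.
move=> mR hR sR.
have [|R' [mR' hR' RR' wR']] := matching_extend_seq (w := [seq w i |
  i <- enum 'I_k]) mR hR.
  by rewrite size_map size_enum_ord.
have /choice[w' w'P] : forall i, exists c : S, (w i : {classic T},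
  c : {classic S}) \in R'.
  move=> i; have [|[q1 q2] qR /=] := wR' i _ (w i);
    first by rewrite size_map size_enum_ord.
  by rewrite (nth_map i) ?size_enum_ord // nth_ord_enum => <-; exists q2.
by exists R', w'; split.
Qed.

(** All heights are at most [h], so that matchings of level [2h] preserve types
    and are symmetric. *)
Lemma agree_eq (h : nat) (T S : ltree h) (R : seq ({classic T} * {classic S})) q :
  matching (2 * h) R -> q \in R -> lb (q.1 : T) = lb (q.2 : S).
Proof. by move=> mR qR; have [+ _] := mt_agree mR qR; apply; lia. Qed.

Lemma matching_eq_hosting (h p : nat) (T S : ltree h)
    (R : seq ({classic T} * {classic S})) :
  matching (2 * h) R -> hosting (2 * h) p R.
Proof. by move=> mR q qR _ a _; rewrite (agree_eq mR qR). Qed.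

Lemma matching_eq_swap (h : nat) (T S : ltree h)
    (R : seq ({classic T} * {classic S})) :
  matching (2 * h) R -> matching (T := S) (S := T) (2 * h) (swap R).
Proof.
move=> mR; apply: (matching_swap mR) => q qR.
by rewrite (agree_eq mR qR); apply: agree_refl.
Qed.

Lemma matching_eq_extend (h : nat) (T S : ltree h)
    (R : seq ({classic T} * {classic S})) (d : T) :
  matching (2 * h) R -> exists R',
    [/\ matching (2 * h) R', {subset R <= R'} & exists2 q, q \in R' & q.1 = d].
Proof.
move=> mR; have [|R' [mR' _ RR' _ dR']] := matching_extend (d := d)
  (p := size R + (lv d).+1) mR (matching_eq_hosting mR); first by [].
by exists R'.
Qed.

(** Back and forth along enumerations of both trees. *)
Lemma scott_iso (h : nat) (T S : ltree h) (R : seq ({classic T} * {classic S})) :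
  countable [set: T] -> countable [set: S] -> matching (2 * h) R ->
  exists2 f : T -> S, isomorphism f &
    forall q, q \in R -> f (q.1 : T) = (q.2 : S).
Proof.
move=> /countable_injP[iT iTI] /countable_injP[iS iSI] mR.
have step Rn : exists R', matching (2 * h) Rn.1 ->
    [/\ matching (2 * h) R', {subset Rn.1 <= R'},
        forall x : T, iT x = Rn.2 -> exists2 q, q \in R' & q.1 = x
      & forall y : S, iS y = Rn.2 -> exists2 q, q \in R' & q.2 = y].
  case: Rn => [R0 n] /=.
  have [mR0|] := pselect (matching (2 * h) R0); last by exists R0.
  have [R1 [mR1 RR1 xR1]] : exists R1, [/\ matching (2 * h) R1, {subset R0 <= R1} &
      forall x : T, iT x = n -> exists2 q, q \in R1 & q.1 = x].
    have [[x xn]|no] := pselect (exists x, iT x = n); last first.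
      by exists R0; split=> // x xn; case: no; exists x.
    have [R1 [mR1 RR1 [q qR qx]]] := matching_eq_extend x mR0.
    exists R1; split=> // x' x'n; exists q => //; rewrite qx.
    by apply: iTI; rewrite ?inE // xn.
  have [[y yn]|no] := pselect (exists y, iS y = n); last first.
    by exists R1; split=> // y yn; case: no; exists y.
  have [R2 [mR2 RR2 [q qR qy]]] := matching_eq_extend y (matching_eq_swap mR1).
  have RR2' q' : q' \in R1 -> q' \in swap R2.
    by move=> q'R; rewrite mem_swap; apply: RR2; rewrite mem_swap /= -surjective_pairing.
  exists (swap R2) => _; split.
  - exact: matching_eq_swap.
  - by move=> q' /RR1/RR2'.
  - by move=> x /xR1[q' /RR2' q'R <-]; exists q'.
  - move=> y' y'n; exists (q.2, q.1); first by rewrite mem_swap /= -surjective_pairing.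
    by rewrite /= qy; apply: iSI; rewrite ?inE // yn.
have [F FP] := choice step.
pose fix C n := if n is n'.+1 then F (C n', n') else R.
have CP n : matching (2 * h) (C n) by elim: n => [//|n IH] /=; have [] := FP (C n, n) IH.
have CS m n : m <= n -> {subset C m <= C n}.
  elim: n => [|n IH]; first by rewrite leqn0 => /eqP->.
  rewrite leq_eqVlt => /orP[/eqP-> //|mn] q /(IH mn) /=.
  by have [_ + _ _] := FP (C n, n) (CP n); apply.
have C2 m n q q' : q \in C m -> q' \in C n -> exists k, q \in C k /\ q' \in C k.
  move=> qm qn; exists (maxn m n); split; [apply: CS qm|apply: CS qn];
    by rewrite ?leq_maxl ?leq_maxr.
have /choice[f fP] : forall x : T, exists y : S, exists n, (x : {classic T},
  y : {classic S}) \in C n.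
  move=> x; have [_ _ /(_ x erefl)[[x' y] qC /= e] _] := FP (C (iT x), iT x) (CP _).
  by rewrite e in qC; exists y, (iT x).+1.
have /choice[g gP] : forall y : S, exists x : T, exists n, (x : {classic T},
  y : {classic S}) \in C n.
  move=> y; have [_ _ _ /(_ y erefl)[[x y0] qC /= e]] := FP (C (iS y), iS y) (CP _).
  by rewrite e in qC; exists x, (iS y).+1.
have inj x x' (y y' : S) m n :
    (x : {classic T}, y : {classic S}) \in C m -> (x' : {classic T},
      y' : {classic S}) \in C n ->
    x = x' <-> y = y'.
  by move=> xm xn; have [k [xk xk']] := C2 _ _ _ _ xm xn; have := mt_inj (CP k) xk xk'.
exists f.
  split.
    exists g => [x|y].
      by have [n fx] := fP x; have [m gx] := gP (f x); apply/(inj _ _ _ _ _ _ gx fx).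
    by have [n gy] := gP y; have [m fy] := fP (g y); apply/(inj _ _ _ _ _ _ fy gy).
  move=> x y; have [n fx] := fP x; have [m fy] := fP y.
  have [k [xk yk]] := C2 _ _ _ _ fx fy.
  by have := matching_prec (CP k) xk yk.
move=> [x y] qR /=; have [n fx] := fP x.
exact/(inj _ _ _ _ _ 0 fx qR).
Qed.

(** * Transfer of formulas along matchings *)

Lemma sat_qf (T S : structure) (n : nat) (phi : form n) (v : 'I_n -> T) (w : 'I_n -> S) :
  finitary_qf phi -> (forall i j, v i = v j <-> w i = w j) ->
  (forall i j, prec (v i) (v j) <-> prec (w i) (w j)) ->
  sat phi v <-> sat phi w.
Proof.
elim: phi v w => //= {n}.
- by move=> n phi IH v w q e p; have := IH v w q e p; tauto.
- by move=> n phi IH psi IH' v w [q q'] e p; have := IH v w q e p;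
    have := IH' v w q' e p; tauto.
- by move=> n phi IH psi IH' v w [q q'] e p; have := IH v w q e p;
    have := IH' v w q' e p; tauto.
Qed.

Lemma app_valuation_pair (T S : Type) (n k : nat) (v : 'I_n -> T) (w : 'I_k -> T)
    (v' : 'I_n -> S) (w' : 'I_k -> S) (P : T -> S -> Prop) :
  (forall i, P (v i) (v' i)) -> (forall i, P (w i) (w' i)) ->
  forall i, P (app_valuation v w i) (app_valuation v' w' i).
Proof. by move=> vP wP i; rewrite /app_valuation; case: fintype.split. Qed.

(** A tuple quantified on the right is answered on the left by extending the
    swapped matching at level [s - 1]; the hosting condition that this takes is
    what agreement at level [s] provides, for every [p]. *)
Lemma matching_transfer (h s : nat) (T S : ltree h)
    (R : seq ({classic T} * {classic S})) (n : nat) (phi : form n) (b : ord)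
    (v : 'I_n -> T) (w : 'I_n -> S) :
  matching s R -> (forall i, (v i : {classic T}, w i : {classic S}) \in R) ->
  ole b (ord_of_nat s) ->
  (Pi_in b phi -> sat phi v -> sat phi w) /\
  (Sigma_in b phi -> sat phi w -> sat phi v).
Proof.
elim: s T S R n phi b v w => [|s IH] T S R n phi b v w mR vw bs.
  have qf : finitary_qf phi -> sat phi v <-> sat phi w.
    move=> q; apply: (sat_qf q) => i j; first by have := mt_inj mR (vw i) (vw j).
    by have := matching_prec mR (vw i) (vw j).
  have pos (c : nat -> ord) : ~ forall i, olt (c i) b.
    by move=> /(_ 0) c0; apply: (@ole_succ_zero (c 0)); apply: ole_trans c0 bs.
  by split=> H; case: H qf => [phi' _ q qf|k psi c /pos//]; apply qf.
have qf : finitary_qf phi -> sat phi v <-> sat phi w.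
  move=> q; apply: (sat_qf q) => i j; first by have := mt_inj mR (vw i) (vw j).
  by have := matching_prec mR (vw i) (vw j).
have answer k (d : 'I_k -> S) : exists (c : 'I_k -> T) R',
    matching (T := S) (S := T) s R' /\ forall i,
      (app_valuation w d i : {classic S}, app_valuation v c i : {classic T}) \in R'.
  have mR' : matching (T := S) (S := T) s (swap R).
    apply: matching_swap (mR) _ => q qR; have [eq le] := mt_agree mR qR.
    by split=> sn; [rewrite eq //; lia|rewrite eq].
  have hR' : hosting (T := S) (S := T) s (size (swap R) + k * h.+1) (swap R).
    move=> q; rewrite mem_swap => qR sn a _ /=; have [_] := mt_agree mR qR.
    by rewrite /= (mt_lv mR qR) /=; move=> /(_ sn a).
  have [R' [c [mR'' _ RR' dc]]] := matching_extend_fun d mR' hR' (leqnn _).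
  exists c, R'; split=> //; apply: (app_valuation_pair
    (P := fun (y : S) (x : T) => (y : {classic S}, x : {classic T}) \in R')) => // i.
  by apply: RR'; rewrite mem_swap; apply: vw.
have low (c : ord) : olt c b -> ole c (ord_of_nat s).
  by move=> cb; apply: olt_nat_succ; apply: ole_trans cb bs.
split=> H; case: H qf => {phi} [phi _ q /(_ q) [//]|k psi c cb cP _ /=].
  move=> vP i d; have [d' [R' [mR' dR']]] := answer _ d.
  by apply: (IH S T R' _ _ _ _ _ mR' dR' (low _ (cb i))).2 (cP i) (vP i d').
move=> [i [d dP]]; exists i; have [d' [R' [mR' dR']]] := answer _ d.
exists d'; exact: (IH S T R' _ _ _ _ _ mR' dR' (low _ (cb i))).1 (cP i) dP.
Qed.

(** * Definable queries *)

Scheme Sigma_in_mut := Minimality for Sigma_in Sort Prop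
  with Pi_in_mut := Minimality for Pi_in Sort Prop.

Combined Scheme Sigma_Pi_in_mut from Sigma_in_mut, Pi_in_mut.

Definition lift_ren (n n' k : nat) (f : 'I_n -> 'I_n') (i : 'I_(n + k)) : 'I_(n' + k) :=
  match fintype.split i with inl j => lshift k (f j) | inr j => rshift n' j end.

Fixpoint rename (n : nat) (phi : form n) : forall n', ('I_n -> 'I_n') -> form n' :=
  match phi with
  | FTrue => fun n' f => FTrue
  | FFalse => fun n' f => FFalse
  | FEq i j => fun n' f => FEq (f i) (f j)
  | FPrec i j => fun n' f => FPrec (f i) (f j)
  | FNot phi => fun n' f => FNot (rename phi f)
  | FAnd phi psi => fun n' f => FAnd (rename phi f) (rename psi f)
  | FOr phi psi => fun n' f => FOr (rename phi f) (rename psi f)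
  | FBigAnd phi => fun n' f => FBigAnd (fun i => rename (phi i) f)
  | FBigOr phi => fun n' f => FBigOr (fun i => rename (phi i) f)
  | FEx k phi => fun n' f => FEx (rename phi (lift_ren (k := k) f))
  | FAll k phi => fun n' f => FAll (rename phi (lift_ren (k := k) f))
  end.

Lemma app_valuation_l (T : Type) (n k : nat) (v : 'I_n -> T) (w : 'I_k -> T) i :
  app_valuation v w (lshift k i) = v i.
Proof.
rewrite /app_valuation; case: fintype.splitP => j /= e.
  by congr v; apply: val_inj.
by have := ltn_ord i; rewrite e; lia.
Qed.

Lemma app_valuation_r (T : Type) (n k : nat) (v : 'I_n -> T) (w : 'I_k -> T) i :
  app_valuation v w (rshift n i) = w i.
Proof.
rewrite /app_valuation; case: fintype.splitP => j /= e.
  by have := ltn_ord j; rewrite -e; lia.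
by congr w; apply: val_inj => /=; lia.
Qed.

Lemma app_valuation_lE (T : Type) (n k : nat) (v : 'I_n -> T) (w : 'I_k -> T) :
  app_valuation v w \o lshift k = v.
Proof. by apply/funext => i; apply: app_valuation_l. Qed.

Lemma app_valuation_rE (T : Type) (n k : nat) (v : 'I_n -> T) (w : 'I_k -> T) :
  app_valuation v w \o @rshift n _ = w.
Proof. by apply/funext => i; apply: app_valuation_r. Qed.

Lemma app_valuation_split (T : Type) (n k : nat) (v : 'I_(n + k) -> T) :
  app_valuation (v \o lshift k) (v \o @rshift n _) = v.
Proof.
by apply/funext => i; rewrite /app_valuation -{2}(splitK i); case: fintype.split.
Qed.

Lemma sat_rename (T : structure) (n : nat) (phi : form n) :
  forall n' (f : 'I_n -> 'I_n') (v : 'I_n' -> T),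
  sat (rename phi f) v <-> sat phi (v \o f).
Proof.
have lr m m' k (f : 'I_m -> 'I_m') (v : 'I_m' -> T) (w : 'I_k -> T) :
    app_valuation v w \o lift_ren (k := k) f = app_valuation (v \o f) w.
  apply/funext => i; rewrite /= /lift_ren [RHS]/app_valuation.
  by case: fintype.split => j; rewrite ?app_valuation_l ?app_valuation_r.
elim: phi => //= {n}.
- by move=> n phi IH n' f v; rewrite IH.
- by move=> n phi IH psi IH' n' f v; rewrite IH IH'.
- by move=> n phi IH psi IH' n' f v; rewrite IH IH'.
- by move=> n phi IH n' f v; split=> H i; apply/IH/H.
- by move=> n phi IH n' f v; split=> -[i /IH H]; exists i.
- by move=> n k phi IH n' f v; split=> -[w H]; exists w; [rewrite -lr;
    apply/IH|apply/IH; rewrite lr].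
- by move=> n k phi IH n' f v; split=> H w; [rewrite -lr; apply/IH|apply/IH; rewrite lr].
Qed.

Lemma qf_rename (n : nat) (phi : form n) : finitary_qf phi ->
  forall n' (f : 'I_n -> 'I_n'), finitary_qf (rename phi f).
Proof.
elim: phi => //= {n}.
- by move=> n phi IH psi IH' [q q'] n' f; split; [apply (IH q)|apply (IH' q')].
- by move=> n phi IH psi IH' [q q'] n' f; split; [apply (IH q)|apply (IH' q')].
Qed.

Lemma Sigma_Pi_rename (n : nat) (a : ord) :
  (forall phi : form n, Sigma_in a phi ->
    forall n' (f : 'I_n -> 'I_n'), Sigma_in a (rename phi f)) /\
  (forall phi : form n, Pi_in a phi ->
    forall n' (f : 'I_n -> 'I_n'), Pi_in a (rename phi f)).
Proof.
move: n a; apply: (Sigma_Pi_in_mut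
  (P := fun n a phi => forall n' (f : 'I_n -> 'I_n'), Sigma_in a (rename phi f))
  (P0 := fun n a phi => forall n' (f : 'I_n -> 'I_n'), Pi_in a (rename phi f)))
  => [n a phi a0 q n' f|n a k psi b ba _ IH n' f|n a phi a0 q n' f
     |n a k psi b ba _ IH n' f] /=.
- by apply: Sigma_in_zero => //; apply: qf_rename.
- by apply: (Sigma_in_pos (psi := fun i => rename (psi i) (lift_ren (k := k i) f)) ba).
- by apply: Pi_in_zero => //; apply: qf_rename.
- by apply: (Pi_in_pos (psi := fun i => rename (psi i) (lift_ren (k := k i) f)) ba).
Qed.

Fixpoint dual (n : nat) (phi : form n) : form n :=
  match phi with
  | FBigAnd phi => FBigOr (fun i => dual (phi i))
  | FBigOr phi => FBigAnd (fun i => dual (phi i))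
  | FEx k phi => FAll (dual phi)
  | FAll k phi => FEx (dual phi)
  | phi => FNot phi
  end.

Lemma sat_dual (T : structure) (n : nat) (phi : form n) :
  forall v : 'I_n -> T, sat (dual phi) v <-> ~ sat phi v.
Proof.
elim: phi => //= {n}.
- move=> n phi IH v; split=> [[i /IH H] /(_ i)//|/existsNP[i H]].
  by exists i; apply/IH.
- by move=> n phi IH v; split=> [H [i Hi]|H i];
    [apply: (IH i v).1 (H i) Hi|apply/IH => Hi; apply: H; exists i].
- by move=> n k phi IH v; split=> [H [w Hw]|H w];
    [apply: (IH _).1 (H w) Hw|apply/IH => Hw; apply: H; exists w].
- move=> n k phi IH v; split=> [[w /IH H] /(_ w)//|/existsNP[w H]].
  by exists w; apply/IH.
Qed.

Lemma Sigma_Pi_dual (n : nat) (a : ord) :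
  (forall phi : form n, Sigma_in a phi -> Pi_in a (dual phi)) /\
  (forall phi : form n, Pi_in a phi -> Sigma_in a (dual phi)).
Proof.
have qf m (phi : form m) : finitary_qf phi -> finitary_qf (dual phi).
  by case: phi.
move: n a; apply: (Sigma_Pi_in_mut (P := fun n a (phi : form n) => Pi_in a (dual phi))
  (P0 := fun n a (phi : form n) => Sigma_in a (dual phi))) =>
    [n a phi a0 q|n a k psi b ba _ IH|n a phi a0 q|n a k psi b ba _ IH] /=.
- by apply: Pi_in_zero => //; apply: qf.
- exact: (Pi_in_pos (psi := fun i => dual (psi i)) ba).
- by apply: Sigma_in_zero => //; apply: qf.
- exact: (Sigma_in_pos (psi := fun i => dual (psi i)) ba).
Qed.

(** Closure properties are easier to use for the predicates that formulas define
    in all structures at once than for the formulas. *)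
Definition query (n : nat) : Type := forall B : structure, ('I_n -> B) -> Prop.

Definition Sdef (a n : nat) (Q : query n) : Prop :=
  exists2 phi : form n, Sigma_in (ord_of_nat a) phi &
    forall (B : structure) (v : 'I_n -> B), sat phi v <-> Q B v.

Definition Pdef (a n : nat) (Q : query n) : Prop :=
  exists2 phi : form n, Pi_in (ord_of_nat a) phi &
    forall (B : structure) (v : 'I_n -> B), sat phi v <-> Q B v.

Lemma Pdef_ext (a n : nat) (Q Q' : query n) :
  (forall B v, Q B v <-> Q' B v) -> Pdef a Q -> Pdef a Q'.
Proof. by move=> QQ [phi pP phiE]; exists phi => // B v; rewrite phiE. Qed.

Lemma Sdef_ext (a n : nat) (Q Q' : query n) :
  (forall B v, Q B v <-> Q' B v) -> Sdef a Q -> Sdef a Q'.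
Proof. by move=> QQ [phi pP phiE]; exists phi => // B v; rewrite phiE. Qed.

Lemma Sdef_neg (a n : nat) (Q : query n) :
  Pdef a Q -> Sdef a (fun B v => ~ Q B v).
Proof.
move=> [phi pP phiE]; exists (dual phi); first exact: (Sigma_Pi_dual _ _).2.
by move=> B v; rewrite sat_dual phiE.
Qed.

Lemma Pdef_neg (a n : nat) (Q : query n) :
  Sdef a Q -> Pdef a (fun B v => ~ Q B v).
Proof.
move=> [phi pP phiE]; exists (dual phi); first exact: (Sigma_Pi_dual _ _).1.
by move=> B v; rewrite sat_dual phiE.
Qed.

Lemma Sdef_negK (a n : nat) (Q : query n) :
  Pdef a (fun B v => ~ Q B v) -> Sdef a Q.
Proof.
move=> /Sdef_neg; apply: Sdef_ext => B v; split=> [/contrapT //|q]; exact.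
Qed.

Lemma Pdef_ren (a n n' : nat) (f : 'I_n -> 'I_n') (Q : query n) :
  Pdef a Q -> Pdef a (fun B v => Q B (v \o f)).
Proof.
move=> [phi pP phiE]; exists (rename phi f); first exact: (Sigma_Pi_rename _ _).2.
by move=> B v; rewrite sat_rename phiE.
Qed.

Lemma Sdef_ren (a n n' : nat) (f : 'I_n -> 'I_n') (Q : query n) :
  Sdef a Q -> Sdef a (fun B v => Q B (v \o f)).
Proof.
move=> [phi pP phiE]; exists (rename phi f); first exact: (Sigma_Pi_rename _ _).1.
by move=> B v; rewrite sat_rename phiE.
Qed.

Lemma olt_nat (a b : nat) : a < b -> olt (ord_of_nat a) (ord_of_nat b).
Proof. by move=> ab; apply/(ole_nat a.+1 b). Qed.

Lemma Sdef_exists (a n k : nat) (Q : forall B : structure, ('I_n -> B) -> ('I_k ->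
  B) -> Prop) :
  Pdef a (fun B (u : 'I_(n + k) -> B) => Q B (u \o lshift k) (u \o @rshift n _)) ->
  Sdef a.+1 (fun B v => exists w, Q B v w).
Proof.
move=> [phi pP phiE]; exists (FBigOr (fun _ : nat => FEx phi)).
  by apply: (Sigma_in_pos (b := fun _ => ord_of_nat a)) => // i; apply: olt_nat.
move=> B v /=; split=> [[_ [w /phiE]]|[w H]].
  by rewrite app_valuation_lE app_valuation_rE; exists w.
by exists 0, w; apply/phiE; rewrite app_valuation_lE app_valuation_rE.
Qed.

Lemma Pdef_forall (a n k : nat) (Q : forall B : structure, ('I_n -> B) -> ('I_k ->
  B) -> Prop) :
  Sdef a (fun B (u : 'I_(n + k) -> B) => Q B (u \o lshift k) (u \o @rshift n _)) ->
  Pdef a.+1 (fun B v => forall w, Q B v w).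
Proof.
move=> [phi pP phiE]; exists (FBigAnd (fun _ : nat => FAll phi)).
  by apply: (Pi_in_pos (b := fun _ => ord_of_nat a)) => // i; apply: olt_nat.
move=> B v /=; split=> [H w|H _ w].
  by have /phiE := H 0 w; rewrite app_valuation_lE app_valuation_rE.
by apply/phiE; rewrite app_valuation_lE app_valuation_rE.
Qed.

Lemma Sdef_P (a n : nat) (Q : query n) : Pdef a Q -> Sdef a.+1 Q.
Proof.
move=> QP; have : Sdef a.+1 (fun B v => exists w : 'I_0 -> B, Q B v).
  by apply: Sdef_exists; apply: (Pdef_ren (lshift 0)) QP.
apply: Sdef_ext => B v; split=> [[] //|q];
  exists (fun i : 'I_0 => False_rect B (notF (ltn_ord i))).
exact: q.
Qed.

Lemma Pdef_S (a n : nat) (Q : query n) : Sdef a Q -> Pdef a.+1 Q.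
Proof.
move=> /Pdef_neg/Sdef_P/Pdef_neg; apply: Pdef_ext => B v.
by split=> [/contrapT //|q]; exact.
Qed.

Lemma Sdef_in (a n : nat) (b : ord) (phi : form n) :
  Sigma_in b phi -> ole b (ord_of_nat a) -> Sdef a (fun B v => sat phi v).
Proof.
move=> pS; case: pS => {phi} [phi _ q|k psi c cb cP] ba; last first.
  exists (FBigOr (fun i => FEx (psi i))) => //.
  by apply: (Sigma_in_pos (b := c)) => // i; apply: ole_trans (cb i) ba.
move: {b ba} phi q; elim: a.
  by move=> phi q; exists phi => //; apply: Sigma_in_zero => //; split; apply: ole_zero.
move=> a IH phi q; apply: Sdef_P; have := IH (FNot phi) q => /Pdef_neg.
by apply: Pdef_ext => B v /=; split=> [/contrapT //|p]; exact.
Qed.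

Lemma Pdef_in (a n : nat) (b : ord) (phi : form n) :
  Pi_in b phi -> ole b (ord_of_nat a) -> Pdef a (fun B v => sat phi v).
Proof.
move=> /(Sigma_Pi_dual _ _).2/Sdef_in/[apply]/Pdef_neg; apply: Pdef_ext => B v.
by rewrite sat_dual; split=> [/contrapT //|p]; exact.
Qed.

Lemma Sdef_leq (a b n : nat) (Q : query n) : a <= b -> Sdef a Q -> Sdef b Q.
Proof.
by move=> ab [phi pS phiE]; apply: Sdef_ext phiE (Sdef_in pS _); apply/ole_nat.
Qed.

Lemma Pdef_leq (a b n : nat) (Q : query n) : a <= b -> Pdef a Q -> Pdef b Q.
Proof.
by move=> ab [phi pS phiE]; apply: Pdef_ext phiE (Pdef_in pS _); apply/ole_nat.
Qed.

Lemma Pdef_zero (n : nat) (Q : query n) : Pdef 0 Q <->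
  exists2 phi : form n, finitary_qf phi & forall B v, @sat B n phi v <-> Q B v.
Proof.
split=> -[phi pP phiE]; exists phi => //; last first.
  by apply: Pi_in_zero => //; split; apply: ole_zero.
case: pP phiE => // k psi b /(_ 0) b0; by have := ole_succ_zero b0.
Qed.

Lemma Pdef_qf (a n : nat) (phi : form n) :
  finitary_qf phi -> Pdef a (fun B v => sat phi v).
Proof. by move=> q; apply: (@Pdef_leq 0) => //; apply/Pdef_zero; exists phi. Qed.

Lemma Sdef_qf (a n : nat) (phi : form n) :
  finitary_qf phi -> Sdef a (fun B v => sat phi v).
Proof.
move=> q; apply: Sdef_negK; exact: (@Pdef_qf a n (FNot phi)).
Qed.

Lemma Pdef_const (a n : nat) (P : Prop) : Pdef a (fun B (v : 'I_n -> B) => P).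
Proof.
have [p|p] := pselect P; first by apply: Pdef_ext (@Pdef_qf a n FTrue I).
by apply: Pdef_ext (@Pdef_qf a n FFalse I).
Qed.

(** The conjuncts of countably many Pi formulas are merged into one list. *)
Lemma Pdef_bigand (a n : nat) (Q : nat -> query n) :
  (forall i, Pdef a.+1 (Q i)) -> Pdef a.+1 (fun B v => forall i, Q i B v).
Proof.
move=> QP.
have /choice[F FP] : forall i, exists F : nat -> {k : nat & form (n + k)},
    (forall j, Sdef a (fun B v => sat (tagged (F j)) v)) /\
    forall B v, Q i B v <-> forall j w, @sat B _ (tagged (F j)) (app_valuation v w).
  move=> i; have [phi pP phiE] := QP i; case: pP phiE => {phi}.
    by move=> phi [/ole_succ_zero].
  move=> k psi b ba bS psiE; exists (fun j => Tagged (fun k => form (n + k)) (psi j));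
    split.
    by move=> j; apply: Sdef_in (bS j) _; apply: olt_nat_succ.
  by move=> B v; rewrite -psiE.
pose conj m (B : structure) (v : 'I_n -> B) : Prop :=
  if unpickle m is Some (i, j) then
    forall w, @sat B _ (tagged (F i j)) (app_valuation v w) else True.
have /choice[G GP] : forall m, exists G : {k : nat & form (n + k)},
    Sigma_in (ord_of_nat a) (tagged G) /\ forall B v, conj m B v <->
      (forall w, @sat B _ (tagged G) (app_valuation v w)).
  move=> m; rewrite /conj; case: (unpickle m : option (nat * nat)) => [[i j]|].
    have [phi pS phiE] := (FP i).1 j; exists (Tagged (fun k => form (n + k)) phi).
    by split=> // B v; split=> H w; apply/phiE.
  have [phi pS phiE] := @Sdef_qf a (n + 0) FTrue I.
  by exists (Tagged (fun k => form (n + k)) phi); split=> // B v; split=> // _ w;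
    apply/phiE.
exists (FBigAnd (fun m => FAll (tagged (G m)))).
  apply: (Pi_in_pos (b := fun _ => ord_of_nat a)) => m; first exact: olt_nat.
  exact: (GP m).1.
move=> B v /=; split=> [H i|H m].
  apply/(FP i).2 => j; have /(GP _).2 := H (pickle (i, j)).
  by rewrite /conj pickleK.
apply/(GP m).2; rewrite /conj; case: (unpickle m : option (nat * nat)) => [[i j]|//] w.
exact: ((FP i).2 B v).1.
Qed.

Lemma Sdef_bigor (a n : nat) (Q : nat -> query n) :
  (forall i, Sdef a.+1 (Q i)) -> Sdef a.+1 (fun B v => exists i, Q i B v).
Proof.
move=> QS; apply: Sdef_negK; have := Pdef_bigand (fun i => Pdef_neg (QS i)).
by apply: Pdef_ext => B v; split=> [H [i]|H i q]; [apply: H|apply: H; exists i].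
Qed.

Lemma Sdef_or (a n : nat) (Q Q' : query n) :
  Sdef a.+1 Q -> Sdef a.+1 Q' -> Sdef a.+1 (fun B v => Q B v \/ Q' B v).
Proof.
move=> qS qS'.
have : Sdef a.+1 (fun B v => exists i, (if i is 0 then Q else Q') B v).
  by apply: Sdef_bigor => -[].
apply: Sdef_ext => B v; split=> [[[|i] q]|[q|q]];
  [by left|by right|by exists 0|by exists 1].
Qed.

Lemma Pdef_all_ord (a n k : nat) (Q : 'I_k -> query n) :
  (forall i, Pdef a (Q i)) -> Pdef a (fun B v => forall i, Q i B v).
Proof.
case: a => [|a] QP.
  have /choice[F FP] : forall i, exists phi : form n,
      finitary_qf phi /\ forall B v, @sat B n phi v <-> Q i B v.
    by move=> i; have /Pdef_zero[phi q phiE] := QP i; exists phi.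
  apply/Pdef_zero; exists (foldr (fun i phi => FAnd (F i) phi) FTrue (enum 'I_k)).
    by elim: (enum _) => //= i s IH; split=> //; apply: (FP i).1.
  move=> B v; transitivity (forall i, i \in enum 'I_k -> Q i B v); last first.
    by split=> [H i|H i _ //]; apply: H; rewrite mem_enum.
  elim: (enum _) => [|i s IH] //=; split=> [[/(FP i).2 q /IH H] j|H].
    by rewrite inE => /orP[/eqP -> //|/H].
  split; first by apply/(FP i).2/H; rewrite inE eqxx.
  by apply/IH => j js; apply: H; rewrite inE js orbT.
have : Pdef a.+1 (fun B v => forall m : nat,
    if insub m is Some i then Q i B v else True).
  apply: Pdef_bigand => m; case: insub => [i|]; [exact: QP|exact: Pdef_const].
apply: Pdef_ext => B v; split=> [H i|H m]; last by case: insub.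
by have := H i; rewrite valK.
Qed.

Lemma Pdef_and (a n : nat) (Q Q' : query n) :
  Pdef a Q -> Pdef a Q' -> Pdef a (fun B v => Q B v /\ Q' B v).
Proof.
move=> qP qP'.
have : Pdef a (fun B v => forall i : 'I_2, (if val i is 0 then Q else Q') B v).
  by apply: Pdef_all_ord => -[[|i] ih].
apply: Pdef_ext => B v; split=> [H|[q q'] [[|i] ih] //].
by split; [apply: (H (Ordinal (isT : 0 < 2)))|apply: (H (Ordinal (isT : 1 < 2)))].
Qed.

(** A guard of lower complexity below a universal quantifier is absorbed into
    the disjunctions inside the matrix. *)
Lemma Pdef_guard (a n k : nat)
    (P Q : forall B : structure, ('I_n -> B) -> ('I_k -> B) -> Prop) :
  Pdef a.+1 (fun B (u : 'I_(n + k) -> B) => P B (u \o lshift k) (u \o @rshift n _)) ->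
  Pdef a.+2 (fun B (u : 'I_(n + k) -> B) => Q B (u \o lshift k) (u \o @rshift n _)) ->
  Pdef a.+2 (fun B v => forall w, P B v w -> Q B v w).
Proof.
move=> PP [phi pP phiE]; case: pP phiE => {phi} [phi [/ole_succ_zero] //|l psi b ba bS
  psiE].
have : Pdef a.+2 (fun B (v : 'I_n -> B) => forall i, forall x : 'I_(k + l i) -> B,
    ~ P B v (x \o lshift (l i)) \/
    sat (psi i) (app_valuation (app_valuation v (x \o lshift (l i))) (x \o @rshift k _))).
  apply: Pdef_bigand => i; apply: Pdef_forall; apply: Sdef_or.
    pose f (j : 'I_(n + k)) : 'I_(n + (k + l i)) :=
      match fintype.split j with inl j => lshift _ j | inr j => rshift n (lshift _ j) end.
    have /Sdef_ext := Sdef_ren f (Sdef_neg PP); apply=> B u.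
    rewrite (_ : (u \o f) \o lshift k = u \o lshift (k + l i)); last first.
      by apply/funext => j; rewrite /= /f (unsplitK (inl j)).
    rewrite (_ : (u \o f) \o @rshift n _ = (u \o @rshift n _) \o lshift (l i)) //.
    by apply/funext => j; rewrite /= /f (unsplitK (inr j)).
  pose f (j : 'I_(n + k + l i)) : 'I_(n + (k + l i)) :=
    match fintype.split j with
    | inl j => match fintype.split j with
               | inl j => lshift _ j | inr j => rshift n (lshift _ j) end
    | inr j => rshift n (rshift k j) end.
  have /(Sdef_ren f)/Sdef_ext := Sdef_in (a := a.+1) (bS i) (olt_nat_succ (ba i)).
  apply=> B u; rewrite (_ : u \o f = app_valuation (app_valuation (u \o lshift (k + l i))
    ((u \o @rshift n _) \o lshift (l i))) ((u \o @rshift n _) \o @rshift k _)) //.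
  apply/funext => j; rewrite /= /f [RHS]/app_valuation;
    case: (fintype.split j) => [j'|//].
  by rewrite /app_valuation; case: (fintype.split j').
apply: Pdef_ext => B v; split=> [H w p|H i x].
  have := (psiE B (app_valuation v w)).1; rewrite app_valuation_lE app_valuation_rE.
  apply=> i x; have := H i (app_valuation w x).
  by rewrite app_valuation_lE app_valuation_rE => -[/(_ p)|].
have [p|p] := pselect (P B v (x \o lshift (l i))); [right|by left].
have := (psiE B (app_valuation v (x \o lshift (l i)))).2.
by rewrite app_valuation_lE app_valuation_rE => /(_ (H _ p) i); apply.
Qed.

(** * Defining the types of nodes *)

Lemma Pdef_prec (a n : nat) (i j : 'I_n) : Pdef a (fun B v => prec (v i) (v j)).
Proof. exact: (@Pdef_qf a n (FPrec i j)). Qed.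

Lemma Pdef_nprec (a n : nat) (i j : 'I_n) : Pdef a (fun B v => ~ prec (v i) (v j)).
Proof. exact: (@Pdef_qf a n (FNot (FPrec i j))). Qed.

Lemma Pdef_eq (a n : nat) (i j : 'I_n) : Pdef a (fun B v => v i = v j).
Proof. exact: (@Pdef_qf a n (FEq i j)). Qed.

Lemma Pdef_neq (a n : nat) (i j : 'I_n) : Pdef a (fun B v => v i <> v j).
Proof. exact: (@Pdef_qf a n (FNot (FEq i j))). Qed.

Lemma Sdef_at_least (a n c : nat)
    (P : forall B : structure, ('I_n -> B) -> B -> Prop) :
  (forall k (i : 'I_k), Pdef a (fun B (u : 'I_(n + k) -> B) =>
     P B (u \o lshift k) (u (rshift n i)))) ->
  Sdef a.+1 (fun B v => at_least (P B v) c).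
Proof.
move=> PP; apply: Sdef_exists; apply: Pdef_and; last by apply: Pdef_all_ord => i;
  apply: PP.
apply: (Pdef_ext (Q := fun B (u : 'I_(n + c) -> B) => forall i j : 'I_c,
    u (rshift n i) = u (rshift n j) -> i = j)).
  by move=> B u; split=> [H i j /H|H i j /H].
apply: Pdef_all_ord => i; apply: Pdef_all_ord => j.
have [->|ij] := eqVneq i j; first by apply: Pdef_ext (Pdef_const a _ True).
apply: Pdef_ext (Pdef_neq a (rshift n i) (rshift n j)) => B u.
by split=> // H /H /eqP; rewrite (negPf ij).
Qed.

Lemma Pdef_counted (a n : nat) (N : natomega)
    (P : forall B : structure, ('I_n -> B) -> B -> Prop) :
  (forall k (i : 'I_k), Pdef a (fun B (u : 'I_(n + k) -> B) =>
     P B (u \o lshift k) (u (rshift n i)))) ->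
  Pdef a.+2 (fun B v => counted (P B v) N).
Proof.
move=> PP; apply: Pdef_bigand => c; have PS := Sdef_at_least c PP.
case: (fits c N); first by apply: Pdef_ext (Pdef_S PS) => B v; split=> // -[_]; apply.
apply: (@Pdef_leq a.+1) => //; apply: Pdef_ext (Pdef_neg PS) => B v.
by split=> // -[H _] /H.
Qed.

Lemma Pdef_below (m a n : nat) (i j : 'I_n) : 0 < a \/ m = 0 ->
  Pdef a (fun B v => below m (v i) (v j)).
Proof.
case: m => [|m] am.
  by apply: Pdef_ext (Pdef_prec a i j) => B v; split=> [|[]].
case: a am => [[]//|a _]; apply: Pdef_and; first exact: Pdef_prec.
apply: Pdef_ext (Pdef_leq (a := 1) _ (Pdef_neg (Sdef_exists (k := 1) (a := 0)
  (Q := fun B v w => prec (v i) (w ord0) /\ prec (w ord0) (v j)) _))) => //.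
  move=> B v; split=> [H _ [z [iz zj]]|H [w [iz zj]]].
    by apply: H; exists (fun _ => z).
  by apply: H => //; exists (w ord0).
by apply: Pdef_and; apply: (@Pdef_prec 0).
Qed.

(** At the bottom the quantifier over immediate successors is replaced by one
    over all larger elements, so that types of height one are Pi_2 rather than
    Pi_3. *)
Lemma Pdef_typed (m : nat) (N : natomega) (n : nat) (i : 'I_n) :
  Pdef (2 * m) (fun B v => typed m N (v i)).
Proof.
elim: m N n i => [|m IH] N n i; first exact: Pdef_const.
rewrite mulnS.
have body M k (j : 'I_k) : Pdef (2 * m) (fun B (u : 'I_(n + k) -> B) =>
    below m (u (lshift k i)) (u (rshift n j)) /\ typed m M (u (rshift n j))).
  apply: Pdef_and; first by apply: Pdef_below; lia.
  exact: (IH M _ (rshift n j)).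
have cnt M K : Pdef (2 * m).+2 (fun B (v : 'I_n -> B) =>
    counted (fun y => below m (v i) y /\ typed m M y) K).
  exact: (Pdef_counted K (P := fun B v y => below m (v i) y /\ typed m M y)).
have all : Pdef (2 * m).+2 (fun B (v : 'I_n -> B) =>
    forall y : 'I_1 -> B, below m (v i) (y ord0) -> exists M, typed m M (y ord0)).
  pose dec c := if c is c'.+1 then Fin c' else Omega.
  apply: Pdef_forall.
  have : Sdef (2 * m).+1 (fun B (u : 'I_(n + 1) -> B) =>
      ~ below m (u (lshift 1 i)) (u (rshift n ord0)) \/
      exists c, typed m (dec c) (u (rshift n ord0))).
    apply: Sdef_or.
      by apply: (Sdef_leq (a := 2 * m)) => //; apply: Sdef_neg; apply: Pdef_below; lia.
    by apply: Sdef_bigor => c; apply: Sdef_P; apply: (IH (dec c) _ (rshift n ord0)).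
  apply: Sdef_ext => B u; split=> [[nb b|[c ty] _]|H].
  - by case: nb.
  - by exists (dec c).
  - have [b|] := pselect (below m (u (lshift 1 i)) (u (rshift n ord0))); last by left.
    by right; have [[k|] ty] := H b; [exists k.+1|exists 0].
have fin : Pdef (2 * m).+2 (fun B (v : 'I_n -> B) => m <> 0 -> forall k,
    counted (fun y => below m (v i) y /\ typed m (Fin k) y) Omega).
  have [m0|m0] := pselect (m = 0).
    by apply: Pdef_ext (Pdef_const _ _ True) => B v; split.
  apply: Pdef_ext (Pdef_bigand (fun k => cnt (Fin k) Omega)) => B v.
  by split=> // H; apply: H.
apply: Pdef_ext (Pdef_and (cnt Omega N) (Pdef_and fin all)) => B v /=.
split=> [[c [f a]]|[c f a]]; split=> //.
  by move=> y; apply: (a (fun _ => y)).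
by split=> // w; apply: a.
Qed.

(** For labelled trees this says that [x] has level [l], without mentioning the
    level function. *)
Definition has_preds (T : structure) (l : nat) (x : T) : Prop :=
  counted (fun y => prec y x) (Fin l).

Lemma Pdef_has_preds (l n : nat) (i : 'I_n) :
  Pdef 2 (fun B v => has_preds l (v i)).
Proof.
apply: (Pdef_counted (a := 0) (Fin l) (P := fun B v y => prec y (v i))) => k j.
exact: (Pdef_prec 0 (rshift n j) (lshift k i)).
Qed.

Lemma has_preds_lv (h : nat) (T : ltree h) (x : T) (l : nat) :
  has_preds l x <-> lv x = l.
Proof.
have [lev gr cl] := skeleton_graded (lb_skeleton (ltP T)).
rewrite (graded_uniq (lb_graded (ltP T)) gr); split=> [c|<-]; last exact: cl.
by have [] := counted_uniq (cl x) c.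
Qed.

Lemma Pdef_is_root (n : nat) (i : 'I_n) : Pdef 1 (fun B v => is_root (v i)).
Proof.
have : Pdef 1 (fun B (v : 'I_n -> B) => forall w : 'I_1 -> B,
    ~ (w ord0 <> v i /\ ~ prec (v i) (w ord0))).
  apply: Pdef_forall; apply: Sdef_neg; apply: Pdef_and.
    exact: (Pdef_neq 0 (rshift n ord0) (lshift 1 i)).
  exact: (Pdef_nprec 0 (lshift 1 i) (rshift n ord0)).
apply: Pdef_ext => B v; split=> [H x|H w [wv nw]]; last by case: (H (w ord0)).
have [vx|vx] := pselect (prec (v i) x); first by right.
by left; apply: contrapT => xv; apply: (H (fun _ => x)).
Qed.

(** ** A Scott sentence *)

(** The axioms of a tree of type [h : N]. The bound on the number of
    predecessors replaces the conditions on finiteness and infinite paths. *)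
Definition typed_tree (h : nat) (N : natomega) (T : structure) : Prop :=
  [/\ forall x y z : T, prec x y -> prec y z -> prec x z,
      forall x : T, ~ prec x x,
      forall x y z : T, prec y x -> prec z x -> prec y z \/ y = z \/ prec z y,
      forall x : T, ~ at_least (fun y => prec y x) h.+1
    & (exists r : T, is_root r) /\ forall r : T, is_root r -> typed h N r].

Lemma typed_tree_labelled (h : nat) (N : natomega) (T : structure) :
  typed_tree h N T <->
  exists lev lab, @labelled h T lev lab /\ forall r, is_root r -> lab r = N.
Proof.
split=> [[trans irr lin bound [[r rr] ty]]|[lev [lab [lT labr]]]].
  have sk : skeleton T.
    split=> // [x|]; last by exists r.
    have [[k|] c] := counted_exists (fun y => prec y x); first by exists k.
    by case: (bound x); apply/c.
  have [lev gr cl] := skeleton_graded sk.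
  have le x : lev x <= h.
    rewrite leqNgt; apply/negP => xh; apply: (bound x).
    exact/(cl x).
  have [lab lT labr] := typed_labelled sk gr le rr (ty r rr).
  exists lev, lab; split=> // r' rr'; rewrite -labr; congr lab.
  by apply/(graded_root gr rr)/(graded_root gr rr').
have sk := lb_skeleton lT; have gr := lb_graded lT.
split.
- exact: sk_trans.
- exact: sk_irr.
- exact: sk_lin.
- move=> x xh; have [lev' gr' cl] := skeleton_graded sk.
  by have /(cl x) := xh; rewrite /= -(graded_uniq gr gr') ltnNge (lb_le lT).
- split=> [|r rr]; first exact: sk_root.
  have lr : h - lev r = h by rewrite (graded_root gr rr r).2 ?subn0.
  exact: ((labelled_typed lT (n := h) (x := r) _ lr).2 (labr r rr)).
Qed.

Lemma Pdef_typed_tree (h : nat) (N : natomega) : 1 < h ->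
  Pdef (2 * h) (fun B (v : 'I_0 -> B) => typed_tree h N B).
Proof.
move=> h1.
have univ k (phi : form k) : finitary_qf phi ->
    Pdef (2 * h) (fun B (v : 'I_0 -> B) => forall w : 'I_k -> B, sat phi w).
  move=> q; apply: (@Pdef_leq 1); first by lia.
  by apply: Pdef_forall; apply: (Sdef_ren (@rshift 0 k) (Q := fun B v => sat phi v));
    apply: Sdef_qf.
pose x0 : 'I_3 := ord0; pose x1 : 'I_3 := Ordinal (isT : 1 < 3).
pose x2 : 'I_3 := Ordinal (isT : 2 < 3).
have trans : Pdef (2 * h) (fun B (v : 'I_0 -> B) =>
    forall x y z : B, prec x y -> prec y z -> prec x z).
  have := univ 3 (FNot (FAnd (FAnd (FPrec x0 x1) (FPrec x1 x2)) (FNot (FPrec x0 x2))))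
    ltac:(by []).
  apply: Pdef_ext => B v /=; split=> [H x y z xy yz|H w [[xy yz]]]; last by apply;
    apply: H xy yz.
  apply: contrapT => xz; apply: (H (fun i : 'I_3 => nth x [:: x; y; z] i)) => /=.
  by [].
have irr : Pdef (2 * h) (fun B (v : 'I_0 -> B) => forall x : B, ~ prec x x).
  have := univ 1 (FNot (FPrec ord0 ord0)) I.
  by apply: Pdef_ext => B v /=; split=> [H x|H w]; [apply: (H (fun _ => x))|apply: H].
have lin : Pdef (2 * h) (fun B (v : 'I_0 -> B) => forall x y z : B,
    prec y x -> prec z x -> prec y z \/ y = z \/ prec z y).
  have := univ 3 (FOr (FNot (FAnd (FPrec x1 x0) (FPrec x2 x0)))
    (FOr (FPrec x1 x2) (FOr (FEq x1 x2) (FPrec x2 x1)))) ltac:(by []).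
  apply: Pdef_ext => B v /=; split=> [H x y z yx zx|H w].
    by case: (H (fun i : 'I_3 => nth x [:: x; y; z] i)) => //= -[].
  have [[yx zx]|] := pselect (prec (w x1) (w x0) /\ prec (w x2) (w x0)); last by left.
  by right; apply: H yx zx.
have bound : Pdef (2 * h) (fun B (v : 'I_0 -> B) => forall x : B,
    ~ at_least (fun y => prec y x) h.+1).
  apply: (@Pdef_leq 3); first by lia.
  have : Pdef 3 (fun B (v : 'I_0 -> B) => forall w : 'I_1 -> B,
      ~ at_least (fun y => prec y (w ord0)) h.+1).
    apply: Pdef_forall; apply: Sdef_P; apply: Pdef_neg.
    apply: (Sdef_at_least (n := 0 + 1) (a := 0) _ (P := fun B u y =>
      prec y (u (rshift 0 ord0)))).
    by move=> k j; apply: (Pdef_prec 0 (rshift _ j) (lshift k (rshift 0 ord0))).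
  by apply: Pdef_ext => B v; split=> [H x|H w]; [apply: (H (fun _ => x))|apply: H].
have root : Pdef (2 * h) (fun B (v : 'I_0 -> B) => exists r : B, is_root r).
  apply: (@Pdef_leq 3); first by lia.
  have : Pdef 3 (fun B (v : 'I_0 -> B) => exists w : 'I_1 -> B, is_root (w ord0)).
    by apply: Pdef_S; apply: Sdef_exists; apply: (Pdef_is_root (rshift 0 ord0)).
  apply: Pdef_ext => B v; split=> [[w H]|[r rr]]; first by exists (w ord0).
  by exists (fun _ => r).
have ty : Pdef (2 * h) (fun B (v : 'I_0 -> B) => forall r : B, is_root r -> typed h N r).
  have -> : 2 * h = (2 * h).-2.+2 by lia.
  have : Pdef (2 * h).-2.+2 (fun B (v : 'I_0 -> B) => forall w : 'I_1 -> B,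
      is_root (w ord0) -> typed h N (w ord0)).
    apply: (Pdef_guard (P := fun B v w => is_root (w ord0)) (Q := fun B v w =>
      typed h N (w ord0))).
      by apply: (@Pdef_leq 1) => //; apply: (Pdef_is_root (rshift 0 ord0)).
    have <- : 2 * h = (2 * h).-2.+2 by lia.
    exact: (Pdef_typed h N (rshift 0 ord0)).
  by apply: Pdef_ext => B v; split=> [H r|H w]; [apply: (H (fun _ => r))|apply: H].
apply: Pdef_ext (Pdef_and trans (Pdef_and irr (Pdef_and lin (Pdef_and bound (Pdef_and
  root ty))))) => B v.
by split=> [[? [? [? [? [? ?]]]]]|[? ? ? ? []]].
Qed.

(** * Isomorphism, orbits and Scott sentences of labelled trees *)

Lemma ltree_iso (h : nat) (T S : ltree h) (r : T) (r' : S) :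
  countable [set: T] -> countable [set: S] -> is_root r -> is_root r' ->
  lb r = lb r' -> isomorphic T S.
Proof.
move=> cT cS rr rr' e.
have mR : matching (2 * h) [:: (r : {classic T}, r' : {classic S})].
  by apply: matching_root => //; rewrite e; apply: agree_refl.
by have [f fi _] := scott_iso cT cS mR; exists f.
Qed.

Lemma isomorphic_refl (A : structure) : isomorphic A A.
Proof. by exists id; split=> //; exists id. Qed.

Lemma sat_iso (A B : structure) (f : A -> B) : isomorphism f ->
  forall n (phi : form n) (v : 'I_n -> A), sat phi v <-> sat phi (f \o v).
Proof.
move=> [[g fg gf] fp] n phi.
have app m k (v : 'I_m -> A) (w : 'I_k -> A) :
    f \o app_valuation v w = app_valuation (f \o v) (f \o w).
  by apply/funext => i; rewrite /= /app_valuation; case: fintype.split.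
have fgE k (w : 'I_k -> B) : f \o (g \o w) = w by apply/funext => i; apply: gf.
elim: phi => //= {n}.
- by move=> n i j v; split=> [->//|]; apply: (can_inj fg).
- by move=> n phi IH v; rewrite IH.
- by move=> n phi IH psi IH' v; rewrite IH IH'.
- by move=> n phi IH psi IH' v; rewrite IH IH'.
- by move=> n phi IH v; split=> H i; apply/IH/H.
- by move=> n phi IH v; split=> -[i /IH H]; exists i.
- move=> n k phi IH v; split=> -[w H]; first by exists (f \o w); rewrite -app; apply/IH.
  by exists (g \o w); apply/IH; rewrite app fgE.
- move=> n k phi IH v; split=> H w; last by apply/IH; rewrite app; apply: H.
  by rewrite -(fgE _ w) -app; apply/IH.
Qed.

Lemma root_uniq (T : structure) (r r' : T) : skeleton T ->
  is_root r -> is_root r' -> r = r'.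
Proof.
move=> sk rr rr'; have [lev gr _] := skeleton_graded sk.
by apply/(graded_root gr rr')/(graded_root gr rr).
Qed.

Lemma ltree_Scott_sentence (h : nat) (A : ltree h) (r : A) : 1 < h ->
  countable [set: A] -> is_root r ->
  has_Scott_sentence A (CPi (ord_of_nat (2 * h))).
Proof.
move=> h1 cA rr; have [phi pP phiE] := Pdef_typed_tree (lb r) h1.
exists phi; split=> // B _ cB.
have At : typed_tree h (lb r) A.
  apply/typed_tree_labelled; exists lv, lb; split; first exact: ltP.
  by move=> r' rr'; rewrite (root_uniq (lb_skeleton (ltP A)) rr' rr).
have v0 (C : structure) : 'I_0 -> C by case.
split=> [Bphi|[f fi] v].
  have /phiE/typed_tree_labelled[lev [lab [lB labr]]] := Bphi (v0 B).
  have [r' rr'] := sk_root (lb_skeleton lB).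
  by apply: (@ltree_iso h A (LTree lB) r r') => //=; rewrite labr.
have -> : v = f \o v0 A by apply/funext => -[].
by apply/(sat_iso fi)/phiE.
Qed.

(** ** Orbits *)

(** A tuple is first completed to one that contains the root and, with each
    entry, all entries below it. *)
Lemma closed_tuple (h : nat) (T : ltree h) (n : nat) (v : 'I_n -> T) :
  exists k (u : 'I_k -> T), let U := app_valuation v u in
    (exists j, is_root (U j)) /\
    forall j l, lv (U j) = l.+1 -> exists2 j', prec (U j') (U j) & lv (U j') = l.
Proof.
have sk := lb_skeleton (ltP T); have gr := lb_graded (ltP T).
have [r rr] := sk_root sk.
have /choice[anc ancP] : forall q : T * nat, exists x : T,
    if q.2 < lv q.1 then prec x q.1 /\ lv x = q.2 else x = q.1.
  move=> [x l] /=; case: leqP => [_|xl]; first by exists x.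
  by have [y yx yl] := graded_anc sk gr xl; exists y.
pose I : finType := option ('I_n * 'I_h.+1).
pose u0 (i : I) : T := if i is Some (i, l) then anc (v i, val l) else r.
exists #|I|, (fun j => u0 (enum_val j)) => U.
have Uu i : exists j, U j = u0 i.
  by exists (rshift n (enum_rank i)); rewrite /U app_valuation_r enum_rankK.
split; first by have [j e] := Uu None; exists j; rewrite e.
have below_v i x l : (x = v i \/ prec x (v i)) -> lv x = l.+1 ->
    exists2 j, prec (U j) x & lv (U j) = l.
  move=> xv xl; have vl : l < lv (v i).
    by case: xv => [<-|/lv_prec]; rewrite xl // => /ltnW.
  have lh : l < h.+1 by have := lv_le (v i); lia.
  have [j e] := Uu (Some (i, Ordinal lh)); have := ancP (v i, l).
  rewrite /= vl => -[av al]; exists j; rewrite e //=.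
  case: xv => [->//|xv]; case: (sk_lin sk av xv) => [//|[ax|/lv_prec]].
    by move: al; rewrite ax xl; lia.
  by rewrite al xl; lia.
move=> j l; rewrite /U /app_valuation; case: fintype.split => [i|j'].
  by apply: below_v; left.
rewrite /u0; case: (enum_val j') => [[i l']|] e; last first.
  by move: e; rewrite (lv_root rr r).2.
apply: (below_v i) e; have := ancP (v i, val l'); rewrite /=.
by case: ifP => [_ []|_]; [right|left].
Qed.

(** Non-root types have height at most [h.-1], so the types in a closed tuple
    are defined by Pi formulas of level [2h-2]; by back-and-forth they
    determine the orbit. *)
Lemma ltree_orbits (h : nat) (T : ltree h) : 1 < h -> countable [set: T] ->
  all_orbits_Sigma T (ord_of_nat (2 * h).-1).
Proof.
move=> h1 cT n v; have [k [u [rU clU]]] := closed_tuple v.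
move: rU clU; set U := app_valuation v u => rU clU.
pose diag (B : structure) (V : 'I_n -> B) (w : 'I_k -> B) :=
  [/\ forall i j, U i = U j <-> app_valuation V w i = app_valuation V w j,
      forall i j, prec (U i) (U j) <-> prec (app_valuation V w i) (app_valuation V w j),
      forall j, has_preds (lv (U j)) (app_valuation V w j)
    & forall j, lv (U j) <> 0 ->
        typed (h - lv (U j)) (lb (U j)) (app_valuation V w j)].
have diagP : Sdef (2 * h).-1 (fun B (V : 'I_n -> B) => exists w : 'I_k -> B, diag B V w).
  have -> : (2 * h).-1 = (2 * h.-1).+1 by lia.
  apply: Sdef_exists.
  have d1 : Pdef (2 * h.-1) (fun B (V : 'I_(n + k) -> B) =>
      forall i j, U i = U j <-> V i = V j).
    apply: Pdef_all_ord => i; apply: Pdef_all_ord => j.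
    have [e|e] := pselect (U i = U j).
      by apply: Pdef_ext (Pdef_eq _ i j) => B V; split=> [VV|[H _]]; [by split|exact: H].
    by apply: Pdef_ext (Pdef_neq _ i j) => B V; split=> [VV|[_ H] /H //]; split.
  have d2 : Pdef (2 * h.-1) (fun B (V : 'I_(n + k) -> B) =>
      forall i j, prec (U i) (U j) <-> prec (V i) (V j)).
    apply: Pdef_all_ord => i; apply: Pdef_all_ord => j.
    have [e|e] := pselect (prec (U i) (U j)).
      by apply: Pdef_ext (Pdef_prec _ i j) => B V; split=> [VV|[H _]];
        [by split|exact: H].
    by apply: Pdef_ext (Pdef_nprec _ i j) => B V; split=> [VV|[_ H] /H //]; split.
  have d3 : Pdef (2 * h.-1) (fun B (V : 'I_(n + k) -> B) =>
      forall j, has_preds (lv (U j)) (V j)).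
    apply: Pdef_all_ord => j; apply: (@Pdef_leq 2); [by lia|exact: Pdef_has_preds].
  have d4 : Pdef (2 * h.-1) (fun B (V : 'I_(n + k) -> B) =>
      forall j, lv (U j) <> 0 -> typed (h - lv (U j)) (lb (U j)) (V j)).
    apply: Pdef_all_ord => j; have [e|e] := pselect (lv (U j) = 0).
      by apply: Pdef_ext (Pdef_const _ _ True) => B V; split.
    apply: Pdef_ext (Pdef_leq (a := 2 * (h - lv (U j))) _ (Pdef_typed _ (lb (U j)) j));
      last by lia.
    by move=> B V; split=> // H; apply: H.
  apply: Pdef_ext (Pdef_and d1 (Pdef_and d2 (Pdef_and d3 d4))) => B V.
  by rewrite /diag app_valuation_split; split=> [[? [? []]]|[]].
have [phi pS phiE] := diagP; exists phi; split=> // w.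
rewrite phiE; split=> [[w' [dE dP dL dT]]|[g [gi ->]]].
  set W := app_valuation w w' in dE dP dL dT.
  have lvE j : lv (U j) = lv (W j) by apply/esym/has_preds_lv.
  have [j0 rj0] := rU.
  have rW : is_root (W j0).
    have [r rr] := sk_root (lb_skeleton (ltP T)).
    have -> // : W j0 = r by apply/(lv_root rr); rewrite -lvE; apply/(lv_root rj0).
  have mR : matching (T := T) (S := T) (2 * h)
      [seq (U j : {classic T}, W j : {classic T}) | j <- enum 'I_(n + k)].
    have inR j : (U j : {classic T}, W j : {classic T}) \in
        [seq (U j : {classic T}, W j : {classic T}) | j <- enum 'I_(n + k)].
      by apply: (map_f (fun j => (U j : {classic T}, W j : {classic T})));
        rewrite mem_enum.
    split.
    - by exists (U j0 : {classic T}, W j0 : {classic T}).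
    - by move=> q /mapP[j _ ->] /=.
    - move=> q /mapP[j _ ->] /=; suff -> : lb (U j) = lb (W j) by apply: agree_refl.
      have [e|e] := pselect (lv (U j) = 0).
        have -> : W j = U j0; last first.
          by congr lb; apply/(lv_root rj0).
        by apply/(lv_root rj0); rewrite -lvE.
      have := dT j e; rewrite lvE.
      by move=> /(labelled_typed (ltP T) _ erefl).
    - move=> q l /mapP[j _ ->] /= /clU[j' pj lj].
      by exists (U j' : {classic T}, W j' : {classic T}); split=> //; apply/dP.
    - by move=> q q' /mapP[i _ ->] /mapP[j _ ->] /=.
  have [f fi fR] := scott_iso cT cT mR; exists f; split=> //.
  apply/funext => i /=.
  have /fR /= : (U (lshift k i) : {classic T}, W (lshift k i) : {classic T}) \in
      [seq (U j : {classic T}, W j : {classic T}) | j <- enum 'I_(n + k)].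
    by apply: (map_f (fun j => (U j : {classic T}, W j : {classic T}))); rewrite mem_enum.
  by rewrite /U /W !app_valuation_l.
exists (g \o u).
have gE j : app_valuation (g \o v) (g \o u) j = g (U j).
  by rewrite /U /app_valuation; case: fintype.split.
have lE := labelled_iso gi (ltP T) (ltP T).
split=> [i j|i j|j|j _]; rewrite ?gE.
- by split=> [->//|]; have [[g' gg' _] _] := gi; apply: (can_inj gg').
- by have [_ gp] := gi; rewrite gp.
- by apply/has_preds_lv; rewrite (lE _).1.
- apply/(labelled_typed (ltP T) _ (_ : h - lv (g (U j)) = _)); last by rewrite (lE _).2.
  by rewrite (lE _).1.
Qed.

(** ** Lower bounds *)

Lemma omega_child (h : nat) (T : ltree h) (x : T) : lv x < h -> lb x = Omega ->
  exists y : T, [/\ prec x y, lv y = (lv x).+1 & lb y = Omega].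
Proof.
move=> xh xO; have := lb_omega (ltP T) xh; rewrite xO => c.
by have [y yP _] := pigeonhole (s := [::]) ((c 1).2 isT) isT; exists y.
Qed.

Lemma fin_child (h : nat) (T : ltree h) (x : T) (k : nat) : (lv x).+1 < h ->
  exists y : T, [/\ prec x y, lv y = (lv x).+1 & lb y = Fin k].
Proof.
move=> xh; have c := lb_fin (ltP T) k xh.
by have [y yP _] := pigeonhole (s := [::]) ((c 1).2 isT) isT; exists y.
Qed.

(** A Pi formula of level below [2m] that holds of a node of type [m : Omega]
    with parameters also holds of a node of type [m : p] with suitable parameters,
    once [p] exceeds the number of moves that the parameters cost. *)
Lemma ltree_orbit_not_Sigma (m : nat) (T : ltree m.+1) (r : T) : 0 < m ->
  is_root r -> lb r = Omega ->
  exists v : 'I_1 -> T, ~ Sigma_definable (ord_of_nat (2 * m)) (tuple_orbit v).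
Proof.
move=> m0 rr rO; have r0 : lv r = 0 by apply/(lv_root rr).
have [|x [rx xl xO]] := omega_child (x := r) _ rO; first by rewrite r0.
exists (fun _ => x) => -[phi [pS phiE]].
have /phiE : tuple_orbit (fun _ : 'I_1 => x) (fun _ => x).
  by exists id; split=> //; split=> //; exists id.
case: pS phiE => [phi' [+ _] _|k psi c cb cP] phiE.
  have -> : 2 * m = (2 * m).-1.+1 by lia.
  by move/ole_succ_zero.
move=> [i [w psix]].
(* Two pairs to begin with, and each parameter costs at most m.+2 more. *)
pose p := 2 + k i * m.+2.
have [|x' [rx' xl' xO']] := fin_child (x := r) p; first by rewrite r0; lia.
pose R := [:: (x : {classic T}, x' : {classic T}); (r : {classic T}, r : {classic T})].
have neq y : prec r y -> r <> y by move=> ry e; move: (lv_prec ry); rewrite -e ltnn.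
have mR : matching (T := T) (S := T) (2 * m).-1 R.
  apply: (matching_add (q := (r : {classic T}, r : {classic T}))) => //=.
  - by apply: matching_root => //; apply: agree_refl.
  - by rewrite inE eqxx.
  - by rewrite xl xl'.
  - by move=> q /[!inE]/eqP-> /=; apply: neq.
  - by move=> q /[!inE]/eqP-> /=; apply: neq.
  - by rewrite xO xl r0; split=> //; lia.
have hR : hosting (T := T) (S := T) (2 * m).-1 p R.
  move=> q; rewrite !inE => /orP[/eqP->|/eqP->] //=.
  by move=> _ a ap _; rewrite xO'.
have [R' [w' [mR' _ RR' ww']]] := matching_extend_fun w mR hR (leqnn _).
have vv' : forall i0 : 'I_1, (x : {classic T}, x' : {classic T}) \in R'.
  by move=> _; apply: RR'; rewrite inE eqxx.
have /(app_valuation_pair (v := fun _ => x) (v' := fun _ => x') (w := w) (w' := w')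
  (P := fun y z : T => (y : {classic T}, z : {classic T}) \in R') vv') pairs := ww'.
have cm : ole (c i) (ord_of_nat (2 * m).-1).
  by apply: olt_nat_succ; rewrite prednK ?muln_gt0 ?m0 //; apply: cb.
have psix' := (matching_transfer (psi i) mR' pairs cm).1 (cP i) psix.
have /phiE[g [gi /(congr1 (fun f => f ord0)) /= e]] :
    sat (FBigOr (fun i => FEx (psi i))) (fun _ : 'I_1 => x') by exists i, w'.
have [_] := labelled_iso gi (ltP T) (ltP T) x.
by rewrite -e xO' xO.
Qed.

(** A Sigma sentence of level [2h] true in [h : Omega] mentions only finitely
    many witnesses, which can be found in [h : p] for large finite [p]. *)
Lemma ltree_Sigma_reflects (h : nat) (T : ltree h) (r : T) (Q : query 0)
    (v : 'I_0 -> T) : 0 < h -> is_root r -> lb r = Omega ->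
  Sdef (2 * h) Q -> Q T v ->
  exists p0, forall (S : ltree h) (r' : S) (p : nat) (v' : 'I_0 -> S),
    is_root r' -> lb r' = Fin p -> p0 <= p -> Q S v'.
Proof.
move=> h0 rr rO [phi pS phiE] /phiE.
case: pS phiE => [phi' [+ _] _|k psi c cb cP] phiE.
  have -> : 2 * h = (2 * h).-1.+1 by lia.
  by move/ole_succ_zero.
move=> [i [w psiw]]; exists (1 + k i * h.+1) => S r' p v' rr' r'p lep.
pose R := [:: (r : {classic T}, r' : {classic S})].
have mR : matching (2 * h).-1 R.
  by apply: matching_root => //; rewrite rO; split=> //; lia.
have hR : hosting (2 * h).-1 (1 + k i * h.+1) R.
  move=> q /[!inE]/eqP-> _ a /= ap _; rewrite r'p; exact: leq_trans lep.
have [R' [w' [mR' _ RR' ww']]] := matching_extend_fun w mR hR (leqnn _).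
have vv' (i0 : 'I_0) : (v i0 : {classic T}, v' i0 : {classic S}) \in R' by case: i0.
have pairs := app_valuation_pair (P := fun (y : T) (z : S) =>
  (y : {classic T}, z : {classic S}) \in R') vv' ww'.
have cm : ole (c i) (ord_of_nat (2 * h).-1).
  by apply: olt_nat_succ; rewrite prednK ?muln_gt0 ?h0 //; apply: cb.
apply/phiE; exists i, w'.
exact: (matching_transfer (psi i) mR' pairs cm).1 (cP i) psiw.
Qed.

Definition finite_types_realized (h : nat) : Prop :=
  forall p, exists2 S : ltree h, countable [set: S] &
    exists2 r : S, is_root r & lb r = Fin p.

Lemma iso_root (A B : structure) (f : A -> B) (r : A) :
  isomorphism f -> is_root r -> is_root (f r).
Proof.
move=> [[g fg gf] fp] rr y; rewrite -(gf y).
by case: (rr (g y)) => [->|/fp]; [left|right].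
Qed.

(** Both conjuncts of a d-Sigma sentence of level [a] are Sigma of level [a.+1], so
    that one bound serves for all complexities below Pi of level [2h]. *)
Lemma ltree_complexity_bound (h : nat) (T : ltree h) (r : T) (d : complexity) :
  finite_types_realized h -> 0 < h -> countable [set: T] -> is_root r -> lb r = Omega ->
  has_Scott_sentence T d ->
  complexity_le (CPi (ord_of_nat (2 * h))) d.
Proof.
move=> trees h0 cT rr rO [phi [dphi ssphi]].
have v0 (C : structure) : 'I_0 -> C by case.
have Tphi : sat phi (v0 T).
  by apply: (ssphi T (inhabits r) cT).2; exact: isomorphic_refl.
have no2 (Q1 Q2 : query 0) : Sdef (2 * h) Q1 -> Sdef (2 * h) Q2 ->
    (forall B v, @sat B 0 phi v <-> Q1 B v /\ Q2 B v) -> False.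
  move=> S1 S2 E; have /E[/ltree_Sigma_reflects H1 /ltree_Sigma_reflects H2] := Tphi.
  have [p1 P1] := H1 r h0 rr rO S1; have [p2 P2] := H2 r h0 rr rO S2.
  have [S cS [r' rr' r'p]] := trees (maxn p1 p2).
  have /ssphi[||f fi] : sentence_sat S phi.
  - by move=> v; apply/E; split; [apply: P1 rr' r'p _|apply: P2 rr' r'p _];
      rewrite ?leq_maxl ?leq_maxr.
  - by exists.
  - by [].
  have [_] := labelled_iso fi (ltP T) (ltP S) r.
  by rewrite (root_uniq (lb_skeleton (ltP S)) (iso_root fi rr) rr') r'p rO.
have no (Q : query 0) : Sdef (2 * h) Q -> (forall B v, @sat B 0 phi v <-> Q B v) -> False.
  by move=> SQ E; apply: (no2 Q Q) => // B v; rewrite E; split=> [|[]].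
have [le|le] := ole_nat_total (2 * h) (complexity_ord d); first by left.
have [|le'] := ole_nat_total (2 * h).-1 (complexity_ord d).
  rewrite prednK ?muln_gt0 ?h0 // => ge; right; split; first by split.
  case: d le dphi {ge} => //= a le dphi.
  by case: (no _ (Sdef_in dphi le)).
have below1 (Q : query 0) : Pdef (2 * h).-1 Q -> Sdef (2 * h) Q.
  by move=> /Sdef_P; rewrite prednK ?muln_gt0 ?h0.
case: d le le' dphi => a /= le le' dphi.
- by case: (no _ (Sdef_in dphi le)).
- by case: (no _ (below1 _ (Pdef_in dphi le'))).
- have [psi [chi [e psiS chiP]]] := dphi.
  case: (no2 _ _ (Sdef_in psiS le) (below1 _ (Pdef_in chiP le'))).
  by rewrite e.
Qed.

(** * Relative computability *)

Definition p1 (z : nat) : nat := (Cantor.of_nat z).1.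
Definition p2 (z : nat) : nat := (Cantor.of_nat z).2.

Lemma p1_pair x y : p1 (pair_code x y) = x.
Proof. by rewrite /p1 Cantor.cancel_of_to. Qed.

Lemma p2_pair x y : p2 (pair_code x y) = y.
Proof. by rewrite /p2 Cantor.cancel_of_to. Qed.

Lemma pair_p z : pair_code (p1 z) (p2 z) = z.
Proof. by rewrite /p1 /p2 -surjective_pairing Cantor.cancel_to_of. Qed.

Lemma pair_inj x y x' y' : pair_code x y = pair_code x' y' -> x = x' /\ y = y'.
Proof. by move=> e; rewrite -(p1_pair x y) -{2}(p2_pair x y) e p1_pair p2_pair. Qed.

Definition computable (Z : set nat) (f : nat -> nat) : Prop :=
  exists c : code, forall x, eval Z c x (f x).

Section Computable.
Variable Z : set nat.
Local Notation computable := (computable Z).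

Lemma computable_ext (f g : nat -> nat) :
  (forall x, f x = g x) -> computable f -> computable g.
Proof. by move=> fg; have -> : f = g by apply/funext. Qed.

Lemma computable_id : computable (fun x => x).
Proof.
exists (CodePair CodeFst CodeSnd) => x; rewrite -{2}(pair_p x).
by apply: eval_pair; rewrite -{1}(pair_p x); constructor.
Qed.

Lemma computable_comp (f g : nat -> nat) :
  computable f -> computable g -> computable (fun x => f (g x)).
Proof.
by move=> [c cf] [d dg]; exists (CodeComp c d) => x; apply: eval_comp (dg x) (cf _).
Qed.

Lemma computable_S f : computable f -> computable (fun x => (f x).+1).
Proof. by apply: computable_comp; exists CodeSucc => x; constructor. Qed.

Lemma computable_const n : computable (fun=> n).
Proof.
elim: n => [|n IH]; first by exists CodeZero => x; constructor.
exact: computable_S IH.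
Qed.

Lemma computable_p1 f : computable f -> computable (fun x => p1 (f x)).
Proof.
apply: (computable_comp (f := p1)); exists CodeFst => x.
by rewrite -{1}(pair_p x); constructor.
Qed.

Lemma computable_p2 f : computable f -> computable (fun x => p2 (f x)).
Proof.
apply: (computable_comp (f := p2)); exists CodeSnd => x.
by rewrite -{1}(pair_p x); constructor.
Qed.

Lemma computable_pair f g : computable f -> computable g ->
  computable (fun x => pair_code (f x) (g x)).
Proof.
by move=> [c cf] [d dg]; exists (CodePair c d) => x; apply: eval_pair.
Qed.

Lemma computable_rec (a n : nat -> nat) (b : nat -> nat -> nat -> nat) :
  computable a -> computable (fun z => b (p1 z) (p1 (p2 z)) (p2 (p2 z))) ->
  computable n ->
  computable (fun x => nat_rec (fun=> nat) (a x) (b x) (n x)).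
Proof.
move=> [ca aP] [cb bP] nP; have [c cP] := computable_pair computable_id nP.
exists (CodeComp (CodeRec ca cb) c) => x; apply: eval_comp (cP x) _.
elim: (n x) => [|m IH] /=; first exact: eval_rec0.
apply: eval_recS IH _; have := bP (pair_code x (pair_code m (nat_rec (fun=>
  nat) (a x) (b x) m))).
by rewrite !(p1_pair, p2_pair).
Qed.

Lemma computable_min (F : nat -> nat -> nat) (m : nat -> nat) :
  computable (fun z => F (p1 z) (p2 z)) ->
  (forall x, F x (m x) = 0) -> (forall x i, i < m x -> F x i <> 0) ->
  computable m.
Proof.
move=> [c cF] m0 mlt; exists (CodeMin c) => x.
apply: (eval_min (v := fun i => (F x i).-1)) => [i im|].
  have := cF (pair_code x i); rewrite p1_pair p2_pair.
  by case: (F x i) (mlt x i im).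
by have := cF (pair_code x (m x)); rewrite p1_pair p2_pair m0.
Qed.

Lemma computable_pred f : computable f -> computable (fun x => (f x).-1).
Proof.
move=> cf; apply: (computable_ext (f := fun x =>
    nat_rec (fun=> nat) 0 (fun n _ => n) (f x))); first by move=> x; case: (f x).
apply: computable_rec cf; first exact: computable_const.
by apply/computable_p1/computable_p2/computable_id.
Qed.

Lemma computable_sub f g : computable f -> computable g ->
  computable (fun x => f x - g x).
Proof.
move=> cf cg; apply: (computable_ext (f := fun x =>
    nat_rec (fun=> nat) (f x) (fun _ y => y.-1) (g x))).
  by move=> x; elim: (g x) => [|n /= ->]; rewrite /= ?subn0 ?subnS.
apply: computable_rec cf _ cg.
by apply/computable_pred/computable_p2/computable_p2/computable_id.
Qed.

Lemma computable_add f g : computable f -> computable g ->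
  computable (fun x => f x + g x).
Proof.
move=> cf cg; apply: (computable_ext (f := fun x =>
    nat_rec (fun=> nat) (f x) (fun _ y => y.+1) (g x))).
  by move=> x; elim: (g x) => [|n /= ->]; rewrite /= ?addn0 ?addnS.
apply: computable_rec cf _ cg.
by apply/computable_S/computable_p2/computable_p2/computable_id.
Qed.

Lemma computable_mul n f : computable f -> computable (fun x => n * f x).
Proof.
move=> cf; elim: n => [|n IH].
  by apply: (computable_ext (f := fun=> 0)) (computable_const 0) => x; rewrite mul0n.
by apply: computable_ext (computable_add cf IH) => x; rewrite mulSn.
Qed.

Lemma computable_if (b : nat -> bool) f g : computable (fun x => b x) ->
  computable f -> computable g -> computable (fun x => if b x then f x else g x).
Proof.
move=> cb cf cg; apply: (computable_ext (f := fun x =>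
    nat_rec (fun=> nat) (g x) (fun _ _ => f x) (b x))); first by move=> x; case: (b x).
apply: computable_rec cg _ cb; apply: computable_comp cf _.
exact/computable_p1/computable_id.
Qed.

(** Propositions enter through their classical truth values, so that [dec]
    applies to predicates that are not boolean. *)
Definition decb (b : nat -> bool) : Prop := computable (fun x => b x).

Definition dec (P : nat -> Prop) : Prop := decb (fun x => `[< P x >]).

Lemma decb_dec b : decb b -> dec (fun x => b x).
Proof. by apply: computable_ext => x; rewrite asboolb. Qed.

Lemma dec_ext P Q : (forall x, P x <-> Q x) -> dec P -> dec Q.
Proof. by move=> PQ; apply: computable_ext => x; rewrite (asbool_equiv_eq (PQ x)). Qed.

Lemma decb_eq f g : computable f -> computable g -> decb (fun x => f x == g x).
Proof.
move=> cf cg; apply: (computable_ext (f := fun x => 1 - ((f x - g x) + (g x - f x)))).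
  by move=> x; case: eqVneq; lia.
apply: computable_sub (computable_const 1) _.
by apply: computable_add; apply: computable_sub.
Qed.

Lemma dec_eq f g : computable f -> computable g -> dec (fun x => f x = g x).
Proof.
move=> cf cg; apply: (dec_ext (P := fun x => f x == g x)); first by move=> x;
  split=> /eqP.
exact/decb_dec/decb_eq.
Qed.

Lemma decb_leq f g : computable f -> computable g -> decb (fun x => f x <= g x).
Proof.
move=> cf cg; apply: (computable_ext (f := fun x => 1 - (f x - g x))).
  by move=> x; case: leqP; lia.
by apply: computable_sub (computable_const 1) _; apply: computable_sub.
Qed.

Lemma decb_neg b : decb b -> decb (fun x => ~~ b x).
Proof.
move=> cb; apply: (computable_ext (f := fun x => 1 - b x)); first by move=> x;
  case: (b x).
exact: computable_sub (computable_const 1) cb.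
Qed.

Lemma decb_and b c : decb b -> decb c -> decb (fun x => b x && c x).
Proof.
move=> cb cc; have := computable_if cb cc (computable_const 0).
by apply: computable_ext => x; case: (b x).
Qed.

Lemma decb_or b c : decb b -> decb c -> decb (fun x => b x || c x).
Proof.
move=> cb cc; have := computable_if cb (computable_const 1) cc.
by apply: computable_ext => x; case: (b x).
Qed.

Lemma dec_neg P : dec P -> dec (fun x => ~ P x).
Proof. by move/decb_neg; apply: computable_ext => x; rewrite asbool_neg. Qed.

Lemma dec_and P Q : dec P -> dec Q -> dec (fun x => P x /\ Q x).
Proof. by move=> cP cQ; have := decb_and cP cQ; apply: computable_ext => x;
  rewrite asbool_and. Qed.

Lemma dec_or P Q : dec P -> dec Q -> dec (fun x => P x \/ Q x).
Proof. by move=> cP cQ; have := decb_or cP cQ; apply: computable_ext => x;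
  rewrite asbool_or. Qed.

Lemma dec_comp P f : dec P -> computable f -> dec (fun x => P (f x)).
Proof. by move=> cP cf; apply: computable_comp cP cf. Qed.

Lemma dec_ball (P : nat -> nat -> Prop) f :
  dec (fun z => P (p1 z) (p2 z)) -> computable f ->
  dec (fun x => forall i, i < f x -> P x i).
Proof.
move=> cP cf; apply: (computable_ext (f := fun x =>
    nat_rec (fun=> nat) 1 (fun i y => if `[< P x i >] then y else 0) (f x))).
  move=> x; elim: (f x) => [|n /= ->]; first by case: asboolP => // -[].
  case: asboolP => Pn; last by case: asboolP => // H; case: Pn; apply: H.
  case: asboolP => H; case: asboolP => // H'.
    by case: H' => i; rewrite ltnS leq_eqVlt => /orP[/eqP->|/H].
  by case: H => i im; apply: H'; apply: ltnW.
apply: computable_rec (computable_const 1) _ cf.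
apply: computable_if; last exact: computable_const.
  have c : computable (fun z => pair_code (p1 z) (p1 (p2 z))).
    by apply: computable_pair; do ?apply/computable_p1; do ?apply: computable_p2;
      apply: computable_id.
  by have := computable_comp cP c; apply: computable_ext => z; rewrite p1_pair p2_pair.
by apply/computable_p2/computable_p2/computable_id.
Qed.

Lemma dec_bex (P : nat -> nat -> Prop) f :
  dec (fun z => P (p1 z) (p2 z)) -> computable f ->
  dec (fun x => exists2 i, i < f x & P x i).
Proof.
move=> /dec_neg cP cf; have := dec_neg (dec_ball (P := fun x i => ~ P x i) cP cf).
apply: dec_ext => x; split=> [/existsNP[i /not_implyP[im /contrapT Pi]]|[i im Pi] H].
  by exists i.
exact: (H i im).
Qed.

Lemma dec_oracle : dec Z.
Proof.
exists CodeOracle => x; case: asboolP => Zx /=;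
  [exact: eval_oracle_in|exact: eval_oracle_out].
Qed.

Lemma dec_Turing (X : set nat) : dec X -> Turing_le X Z.
Proof.
move=> [c cX]; exists c => x; have := cX x.
by case: asboolP => Xx cx; split.
Qed.

(** [entry w i] is the [i]-th term of the sequence coded by [w], obtained by
    iterating the inverse of the pairing function. *)
Definition tail (w i : nat) : nat := nat_rec (fun=> nat) w (fun _ y => p2 y) i.
Definition entry (w i : nat) : nat := p1 (tail w i).

Lemma tail_cons x w i : tail (pair_code x w) i.+1 = tail w i.
Proof. by elim: i => [|i /= <-] //=; rewrite p2_pair. Qed.

Lemma code_sequence (f : nat -> nat) (n : nat) :
  exists2 w, forall i, i < n -> entry w i = f i & tail w n = 0.
Proof.
elim: n f => [|n IH] f; first by exists 0.
have [w wf wn] := IH (f \o succn); exists (pair_code (f 0) w).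
  by case=> [_|i /wf /= wi]; rewrite -?wi /entry ?tail_cons //= p1_pair.
by rewrite tail_cons.
Qed.

(** Codes whose tail vanishes are canonical; this keeps witnesses that contain
    finite sequences unique. *)
Lemma code_uniq (n w w' : nat) : tail w n = 0 -> tail w' n = 0 ->
  (forall i, i < n -> entry w i = entry w' i) -> w = w'.
Proof.
elim: n w w' => [|n IH] w w'; first by move=> /= -> ->.
rewrite -(pair_p w) -(pair_p w') !tail_cons => wn wn' e.
have /= := e 0 isT; rewrite /entry /= !p1_pair => ->.
rewrite (IH (p2 w) (p2 w')) // => i im.
by have := e i.+1 im; rewrite /entry !tail_cons.
Qed.

Lemma computable_tail f g : computable f -> computable g ->
  computable (fun x => tail (f x) (g x)).
Proof.
move=> cf cg; apply: computable_rec cf _ cg.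
by do !apply: computable_p2; apply: computable_id.
Qed.

Lemma computable_entry f g : computable f -> computable g ->
  computable (fun x => entry (f x) (g x)).
Proof. by move=> cf cg; apply/computable_p1/computable_tail. Qed.

End Computable.

(** Proves computability along the syntax of the function or predicate. *)
Ltac comp1 :=
  lazymatch goal with
  | |- computable _ (fun x => x) => exact: computable_id
  | |- computable _ p1 => exact: (computable_p1 (computable_id _))
  | |- computable _ p2 => exact: (computable_p2 (computable_id _))
  | |- computable _ (fun _ => ?c) => exact: computable_const
  | |- computable _ (fun x => p1 (@?f x)) => apply: computable_p1
  | |- computable _ (fun x => p2 (@?f x)) => apply: computable_p2
  | |- computable _ (fun x => Cantor.to_nat (@?f x, @?g x)) => apply: computable_pair
  | |- computable _ (fun x => entry (@?f x) (@?g x)) => apply: computable_entry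
  | |- computable _ (fun x => tail (@?f x) (@?g x)) => apply: computable_tail
  | |- computable _ (fun x => @?f x + @?g x) => apply: computable_add
  | |- computable _ (fun x => _ * @?f x) => apply: computable_mul
  | |- computable _ (fun x => @?f x - @?g x) => apply: computable_sub
  | |- computable _ (fun x => (@?f x).-1) => apply: computable_pred
  | |- computable _ (fun x => (@?f x).+1) => apply: computable_S
  | |- dec _ (fun x => is_true (@?b x)) => apply: decb_dec
  | |- dec _ (fun x => @?P x /\ @?Q x) => apply: dec_and
  | |- dec _ (fun x => @?P x \/ @?Q x) => apply: dec_or
  | |- dec _ (fun x => ~ @?P x) => apply: dec_neg
  | |- dec _ (fun x => @?f x = @?g x) => apply: dec_eq
  | |- decb _ (fun x => @?f x == @?g x) => apply: decb_eq
  | |- decb _ (fun x => @?f x <= @?g x) => apply: decb_leq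
  | |- decb _ (fun x => @?b x && @?c x) => apply: decb_and
  | |- decb _ (fun x => @?b x || @?c x) => apply: decb_or
  | |- decb _ (fun x => ~~ @?b x) => apply: decb_neg
  | |- computable ?Z (fun x => nat_of_bool (@?b x)) => change (decb Z b)
  | |- computable _ (fun x => if _ then _ else _) => apply: computable_if
  end.

Ltac comp := repeat first [assumption | progress cbv beta | comp1].

(** * The arithmetical hierarchy *)

(** [arith Z n] is the class of Sigma_n predicates relative to [Z]; a Pi_n
    predicate is handled as one whose complement lies in [arith Z n]. *)
Fixpoint arith (Z : set nat) (n : nat) (P : nat -> Prop) : Prop :=
  if n is n'.+1 then
    exists2 Q, arith Z n' Q & forall x, P x <-> exists y, ~ Q (pair_code x y)
  else dec Z P.

Section Arith.
Variable Z : set nat.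
Local Notation arith := (arith Z).
Local Notation computable := (computable Z).

Lemma arith_ext n P Q : (forall x, P x <-> Q x) -> arith n P -> arith n Q.
Proof. by move=> PQ; have -> : P = Q by apply/funext => x; apply/propext. Qed.

Lemma arith_comp n P f : arith n P -> computable f -> arith n (fun x => P (f x)).
Proof.
elim: n P f => [|n IH] P f; first exact: dec_comp.
move=> [Q aQ PQ] cf; exists (fun z => Q (pair_code (f (p1 z)) (p2 z))).
  apply: (IH Q (fun z => pair_code (f (p1 z)) (p2 z))) => //.
  by apply: computable_pair; [apply: computable_comp cf _|]; comp.
by move=> x; rewrite PQ; split=> -[y H]; exists y; move: H; rewrite p1_pair p2_pair.
Qed.

Lemma arith_up n : (forall P, dec Z P -> arith n P) /\
  (forall P, arith n P -> arith n.+1 P) /\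
  (forall P, arith n P -> arith n.+1 (fun x => ~ P x)).
Proof.
have dum m P : arith m P -> arith m.+1 (fun x => ~ P x).
  move=> aP; exists (fun z => P (p1 z)); first by apply: arith_comp aP _; comp.
  by move=> x; split=> [H|[y]]; first exists 0; rewrite p1_pair.
have zero P : dec Z P -> arith 1 P.
  move=> dP; apply: arith_ext (dum 0 (fun x => ~ P x) (dec_neg dP)) => x.
  by split=> [/contrapT //|Px]; apply.
elim: n => [|n [IH1 [IH2 _]]].
  by split=> //; split; [exact: zero|exact: dum].
split; first by move=> P /IH1/IH2.
split; last exact: dum.
by move=> P [Q /IH2 aQ PQ]; exists Q.
Qed.

Lemma arith_dec n P : dec Z P -> arith n P.
Proof. by move=> dP; apply: (arith_up n).1. Qed.

Lemma arith_S n P : arith n P -> arith n.+1 P.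
Proof. exact: (arith_up n).2.1. Qed.

Lemma arith_neg n P : arith n P -> arith n.+1 (fun x => ~ P x).
Proof. exact: (arith_up n).2.2. Qed.

Lemma arith_and_or n P Q : arith n P -> arith n Q ->
  arith n (fun x => P x /\ Q x) /\ arith n (fun x => P x \/ Q x).
Proof.
elim: n P Q => [|n IH] P Q; first by move=> dP dQ; split; [apply: dec_and|apply: dec_or].
move=> [P' aP' PE] [Q' aQ' QE]; split.
  have aP2 : arith n (fun z => P' (pair_code (p1 z) (p1 (p2 z)))) by apply: arith_comp
    aP' _; comp.
  have aQ2 : arith n (fun z => Q' (pair_code (p1 z) (p2 (p2 z)))) by apply: arith_comp
    aQ' _; comp.
  have [_ aU] := IH _ _ aP2 aQ2; eexists; first exact: aU.
  move=> x; rewrite PE QE /=; split=> [[[y Hy] [z Hz]]|[w]].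
    by exists (pair_code y z); rewrite !(p1_pair, p2_pair); case.
  by rewrite p1_pair p2_pair => /not_orP[Hy Hz]; split; [exists (p1 w)|exists (p2 w)].
have [aU _] := IH _ _ aP' aQ'; eexists; first exact: aU.
move=> x; rewrite PE QE /=; split=> [[[y Hy]|[y Hy]]|[y /not_andP[Hy|Hy]]].
- by exists y; case.
- by exists y; case.
- by left; exists y.
- by right; exists y.
Qed.

Lemma arith_and n P Q : arith n P -> arith n Q -> arith n (fun x => P x /\ Q x).
Proof. by move=> aP aQ; have [] := arith_and_or aP aQ. Qed.

Lemma arith_or n P Q : arith n P -> arith n Q -> arith n (fun x => P x \/ Q x).
Proof. by move=> aP aQ; have [] := arith_and_or aP aQ. Qed.

Lemma arith_ex n (P : nat -> nat -> Prop) :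
  arith n.+1 (fun z => P (p1 z) (p2 z)) -> arith n.+1 (fun x => exists y, P x y).
Proof.
move=> [Q aQ PQ].
exists (fun z => Q (pair_code (pair_code (p1 z) (p1 (p2 z))) (p2 (p2 z)))).
  by apply: (arith_comp aQ (f := fun z => pair_code (pair_code (p1 z) (p1 (p2 z))) (p2
    (p2 z)))); comp.
have PE x y : P x y <-> exists u, ~ Q (pair_code (pair_code x y) u).
  by rewrite -PQ p1_pair p2_pair.
move=> x; split=> [[y /PE[u H]]|[w H]].
  by exists (pair_code y u); rewrite !(p1_pair, p2_pair).
exists (p1 w); apply/PE; exists (p2 w).
by move: H; rewrite !(p1_pair, p2_pair).
Qed.

Lemma arith_bex n (P : nat -> nat -> Prop) f :
  arith n (fun z => P (p1 z) (p2 z)) -> computable f ->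
  arith n (fun x => exists2 i, i < f x & P x i).
Proof.
case: n => [|n] aP cf; first exact: dec_bex.
have : arith n.+1 (fun x => exists i, i < f x /\ P x i).
  apply: arith_ex; apply: arith_and aP; apply: arith_dec; apply: decb_dec.
  apply: decb_leq; last by apply: computable_comp cf _; comp.
  by comp.
by apply: arith_ext => x; split=> -[i]; [case|]; exists i.
Qed.

(** Collection: finitely many witnesses are coded by one sequence. *)
Lemma arith_ball n (P : nat -> nat -> Prop) f :
  arith n (fun z => P (p1 z) (p2 z)) -> computable f ->
  arith n (fun x => forall i, i < f x -> P x i).
Proof.
case: n => [|n] aP cf; first exact: dec_ball.
have [Q aQ PQ] := aP.
have PE x i : P x i <-> exists u, ~ Q (pair_code (pair_code x i) u).
  by rewrite -PQ p1_pair p2_pair.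
pose g z i := pair_code (pair_code (p1 z) i) (entry (p2 z) i).
have aQ' : arith n (fun z => exists2 i, i < f (p1 z) & Q (g z i)).
  apply: arith_bex; last by apply: computable_comp cf _; comp.
  by apply: arith_comp aQ _; rewrite /g; comp.
exists (fun z => exists2 i, i < f (p1 z) & Q (g z i)) => // x.
split=> [H|[w H] i im].
  have /choice[u uP] : forall i, exists u, i < f x -> ~ Q (pair_code (pair_code x i) u).
    by move=> i; have [/H/PE[u Hu]|] := boolP (i < f x); [exists u|exists 0].
  have [w wu _] := code_sequence u (f x); exists w => -[i].
  by rewrite /g p1_pair p2_pair => im; rewrite wu //; apply: uP.
apply/PE; exists (entry w i) => Qw; apply: H; exists i; first by rewrite p1_pair.
by rewrite /g p1_pair p2_pair.
Qed.

(** Every Sigma predicate has unique Pi witnesses: a witness is paired with the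
    sequence of the unique refutations of all smaller candidates. *)
Lemma arith_unique n P : arith n.+1 P -> exists Q,
  [/\ arith n (fun z => ~ Q z), forall x, P x <-> exists y, Q (pair_code x y)
    & forall x y y', Q (pair_code x y) -> Q (pair_code x y') -> y = y'].
Proof.
have least (D : nat -> Prop) : (exists y, D y) ->
    exists2 y, D y & forall i, i < y -> ~ D i.
  move=> [y0 Dy0]; have exP : exists y, `[< D y >] by exists y0; apply/asboolP.
  case: (ex_minnP exP) => y /asboolP Dy ymin; exists y => // i iy Di.
  by move: iy; rewrite ltnNge ymin //; apply/asboolP.
elim: n P => [|n IH] P [G aG PE].
  exists (fun z => ~ G z /\ forall i, i < p2 z -> G (pair_code (p1 z) i)); split.
  - apply: dec_neg; apply: dec_and; first exact: dec_neg.
    apply: dec_ball; last by comp.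
    by apply: (dec_comp aG (f := fun z => pair_code (p1 (p1 z)) (p2 z))); comp.
  - move=> x; rewrite PE; split=> [/least[y Gy ymin]|[y [Gy _]]]; last by exists y.
    by exists y; split=> // i; rewrite p1_pair p2_pair => /ymin/contrapT.
  - move=> x y y' [Gy yG] [Gy' y'G]; move: yG y'G; rewrite !p1_pair !p2_pair => yG y'G.
    by case: (ltngtP y y') => // [/y'G|/yG].
have {}aG : arith n.+1 G := aG.
have [K [aK GE Ku]] := IH _ aG.
pose Q z := [/\ ~ G (pair_code (p1 z) (p1 (p2 z))),
  forall i, i < p1 (p2 z) ->
    K (pair_code (pair_code (p1 z) i) (entry (p2 (p2 z)) i))
  & tail (p2 (p2 z)) (p1 (p2 z)) = 0].
have QE x y w : Q (pair_code x (pair_code y w)) <-> [/\ ~ G (pair_code x y),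
    forall i, i < y -> K (pair_code (pair_code x i) (entry w i)) & tail w y = 0].
  by rewrite /Q !(p1_pair, p2_pair).
exists Q; split.
- have : arith n.+1 (fun z => G (pair_code (p1 z) (p1 (p2 z))) \/
      ((exists2 i, i < p1 (p2 z) &
        ~ K (pair_code (pair_code (p1 z) i) (entry (p2 (p2 z)) i))) \/
       tail (p2 (p2 z)) (p1 (p2 z)) <> 0)).
    apply: arith_or; last apply: arith_or.
    + by apply: (arith_comp aG (f := fun z => pair_code (p1 z) (p1 (p2 z)))); comp.
    + apply: arith_bex; last by comp.
      apply: arith_S.
      apply: (arith_comp aK (f := fun z => pair_code (pair_code (p1 (p1 z)) (p2 z))
        (entry (p2 (p2 (p1 z))) (p2 z)))).
      by comp.
    + apply: arith_dec; apply: dec_neg.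
      by comp.
  apply: arith_ext => z; split=> [[Gz|[[i iz Kz]|tz]] [Gz' Kz' tz']|nQ] //.
    exact: Kz (Kz' i iz).
  have [|Gz] := pselect (G (pair_code (p1 z) (p1 (p2 z)))); first by left.
  right; have [tz|] := pselect (tail (p2 (p2 z)) (p1 (p2 z)) = 0); last by right.
  left; apply: contrapT => no; apply: nQ; split=> // i iz.
  by apply: contrapT => Kz; apply: no; exists i.
- move=> x; rewrite PE; split=> [/least[y Gy ymin]|[w]]; last first.
    by rewrite -(pair_p w) => /QE[]; exists (p1 w).
  have /choice[u uP] : forall i, exists u, i < y -> K (pair_code (pair_code x i) u).
    move=> i; have [/ymin/contrapT/GE[u Ku']|] := boolP (i < y); first by exists u.
    by exists 0.
  have [w wu wy] := code_sequence u y; exists (pair_code y w); apply/QE; split=> // i iy.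
  by rewrite wu //; apply: uP.
- move=> x v v'; rewrite -(pair_p v) -(pair_p v') => /QE[Gy Ky ty] /QE[Gy' Ky' ty'].
  have e : p1 v = p1 v'.
    case: (ltngtP (p1 v) (p1 v')) => // lt.
      by case: Gy; apply/GE; exists (entry (p2 v') (p1 v)); apply: Ky'.
    by case: Gy'; apply/GE; exists (entry (p2 v) (p1 v')); apply: Ky.
  have -> : p2 v = p2 v'; last by rewrite e.
  apply: (code_uniq ty); first by rewrite e.
  by move=> i iy; apply: Ku (Ky i iy) (Ky' i _); rewrite -e.
Qed.

(** A Pi_(n+2) predicate says that infinitely many candidates have a Pi_n
    property: the witnesses that the Sigma_(n+1) matrix holds up to a bound are
    made unique and counted together with the bound. *)
Lemma arith_infinite n P : arith n.+2 (fun x => ~ P x) -> exists Q,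
  arith n (fun z => ~ Q z) /\
  forall x, P x <-> forall a, at_least (fun y => Q (pair_code x y)) a.
Proof.
move=> [G aG PE]; have {}aG : arith n.+1 G := aG.
have {}PE x : P x <-> forall y, G (pair_code x y).
  split=> [Px y|H]; apply: contrapT => no.
    by have /PE : exists y, ~ G (pair_code x y) by exists y.
  by have /PE[y] := no; apply.
pose W z := forall i, i < (p2 z).+1 -> G (pair_code (p1 z) i).
have aW : arith n.+1 W.
  apply: arith_ball; last by comp.
  by apply: (arith_comp aG (f := fun z => pair_code (p1 (p1 z)) (p2 z))); comp.
have WE x y : W (pair_code x y) <-> forall i, i <= y -> G (pair_code x i).
  by rewrite /W p1_pair p2_pair; split=> H i /H.
have [K [aK WK Ku]] := arith_unique aW.
pose Q z := K (pair_code (pair_code (p1 z) (p1 (p2 z))) (p2 (p2 z))).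
have QE x y w : Q (pair_code x (pair_code y w)) <-> K (pair_code (pair_code x y) w).
  by rewrite /Q !(p1_pair, p2_pair).
exists Q; split.
  apply: (arith_comp aK (f := fun z => pair_code (pair_code (p1 z) (p1 (p2 z))) (p2 (p2
    z)))).
  by comp.
move=> x; split=> [/PE Gx a|H].
  have /choice[w wP] : forall y, exists w, K (pair_code (pair_code x y) w).
    by move=> y; apply/WK/WE => i _.
  apply: (at_least_inj (f := fun y => pair_code y (w y))) (at_least_nat a).
    by move=> y _; apply/QE.
  by move=> y y' _ _ /pair_inj[].
apply/PE => y; apply: contrapT => nG.
have /at_least_ord : at_least (fun i => i < y) y.+1.
  apply: (at_least_inj (f := p1)) (H y.+1) => [v|v v'].
    rewrite -{1}(pair_p v) => /QE Kv; rewrite ltnNge; apply/negP => yv; apply: nG.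
    by have /WE : W (pair_code x (p1 v)) by [apply/WK; exists (p2 v)]; apply.
  rewrite -{1}(pair_p v) -{1}(pair_p v') => /QE Kv /QE Kv' e.
  by rewrite e in Kv; rewrite -(pair_p v) -(pair_p v') e (Ku _ _ _ Kv Kv').
by rewrite ltnn.
Qed.

End Arith.

(** ** The jump *)

Lemma code_index_inj : injective code_index.
Proof.
elim=> [|||||c IHc d IHd|c IHc d IHd|c IHc d IHd|c IHc] [|||||c' d'|c' d'|c' d'|c'] //=;
  try by move=> e; exfalso; lia.
all: try (move=> e; have /pair_inj[/IHc -> /IHd ->] // :
  pair_code (code_index c) (code_index d) = pair_code (code_index c') (code_index d')
    by lia).
by move=> e; have /IHc -> // : code_index c = code_index c' by lia.
Qed.

(** Surjectivity makes every number that occurs in a step the index of a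
    program. *)
Lemma code_index_surj (n : nat) : exists c, code_index c = n.
Proof.
elim/ltn_ind: n => n IH.
have [n5|n5] := leqP 5 n; last first.
  by case: n n5 {IH} => [|[|[|[|[|]]]]] // _; [exists CodeZero|exists CodeSucc
    |exists CodeFst|exists CodeSnd|exists CodeOracle].
have nE := divn_eq (n - 5) 4; set q := (n - 5) %/ 4 in nE.
have r4 : (n - 5) %% 4 < 4 by apply: ltn_pmod.
have le : p2 q + p1 q <= q.
  by rewrite -{3}(pair_p q); apply/leP/Cantor.to_nat_non_decreasing.
have [|a ea] := IH (p1 q); first by lia.
have [|b eb] := IH (p2 q); first by lia.
have [|c ec] := IH q; first by lia.
case r : ((n - 5) %% 4) r4 nE => [|[|[|[|//]]]] _ nE.
- by exists (CodePair a b); rewrite /= ea eb pair_p; lia.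
- by exists (CodeComp a b); rewrite /= ea eb pair_p; lia.
- by exists (CodeRec a b); rewrite /= ea eb pair_p; lia.
- by exists (CodeMin c); rewrite /= ec; lia.
Qed.

Definition fact (c x y : nat) : nat := pair_code c (pair_code x y).

(** One step of an evaluation, for codes given by their indices, from the
    previously established facts [F a x y] that program [a] maps [x] to [y]. *)
Definition eval_step (Y : set nat) (F : nat -> Prop) (c x y : nat) : Prop :=
  (c = 0 /\ y = 0) \/ (c = 1 /\ y = x.+1) \/ (c = 2 /\ y = p1 x) \/
  (c = 3 /\ y = p2 x) \/ (c = 4 /\ (Y x /\ y = 1)) \/ (c = 4 /\ (~ Y x /\ y = 0)) \/
  (exists a, exists b, c = 4 * pair_code a b + 5 /\
    (F (fact a x (p1 y)) /\ F (fact b x (p2 y)))) \/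
  (exists a, exists b, c = 4 * pair_code a b + 6 /\
    exists u, F (fact b x u) /\ F (fact a u y)) \/
  (exists a, exists b, c = 4 * pair_code a b + 7 /\
    (p2 x = 0 /\ F (fact a (p1 x) y))) \/
  (exists a, exists b, c = 4 * pair_code a b + 7 /\
    exists n, exists u, p2 x = n.+1 /\ (F (fact c (pair_code (p1 x) n) u) /\
      F (fact b (pair_code (p1 x) (pair_code n u)) y))) \/
  (exists a, c = 4 * a + 8 /\ (F (fact a (pair_code x y) 0) /\
    forall i, i < y -> exists v, F (fact a (pair_code x i) v.+1))).

Definition holds (Y : set nat) (c x y : nat) : Prop :=
  exists2 C, code_index C = c & eval Y C x y.

Definition holds_fact (Y : set nat) (q : nat) : Prop :=
  holds Y (p1 q) (p1 (p2 q)) (p2 (p2 q)).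

Lemma holds_factE Y c x y : holds_fact Y (fact c x y) <-> holds Y c x y.
Proof. by rewrite /holds_fact /fact !(p1_pair, p2_pair). Qed.

Lemma eval_step_mono Y (F G : nat -> Prop) c x y :
  (forall q, F q -> G q) -> eval_step Y F c x y -> eval_step Y G c x y.
Proof.
move=> FG.
move=> [?|[?|[?|[?|[?|[?|[H|[H|[H|[H|H]]]]]]]]]]; first by left.
- by right; left.
- by do 2 right; left.
- by do 3 right; left.
- by do 4 right; left.
- by do 5 right; left.
- do 6 right; left; case: H => a [b [e [/FG Fa /FG Fb]]]; by exists a, b.
- do 7 right; left; case: H => a [b [e [u [/FG Fa /FG Fb]]]]; exists a, b; split=> //.
  by exists u.
- do 8 right; left; case: H => a [b [e [e' /FG Fa]]]; by exists a, b.
- do 9 right; left; case: H => a [b [e [n [u [e' [/FG Fa /FG Fb]]]]]]; exists a, b;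
    split=> //.
  by exists n, u.
- do 10 right; case: H => a [e [/FG Fa H]]; exists a; split=> //;
    split=> // i /H[v /FG Fv].
  by exists v.
Qed.

Lemma eval_step_sound Y (F : nat -> Prop) c x y :
  (forall q, F q -> holds_fact Y q) -> eval_step Y F c x y -> holds Y c x y.
Proof.
move=> FH /(eval_step_mono FH).
move=> [[-> ->]|[[-> ->]|[[-> ->]|[[-> ->]|[[-> [Yx ->]]|[[-> [Yx ->]]|H]]]]]].
- by exists CodeZero; constructor.
- by exists CodeSucc; constructor.
- by exists CodeFst => //; rewrite -{1}(pair_p x); constructor.
- by exists CodeSnd => //; rewrite -{1}(pair_p x); constructor.
- by exists CodeOracle; constructor.
- by exists CodeOracle; constructor.
case: H => [H|[H|[H|[H|H]]]].
- case: H => a [b [-> [/holds_factE[A <- eA] /holds_factE[B <- eB]]]].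
  by exists (CodePair A B) => //; rewrite -(pair_p y); apply: eval_pair.
- case: H => a [b [-> [u [/holds_factE[B <- eB] /holds_factE[A <- eA]]]]].
  by exists (CodeComp A B) => //; apply: eval_comp eA.
- case: H => a [b [-> [x0 /holds_factE[A <- eA]]]].
  have [B <-] := code_index_surj b.
  by exists (CodeRec A B) => //; rewrite -(pair_p x) x0; apply: eval_rec0.
- case: H => a [b [-> [n [u [xn [/holds_factE[R Re eR] /holds_factE[B Bb eB]]]]]]].
  exists R => //; rewrite -(pair_p x) xn.
  case: R Re eR => /= [|||||A B'|A B'|A B'|A] Re eR; try by exfalso; lia.
  have /pair_inj[_ e] : pair_code (code_index A) (code_index B') = pair_code a b by lia.
  have e' : B' = B by apply: code_index_inj; rewrite e.
  by rewrite e' in eR *; apply: eval_recS eR eB.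
- case: H => a [-> [/holds_factE[A <- eA] H]].
  have /choice[v vP] : forall i, exists v, i < y -> eval Y A (pair_code x i) v.+1.
    move=> i; have [/H[v /holds_factE[A' /code_index_inj -> eA']]|] := boolP (i < y).
      by exists v.
    by exists 0.
  by exists (CodeMin A) => //; apply: (eval_min (v := v)).
Qed.

(** A derivation of facts, each by one step from earlier ones. *)
Definition certificate (Y : set nat) (s : seq nat) : Prop :=
  forall i, i < size s -> eval_step Y (fun q => q \in take i s)
    (p1 (nth 0 s i)) (p1 (p2 (nth 0 s i))) (p2 (p2 (nth 0 s i))).

Lemma certificate_cat Y s s' :
  certificate Y s -> certificate Y s' -> certificate Y (s ++ s').
Proof.
move=> cs cs' i; rewrite size_cat nth_cat take_cat => is'.
case: ltnP => [/cs //|si].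
have : i - size s < size s' by lia.
by move=> /cs'; apply: eval_step_mono => q; rewrite mem_cat orbC => ->.
Qed.

Lemma certificate_step Y s c x y : certificate Y s ->
  eval_step Y (fun q => q \in s) c x y ->
  exists2 s', certificate Y s' & fact c x y \in s'.
Proof.
move=> cs st; exists (rcons s (fact c x y)); last by rewrite mem_rcons inE eqxx.
move=> i; rewrite size_rcons ltnS nth_rcons -cats1 take_cat => is'.
case: ltnP => [/cs //|si]; have -> : i = size s by lia.
rewrite eqxx /fact !(p1_pair, p2_pair) subnn cats0; exact: st.
Qed.

Lemma certificate_all Y (f : nat -> nat) (n : nat) :
  (forall i, i < n -> exists2 s, certificate Y s & f i \in s) ->
  exists2 s, certificate Y s & forall i, i < n -> f i \in s.
Proof.
elim: n => [|n IH] H; first by exists [::].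
have [s cs ss] := IH (fun i im => H i (ltnW im)).
have [s' cs' ss'] := H n (ltnSn n).
exists (s ++ s'); first exact: certificate_cat.
move=> i; rewrite ltnS mem_cat leq_eqVlt => /orP[/eqP->|/ss ->] //.
by rewrite ss' orbT.
Qed.

Lemma certificate_complete Y C x y : eval Y C x y ->
  exists2 s, certificate Y s & fact (code_index C) x y \in s.
Proof.
have nil : certificate Y [::] by [].
elim=> {C x y}
  [x|x|x y|x y|x Yx|x Yx|c d x y z _ [s cs ys] _ [s' cs' ys']
  |c d x y z _ [s cs ys] _ [s' cs' ys']|c d x y _ [s cs ys]
  |c d x n y z _ [s cs ys] _ [s' cs' ys']|c x n v _ IHv _ [s cs ys]].
- by apply: certificate_step nil _; left.
- by apply: certificate_step nil _; right; left.
- by apply: certificate_step nil _; do 2 right; left; rewrite p1_pair.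
- by apply: certificate_step nil _; do 3 right; left; rewrite p2_pair.
- by apply: certificate_step nil _; do 4 right; left.
- by apply: certificate_step nil _; do 5 right; left.
- apply: certificate_step (certificate_cat cs cs') _; do 6 right; left.
  exists (code_index c), (code_index d); rewrite p1_pair p2_pair !mem_cat.
  by rewrite ys ys' orbT.
- apply: certificate_step (certificate_cat cs cs') _; do 7 right; left.
  exists (code_index c), (code_index d); split=> //; exists y.
  by rewrite !mem_cat ys ys' orbT.
- apply: certificate_step cs _; do 8 right; left.
  by exists (code_index c), (code_index d); rewrite p1_pair p2_pair.
- apply: certificate_step (certificate_cat cs cs') _; do 9 right; left.
  exists (code_index c), (code_index d); split=> //; exists n, y.
  by rewrite p1_pair p2_pair !mem_cat ys ys' orbT.
- have [s' cs' vs'] := certificate_all IHv.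
  apply: certificate_step (certificate_cat cs cs') _; do 10 right.
  exists (code_index c); split=> //; rewrite mem_cat ys; split=> // i im.
  by exists (v i); rewrite mem_cat vs' ?orbT.
Qed.

Definition halting (Y : set nat) (e : nat) : Prop :=
  exists w, exists n,
    (forall i, i < n -> eval_step Y (fun q => exists j, j < i /\ entry w j = q)
       (p1 (entry w i)) (p1 (p2 (entry w i))) (p2 (p2 (entry w i)))) /\
    (exists i, i < n /\ exists y, entry w i = fact e e y).

Lemma jump_halting Y e : jump Y e <-> halting Y e.
Proof.
split=> [[C [<- [y /certificate_complete[s cs ys]]]]|[w [n [st [i [im [y ey]]]]]]].
  have [w ws _] := code_sequence (nth 0 s) (size s).
  exists w, (size s); split=> [i im|].
    rewrite ws //; apply: eval_step_mono (cs i im) => q /(nthP 0)[j].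
    rewrite size_take im => ji; rewrite nth_take // => <-.
    by exists j; rewrite ws //; apply: ltn_trans im.
  move: ys => /(nthP 0)[i im ei]; exists i; split=> //.
  by exists y; rewrite ws.
have all : forall i, i < n -> holds_fact Y (entry w i).
  elim/ltn_ind => j IH jn; apply: eval_step_sound (st j jn) => q [l [lj <-]].
  by apply: IH => //; apply: ltn_trans jn.
have := all i im; rewrite ey => /holds_factE[C Ce H].
by exists C; split=> //; exists y.
Qed.

Section ArithJump.
Variable Z : set nat.

(** The oracle occurs in a step both positively and negatively, which is why the
    level goes up by one. *)
Lemma arith_eval_step n Y (F : nat -> nat -> Prop) :
  arith Z n Y -> arith Z n.+1 (fun t => F (p1 t) (p2 t)) ->
  arith Z n.+1 (fun t => eval_step Y (F (p1 t))
    (p1 (p2 t)) (p1 (p2 (p2 t))) (p2 (p2 (p2 t)))).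
Proof.
move=> aY aF.
have aFc f g : computable Z f -> computable Z g -> arith Z n.+1 (fun t => F (f t) (g t)).
  move=> cf cg; have := arith_comp aF (computable_pair cf cg).
  by apply: arith_ext => t; rewrite p1_pair p2_pair.
have aYc f : computable Z f -> arith Z n.+1 (fun t => Y (f t)).
  by move=> cf; apply: (arith_comp (arith_S aY) cf).
have aNYc f : computable Z f -> arith Z n.+1 (fun t => ~ Y (f t)).
  by move=> cf; apply: (arith_comp (arith_neg aY) cf).
rewrite /eval_step /fact.
repeat lazymatch goal with
| |- arith _ _ (fun t => _ \/ _) => apply: arith_or
| |- arith _ _ (fun t => _ /\ _) => apply: arith_and
| |- arith _ _ (fun t => F _ _) => apply: aFc; comp
| |- arith _ _ (fun t => Y _) => apply: aYc; comp
| |- arith _ _ (fun t => ~ Y _) => apply: aNYc; comp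
| |- arith _ _ (fun t => _ = _) => apply: arith_dec; comp
| |- arith _ _ (fun t => exists y, _) => apply: arith_ex
| |- arith _ _ (fun t => forall i, _) => apply: arith_ball; last by comp
end.
Qed.

Lemma arith_jump n Y : arith Z n Y -> arith Z n.+1 (jump Y).
Proof.
move=> aY; apply: (arith_ext (P := halting Y)); first by move=> e; rewrite jump_halting.
rewrite /halting; do 2 apply: arith_ex; apply: arith_and.
  apply: arith_ball; last by comp.
  pose F z q := exists j, j < p2 z /\ entry (p1 z) j = q.
  have aF : arith Z n.+1 (fun t => F (p1 t) (p2 t)).
    by rewrite /F; apply: arith_ex; apply: arith_and; apply: arith_dec; comp.
  have := arith_comp (arith_eval_step aY aF) (f := fun z => pair_code
    (pair_code (p2 (p1 (p1 z))) (p2 z)) (entry (p2 (p1 (p1 z))) (p2 z))) ltac:(comp).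
  by apply: arith_ext => z; rewrite /F !(p1_pair, p2_pair).
apply: arith_ex; apply: arith_and; first by apply: arith_dec; comp.
by apply: arith_ex; apply: arith_dec; rewrite /fact; comp.
Qed.

Lemma arith_iter_jump k : arith Z k (iter_jump k Z).
Proof. by elim: k => [|k IH]; [exact: dec_oracle|exact: arith_jump]. Qed.

End ArithJump.

(** * Computable trees *)

Definition card (T : Type) (D : T -> Prop) : natomega :=
  projT1 (cid (counted_exists D)).

Lemma cardP (T : Type) (D : T -> Prop) : counted D (card D).
Proof. exact: projT2 (cid (counted_exists D)). Qed.

(** Nodes carry codes of their types.  At height n.+1, the code (0, _) stands for
    Omega, (1, k) for the finite type k, and (t, e) with t > 1 for the number of
    b such that F n (e, b). *)
Definition ltype (F : nat -> nat -> Prop) (n c : nat) : natomega :=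
  if n is i.+1 then
    if p1 c == 0 then Omega else if p1 c == 1 then Fin (p2 c)
    else card (fun b => F i (pair_code (p2 c) b))
  else Omega.

(** [child F n c j] is 0 if a node of height [n] with code [c] has no [j]-th
    child, and otherwise the successor of the code of that child.  Above height
    one, the children (k.+1, _) supply infinitely many nodes of type k, and only
    the children (0, b) may be of type Omega. *)
Definition child (F : nat -> nat -> Prop) (n c j : nat) : nat :=
  if n is 1 then
    if (p1 c == 0) || (((p1 c == 1) && (j.+1 <= p2 c)) ||
      ((2 <= p1 c) && `[< F 0 (pair_code (p2 c) j) >])) then 1 else 0
  else if p1 j == 0 then
    if p1 c == 0 then (pair_code 0 0).+1
    else if p1 c == 1 then (if (p2 j).+1 <= p2 c then (pair_code 0 0).+1 else 0)
    else (pair_code 2 (pair_code (p2 c) (p2 j))).+1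
  else (pair_code 1 (p1 j).-1).+1.

(** A node is a pair of its level [d] and its path [x], where 0 is the path of the
    root and (x, j) that of the [j]-th child of the node with path [x].  The
    value is 0 if there is no such node, and otherwise the successor of its type
    code. *)
Fixpoint code_at (F : nat -> nat -> Prop) (h c0 d x : nat) : nat :=
  if d is d'.+1 then
    if code_at F h c0 d' (p1 x) == 0 then 0
    else child F (h - d') (code_at F h c0 d' (p1 x)).-1 (p2 x)
  else if x == 0 then c0.+1 else 0.

Lemma childE F n c j : 1 < n -> child F n c j =
  if p1 j == 0 then
    if p1 c == 0 then (pair_code 0 0).+1
    else if p1 c == 1 then (if (p2 j).+1 <= p2 c then (pair_code 0 0).+1 else 0)
    else (pair_code 2 (pair_code (p2 c) (p2 j))).+1
  else (pair_code 1 (p1 j).-1).+1.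
Proof. by case: n => [|[|n]]. Qed.

Lemma code_at1 F h c0 j : code_at F h c0 1 (pair_code 0 j) = child F h c0 j.
Proof. by rewrite -[LHS]/(if (if p1 _ == 0 then _ else _) == 0 then _ else _) p1_pair
  p2_pair subn0. Qed.

(** The path of the ancestor [k] levels below. *)
Definition anc (x k : nat) : nat := nat_rec (fun=> nat) x (fun _ y => p1 y) k.

Lemma ancS x k : anc x k.+1 = anc (p1 x) k.
Proof. by elim: k => [|k IH] //=; rewrite -IH. Qed.

Lemma anc_add x k l : anc x (k + l) = anc (anc x k) l.
Proof. by elim: l => [|l IH]; rewrite ?addn0 ?addnS //= IH. Qed.

Definition coded_tree (F : nat -> nat -> Prop) (h c0 : nat) : nat_structure :=
  NatStructure [set z | p1 z <= h /\ code_at F h c0 (p1 z) (p2 z) <> 0]%classic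
    (fun z z' => p1 z < p1 z' /\ p2 z = anc (p2 z') (p1 z' - p1 z)).

Section CodedTree.
Variables (F : nat -> nat -> Prop) (m c0 : nat).
Hypothesis F_step : forall i e, i < m ->
  F i.+1 e <-> forall a, at_least (fun b => F i (pair_code e b)) a.

Local Notation h := m.+1.
Local Notation T := (coded_tree F h c0).
Local Notation code_at := (code_at F h c0).

Lemma ltype_coded n e : n < m ->
  ltype F n.+1 (pair_code 2 e) = Omega <-> F n.+1 e.
Proof.
move=> nm; rewrite /ltype p1_pair p2_pair /= (F_step e nm).
have cD := cardP (fun b => F n (pair_code e b)).
split=> [eO|all]; first by rewrite eO in cD; apply/counted_omega.
exact: counted_uniq cD ((counted_omega _).2 all).
Qed.

Let has_child n c N j := child F n c j <> 0 /\ ltype F n.-1 (child F n c j).-1 = N.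

Lemma child_omega n c : 0 < n <= h ->
  counted (has_child n c Omega) (ltype F n c).
Proof.
case: n => [//|[|n]] nh.
  apply: (counted_ext (D := fun j => [|| p1 c == 0, (p1 c == 1) && (j.+1 <= p2 c)
      | (2 <= p1 c) && `[< F 0 (pair_code (p2 c) j) >]])).
    by move=> j; rewrite /has_child /child; case: ifP => _; split=> // -[].
  rewrite /ltype; case: (p1 c) => [|[|t]] /=.
  - by apply/counted_omega => a; apply: at_least_sub (at_least_nat a).
  - by move=> a; rewrite -at_least_ord; split; apply: at_least_sub => i; rewrite orbF.
  - by apply: counted_ext (cardP _) => j; split=> /asboolP.
have omega2 b := ltype_coded (pair_code (p2 c) b) (ltac:(lia) : n < m).
have [E cE ED] : exists2 E : nat -> Prop, counted E (ltype F n.+2 c) &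
    forall j, has_child n.+2 c Omega j <-> p1 j = 0 /\ E (p2 j).
  have off j : p1 j <> 0 -> ~ has_child n.+2 c Omega j.
    move=> j0 [_]; rewrite /child; case: eqP => // _.
    by rewrite /ltype p1_pair p2_pair.
  have on j : p1 j = 0 -> child F n.+2 c j =
      if p1 c == 0 then (pair_code 0 0).+1
      else if p1 c == 1 then (if (p2 j).+1 <= p2 c then (pair_code 0 0).+1 else 0)
      else (pair_code 2 (pair_code (p2 c) (p2 j))).+1 by move=> j0; rewrite /child j0.
  have zero : ltype F n.+1 (pair_code 0 0) = Omega by rewrite /ltype p1_pair.
  rewrite [ltype _ _ _]/ltype; case t : (p1 c) => [|[|t']] /=.
  - exists (fun=> True); first by apply/counted_omega => a; apply: at_least_nat.
    move=> j; have [j0|j0] := pselect (p1 j = 0); last by split=> [/(off _ j0)|[]].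
    by rewrite /has_child (on j j0) t.
  - exists (fun b => b < p2 c); first by move=> a; apply: at_least_ord.
    move=> j; have [j0|j0] := pselect (p1 j = 0); last by split=> [/(off _ j0)|[]].
    by rewrite /has_child (on j j0) t /=; case: ifP => jc; split=> // -[].
  - exists (fun b => F n.+1 (pair_code (p2 c) b)); first exact: cardP.
    move=> j; have [j0|j0] := pselect (p1 j = 0); last by split=> [/(off _ j0)|[]].
    by rewrite /has_child (on j j0) t /=; split=> [[_ /omega2]|[_ /omega2]].
apply: (counted_bij (f := fun b => pair_code 0 b) (g := p2)) cE => [b Eb|j|b _|j].
- by apply/ED; rewrite p1_pair p2_pair.
- by move=> /ED[].
- by rewrite p2_pair.
- by move=> /ED[j0 _]; rewrite -{2}(pair_p j) j0.
Qed.

Lemma child_fin n c k : 1 < n -> counted (has_child n c (Fin k)) Omega.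
Proof.
case: n => [|[|n]] // _; apply/counted_omega => a.
apply: (at_least_inj (f := fun b => pair_code k.+1 b)) (at_least_nat a).
  by move=> b _; rewrite /has_child /child !p1_pair /= p1_pair p2_pair.
by move=> b b' _ _ /pair_inj[].
Qed.

Lemma code_at_anc d x k : code_at d x <> 0 -> k <= d -> code_at (d - k) (anc x k) <> 0.
Proof.
elim: k d x => [|k IH] [|d] x // dx kd; rewrite ancS subSS; apply: IH => //.
by move: dx => /=; case: eqP.
Qed.

Lemma code_at_root d x : code_at d x <> 0 -> anc x d = 0.
Proof.
by move=> /code_at_anc/(_ (leqnn d)); rewrite subnn /=; case: eqP.
Qed.

Definition node_lev (z : T) : nat := p1 (sval z).
Definition node_code (z : T) : nat := (code_at (p1 (sval z)) (p2 (sval z))).-1.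
Definition node_lab (z : T) : natomega := ltype F (h - node_lev z) (node_code z).

Lemma node_ex d x : d <= h -> code_at d x <> 0 ->
  exists z : T, sval z = pair_code d x.
Proof.
move=> dh dx; have U : universe T (pair_code d x) by rewrite /= p1_pair p2_pair.
by exists (exist _ _ U).
Qed.

Lemma node_root : exists2 r : T, is_root r &
  node_lev r = 0 /\ node_code r = c0.
Proof.
have [//|//|r re] := @node_ex 0 0; exists r; last first.
  by rewrite /node_lev /node_code re p1_pair p2_pair.
move=> z; have [zh zc] := proj2_sig z.
case: (posnP (p1 (sval z))) => z0; last first.
  right; rewrite /= re p1_pair p2_pair subn0 z0; split=> //.
  by rewrite (code_at_root zc).
left; apply: sval_inj; rewrite re -(pair_p (sval z)) z0.
by move: zc; rewrite z0 /=; case: eqP => // ->.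
Qed.

Lemma node_graded : graded node_lev.
Proof.
split=> [x y [] //|y l yl]; have [yh yc] := proj2_sig y.
rewrite /node_lev in yl; rewrite yl in yh yc.
have [||x xe] := @node_ex l (p1 (p2 (sval y))).
- exact: ltnW.
- by have := code_at_anc yc (isT : 1 <= l.+1); rewrite subSS subn0.
exists x; last by rewrite /node_lev xe p1_pair.
by rewrite /= xe yl p1_pair p2_pair subSnn.
Qed.

Lemma node_skeleton : skeleton T.
Proof.
apply: graded_skeleton node_graded => [x y z [xy xyE] [yz yzE]|x y z [yx yxE] [zx zxE]|].
- split; first exact: ltn_trans yz.
  rewrite xyE yzE -anc_add; congr anc; lia.
- have [yz|zy|yz] := ltngtP (p1 (sval y)) (p1 (sval z)).
  + left; split=> //; rewrite yxE zxE -anc_add; congr anc; lia.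
  + right; right; split=> //; rewrite yxE zxE -anc_add; congr anc; lia.
  + right; left; apply: sval_inj.
    by rewrite -[LHS]pair_p -[RHS]pair_p yxE zxE yz.
- by have [r rr _] := node_root; exists r.
Qed.

Lemma code_at_child (x : T) j :
  code_at (node_lev x).+1 (pair_code (p2 (sval x)) j) =
  child F (h - node_lev x) (node_code x) j.
Proof.
have [_ xc] := proj2_sig x.
by rewrite /node_lev /node_code /= p1_pair p2_pair; case: eqP.
Qed.

Lemma node_child (x : T) j : node_lev x < h ->
  child F (h - node_lev x) (node_code x) j <> 0 ->
  exists y : T, sval y = pair_code (node_lev x).+1 (pair_code (p2 (sval x)) j).
Proof. by move=> xh xc; apply: node_ex => //; rewrite code_at_child. Qed.

Lemma node_children (x : T) N K : node_lev x < h ->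
  counted (has_child (h - node_lev x) (node_code x) N) K ->
  counted (fun y : T => [/\ prec x y, node_lev y = (node_lev x).+1 & node_lab y = N]) K.
Proof.
move=> xh; have /choice[g gE] : forall j, exists y : T,
    child F (h - node_lev x) (node_code x) j <> 0 ->
    sval y = pair_code (node_lev x).+1 (pair_code (p2 (sval x)) j).
  move=> j; have [/(node_child xh)[y ye]|no] :=
    pselect (child F (h - node_lev x) (node_code x) j <> 0); first by exists y.
  by exists x.
have yE (y : T) : prec x y -> node_lev y = (node_lev x).+1 ->
    sval y = pair_code (node_lev x).+1 (pair_code (p2 (sval x)) (p2 (p2 (sval y)))).
  rewrite /node_lev => -[_ xE] yl; rewrite -{1}(pair_p (sval y)) yl;
    congr (pair_code _ _).
  by rewrite xE yl subSnn /= pair_p.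
have labE (y : T) j : sval y = pair_code (node_lev x).+1 (pair_code (p2 (sval x)) j) ->
    node_lab y = ltype F (h - node_lev x).-1 (child F (h - node_lev x) (node_code x)
      j).-1.
  move=> ye; rewrite /node_lab {1}/node_lev {1}/node_code ye p1_pair p2_pair
    code_at_child.
  by rewrite subnS.
apply: (counted_bij (f := g) (g := fun y : T => p2 (p2 (sval y)))) =>
  [j [jc jN]|y [xy yl yN]|j [jc jN]|y [xy yl yN]].
- have ge := gE j jc; split.
  + by rewrite /= ge p1_pair p2_pair /node_lev subSnn /= p1_pair.
  + by rewrite /node_lev ge p1_pair.
  + by rewrite (labE _ _ ge).
- have ye := yE y xy yl; split; last by rewrite -yN (labE _ _ ye).
  have [_] := proj2_sig y; rewrite ye p1_pair !p2_pair.
  by rewrite code_at_child.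
- by rewrite (gE j jc) !p2_pair.
- have ye := yE y xy yl; apply: sval_inj; rewrite gE -?ye //.
  have [_] := proj2_sig y; rewrite {1 2}ye p1_pair p2_pair.
  by rewrite code_at_child.
Qed.

Lemma node_labelled : labelled h node_lev node_lab.
Proof.
split.
- exact: node_skeleton.
- exact: node_graded.
- by move=> x; have [] := proj2_sig x.
- by move=> x xh; rewrite /node_lab xh subnn.
- move=> x xh; apply: node_children => //; apply: child_omega.
  by rewrite subn_gt0 xh leq_subr.
- move=> x k xh; apply: node_children; first exact: ltnW.
  by apply: child_fin; lia.
Qed.

Lemma node_countable : countable [set: T].
Proof.
by apply/countable_injP; exists (fun z => sval z) => x y _ _; apply: sval_inj.
Qed.

Definition coded_ltree : ltree h := LTree node_labelled.

End CodedTree.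

(** ** Computability of coded trees *)

Section ComputableTree.
Variables (Z : set nat) (F : nat -> nat -> Prop) (h c0 : nat).
Hypothesis F0 : dec Z (F 0).

Lemma computable_child n f g : computable Z f -> computable Z g ->
  computable Z (fun x => child F n (f x) (g x)).
Proof.
move=> cf cg; rewrite /child; case: n => [|[|n]]; try by comp.
have cF : decb Z (fun x => `[< F 0 (pair_code (p2 (f x)) (g x)) >]).
  by apply: (computable_comp F0); comp.
by comp.
Qed.

Lemma computable_code_at d f : computable Z f ->
  computable Z (fun x => code_at F h c0 d (f x)).
Proof.
elim: d f => [|d IH] f cf /=; first by comp.
have c1 : computable Z (fun x => code_at F h c0 d (p1 (f x))) by apply: IH; comp.
have c2 : computable Z (fun x => child F (h - d) (code_at F h c0 d (p1 (f x))).-1 (p2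
  (f x))).
  by apply: computable_child; comp.
by comp.
Qed.

Lemma computable_anc f g : computable Z f -> computable Z g ->
  computable Z (fun x => anc (f x) (g x)).
Proof. by move=> cf cg; apply: computable_rec cf _ cg; comp. Qed.

Lemma dec_coded_universe : dec Z (universe (coded_tree F h c0)).
Proof.
suff H H0 : dec Z (fun z => p1 z <= H0 /\ code_at F h c0 (p1 z) (p2 z) <> 0) by exact: H.
elim: H0 => [|H IH].
  apply: (dec_ext (P := fun z => p1 z = 0 /\ code_at F h c0 0 (p2 z) <> 0)).
    by move=> z; rewrite leqn0; split=> [[-> zc]|[/eqP -> zc]].
  have c1 : computable Z (fun z => code_at F h c0 0 (p2 z)) by apply:
    computable_code_at; comp.
  by comp.
apply: (dec_ext (P := fun z => (p1 z <= H /\ code_at F h c0 (p1 z) (p2 z) <> 0) \/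
    (p1 z = H.+1 /\ code_at F h c0 H.+1 (p2 z) <> 0))).
  move=> z; split=> [[[zH zc]|[-> //]]|[]]; first by split=> //; apply: leqW.
  by rewrite leq_eqVlt => /orP[/eqP->|]; [right|left].
have c1 : computable Z (fun z => code_at F h c0 H.+1 (p2 z)) by apply:
  computable_code_at; comp.
by comp.
Qed.

Lemma coded_tree_computable : computable_structure Z (coded_tree F h c0).
Proof.
split; first exact: dec_Turing dec_coded_universe.
apply: dec_Turing; set U := universe _.
have dU f : computable Z f -> dec Z (fun x => U (f x)).
  exact: dec_comp dec_coded_universe.
have U1 : dec Z (fun x => U (p1 x)) by apply: dU; comp.
have U2 : dec Z (fun x => U (p2 x)) by apply: dU; comp.
have cA : computable Z (fun x => anc (p2 (p2 x)) (p1 (p2 x) - p1 (p1 x))).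
  by apply: computable_anc; comp.
apply: (dec_ext (P := fun x => U (p1 x) /\ (U (p2 x) /\
    ((p1 (p1 x)).+1 <= p1 (p2 x) /\
     p2 (p1 x) = anc (p2 (p2 x)) (p1 (p2 x) - p1 (p1 x)))))); last by comp.
move=> z; split=> [[z1 [z2 [lt e]]]|[x [y [-> [Ux Uy [lt e]]]]]].
  by exists (p1 z), (p2 z); rewrite pair_p.
by rewrite p1_pair p2_pair.
Qed.

End ComputableTree.

(** * The tree types *)

Lemma tree_type_labelled (h : nat) (N : natomega) (A : structure) :
  tree_type h N A -> countable [set: A] /\
  exists (lev : A -> nat) lab r, [/\ labelled h lev lab, is_root r & lab r = N].
Proof.
move=> tA; have trA := tree_type_is_tree tA; split.
  by have [_ [_ [_ [_ [_ [cA _]]]]]] := trA.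
have sk := is_tree_skeleton trA; have [lev gr _] := skeleton_graded sk.
have [r rr] := sk_root sk.
have rN := tree_type_typed tA sk (cone_map_id rr).
have [lab lA labr] := typed_labelled sk gr (tree_type_depth tA gr) rr rN.
by exists lev, lab, r.
Qed.

Lemma coded_finite_types_realized (m : nat) : finite_types_realized m.+1.
Proof.
move=> p; pose F (_ _ : nat) := True.
have Fs i e : i < m -> F i.+1 e <-> forall a, at_least (fun b => F i (pair_code e b)) a.
  by move=> _; split=> // _ a; apply: at_least_nat.
exists (coded_ltree (pair_code 1 p) Fs); first exact: node_countable.
have [r rr [rl rc]] := node_root F m (pair_code 1 p); exists r => //.
by rewrite /= /node_lab rl rc subn0 /ltype p1_pair p2_pair.
Qed.

(** The unary predicates along the chain are exactly those that count the children
    of type Omega in a coded tree. *)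
Lemma arith_chain (Z : set nat) (m : nat) (P : nat -> Prop) :
  arith Z (2 * m) (fun x => ~ P x) -> exists F : nat -> nat -> Prop,
  [/\ F m = P, dec Z (F 0) & forall i e, i < m ->
    F i.+1 e <-> forall a, at_least (fun b => F i (pair_code e b)) a].
Proof.
elim: m P => [|m IH] P aP.
  exists (fun _ => P); split=> //; apply: dec_ext (dec_neg aP) => x.
  by split=> [/contrapT|Px]; [|apply].
rewrite mulnS in aP; have [Q [/IH[F [Fm F0 FS]] PQ]] := arith_infinite aP.
exists (fun i => if i == m.+1 then P else F i); rewrite eqxx; split=> // i e.
rewrite ltnS leq_eqVlt => /orP[/eqP->|im].
  by rewrite eqxx PQ (ltn_eqF (ltnSn m)) Fm.
by rewrite eqSS (ltn_eqF im) (ltn_eqF (leqW im)); apply: FS.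
Qed.

Section Copies.
Variables (Z : set nat) (m : nat).
Hypothesis m_gt0 : 0 < m.
Let J := iter_jump (2 * m) Z.

(** The Pi_2m predicate below is the complement of the jump, padded with
    infinitely many true instances so that the root of the tree built from it
    has type Omega. *)
Let P x := p1 (p2 x) = 0 \/ ~ J (p2 (p2 x)).

Let aP : arith Z (2 * m) (fun x => ~ P x).
Proof.
have aJ : arith Z (2 * m) (fun x => J (p2 (p2 x))).
  by apply: (arith_comp (arith_iter_jump Z (2 * m))); comp.
have : arith Z (2 * m) (fun x => ~ (p1 (p2 x) = 0) /\ J (p2 (p2 x))).
  by apply: arith_and aJ; apply: arith_dec; comp.
by apply: arith_ext => x; rewrite /P not_orE notK.
Qed.

Variable A : ltree m.+1.
Hypothesis A_countable : countable [set: A].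
Hypothesis A_root : exists2 r : A, is_root r & lb r = Omega.

(** In one copy the children of the root carry the instances of a Pi_2m
    predicate, in the other their types are visible from their codes; an isomorphism
    therefore decides the predicate. *)
Lemma copies_compute_jump : exists T S : nat_structure,
  computable_copy Z A T /\ computable_copy Z A S /\
  forall f : T -> S, isomorphism f -> map_computes f J.
Proof.
have [F [Fm F0 FS]] := arith_chain aP.
have [r rr rO] := A_root.
(* The code (2, 0) counts the b such that F m (0, b), and (0, 0) stands for
   Omega. *)
pose cT := pair_code 2 0; pose cS := pair_code 0 0.
pose T := coded_ltree cT FS; pose S := coded_ltree cS FS.
have [rT rrT [rTl rTc]] := node_root F m cT.
have [rS rrS [rSl rSc]] := node_root F m cS.
have rTO : lb (rT : T) = Omega.
  rewrite /= /node_lab rTl rTc subn0 /ltype p1_pair p2_pair /=.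
  apply: counted_uniq (cardP _) _; apply/counted_omega => a.
  apply: (at_least_inj (f := fun b => pair_code 0 b)) (at_least_nat a).
    by move=> b _; rewrite Fm; left; rewrite p2_pair p1_pair.
  by move=> b b' _ _ /pair_inj[].
have rSO : lb (rS : S) = Omega.
  by rewrite /= /node_lab rSl rSc subn0 /ltype p1_pair.
exists (coded_tree F m.+1 cT), (coded_tree F m.+1 cS); split.
  split; first exact: coded_tree_computable.
  by apply: (@ltree_iso m.+1 A T r rT) => //; [exact: node_countable|rewrite rO].
split.
  split; first exact: coded_tree_computable.
  by apply: (@ltree_iso m.+1 A S r rS) => //; [exact: node_countable|rewrite rO].
(* The node of level one whose type is Omega unless i lies in the jump. *)
move=> f fi; pose g i := pair_code 1 (pair_code 0 (pair_code 0 (pair_code 1 i))).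
have codeT i : code_at F m.+1 cT 1 (pair_code 0 (pair_code 0 (pair_code 1 i))) =
    (pair_code 2 (pair_code 0 (pair_code 1 i))).+1.
  by rewrite code_at1 childE // /cT !(p1_pair, p2_pair).
have /choice[x xE] : forall i, exists x : T, sval x = g i.
  by move=> i; apply: node_ex => //; rewrite codeT.
have xlab i : lb (x i : T) = Omega <-> ~ J i.
  rewrite /= /node_lab /node_code /node_lev xE /g p1_pair p2_pair codeT.
  have m1 : m.-1 < m by rewrite prednK.
  have := ltype_coded FS (pair_code 0 (pair_code 1 i)) m1; rewrite prednK //.
  rewrite subSS subn0 => ->; rewrite Fm /P !(p1_pair, p2_pair).
  by split=> [[//|//]|nJ]; right.
have ylab (y : S) : lv y = 1 -> lb y = Omega <-> p1 (p2 (p2 (sval y))) = 0.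
  rewrite /= /node_lev => y1; have [_] := proj2_sig y.
  rewrite /node_lab /node_code /node_lev y1 => yc.
  have y0 : p1 (p2 (sval y)) = 0 := code_at_root yc.
  rewrite -[p2 (sval y)]pair_p.
  rewrite y0 code_at1 p2_pair subSS subn0 childE // /cS p1_pair.
  move: (p2 (p2 (sval y))) => j; rewrite -(prednK m_gt0); case: eqP => j0 /=; first by [].
  by rewrite p1_pair p2_pair.
have fE i : ~ J i <-> p1 (p2 (p2 (sval (f (x i))))) = 0.
  have [fl fb] := labelled_iso fi (ltP T) (ltP S) (x i).
  rewrite -ylab; last by rewrite [LHS]fl /= /node_lev xE p1_pair.
  by rewrite -xlab -[lb (x i : T)]fb.
(* The image of that node is found by search in the graph, and the index of a
   level-one node of the second copy shows whether its type is Omega. *)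
apply: dec_Turing; set G := graph f.
have cy : computable G (fun i => sval (f (x i))).
  have dG : dec G G := dec_oracle G.
  apply: (@computable_min G (fun i n => ~~ `[< G (pair_code (g i) n) >] : nat)).
  - have : decb G (fun z => `[< G (pair_code (g (p1 z)) (p2 z)) >]).
      by apply: (computable_comp dG (g := fun z => pair_code (g (p1 z)) (p2 z)));
        rewrite /g; comp.
    by move=> d; comp.
  - by move=> i; case: asboolP => // -[]; exists (x i); rewrite xE.
  - move=> i n ni; case: asboolP => // -[u /pair_inj[ug nf]].
    have ux : u = x i by apply: sval_inj; rewrite -ug xE.
    by move: ni; rewrite nf ux ltnn.
apply: (dec_ext (P := fun i => ~ (p1 (p2 (p2 (sval (f (x i))))) = 0))); last by comp.
by move=> i; rewrite -fE notK.
Qed.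

End Copies.

Theorem theorem1p2 (m : nat) (hm : 1 <= m) (A : structure)
    (hA : tree_type m.+1 Omega A) :
  (forall Z : set nat, exists T S : nat_structure,
      computable_copy Z A T /\ computable_copy Z A S /\
      forall f : T -> S, isomorphism f ->
        map_computes f (iter_jump (2 * m) Z)) /\
  (SR A (ord_of_nat (2 * m + 1)) /\
   (exists (n : nat) (v : 'I_n -> A),
      ~ Sigma_definable (ord_of_nat (2 * m)) (tuple_orbit v)) /\
   (forall (n : nat) (v : 'I_n -> A),
      Sigma_definable (ord_of_nat (2 * m + 1)) (tuple_orbit v))) /\
  (exists c : complexity, SSC A c /\
     (c = CSigma (ord_of_nat (2 * m + 1)) \/
      c = CdSigma (ord_of_nat (2 * m + 1)) \/
      c = CPi (ord_of_nat (2 * m + 2)))).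
Proof.
have [cA [lev [lab [r [lA rr rO]]]]] := tree_type_labelled hA.
pose A' : ltree m.+1 := LTree lA.
have orbits : all_orbits_Sigma A (ord_of_nat (2 * m + 1)).
  have -> : 2 * m + 1 = (2 * m.+1).-1 by lia.
  exact: (@ltree_orbits m.+1 A').
have [v nv] := @ltree_orbit_not_Sigma m A' r hm rr rO.
split; first by move=> Z; apply: (@copies_compute_jump Z m hm A') => //; exists r.
split.
  split; last by split; [exists 1, v|exact: orbits].
  split=> // b ab; have [|le] := ole_nat_total (2 * m) b; first by rewrite addn1.
  case: nv; have [phi [pS phiE]] := ab 1 v.
  have [psi psiS psiE] := Sdef_in pS le.
  by exists psi; split=> // w; rewrite psiE phiE.
exists (CPi (ord_of_nat (2 * m + 2))); split; last by right; right.
have -> : 2 * m + 2 = 2 * m.+1 by lia.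
split; first exact: (@ltree_Scott_sentence m.+1 A' r).
move=> d; apply: (@ltree_complexity_bound m.+1 A' r) => //.
exact: coded_finite_types_realized.
Qed.
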